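(* Let $r\geq0$ and let $\mathcal{A}_1=\{L_1^1,\dots,L_n^1\}$ and $\mathcal{A}_2=\{L_1^2,\dots,L_m^2\}$ be two ordered line arrangements in $\mathbb{CP}^2$, with $r\le\min(n,m)$, such that $L_i^1=L_i^2$ for all $i\leq r$, and $L_i^1\notin\mathcal{A}_2$, $L_j^2\notin\mathcal{A}_1$ for all $i>r$ and $j>r$. Let $G$ be an Abelian group, $\Lambda_1\in\mathrm{TLG}(\mathcal{A}_1,G)$ and $\Lambda_2\in\mathrm{TLG}(\mathcal{A}_2,G)$. Then $$\mathscr{L}(\mathcal{A}_1\stackrel{\circ}{\cup}\mathcal{A}_2,\Lambda_1\oplus\Lambda_2)=\mathscr{L}(\mathcal{A}_1,\Lambda_1)+\mathscr{L}(\mathcal{A}_2,\Lambda_2).$$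
   Context: **Arrangements.** A line arrangement $\mathcal{A}$ is a finite set of lines in $\mathbb{CP}^2$, assumed not to be a pencil (not all lines pass through one point). $\mathcal{Z}(\mathcal{A})=\bigcup_{L\in\mathcal{A}}L$, $M(\mathcal{A})=\mathbb{CP}^2\setminus\mathcal{Z}(\mathcal{A})$; $\mathrm{Sing}(\mathcal{A})$ is the set of points lying on at least two lines. The incidence graph $\Gamma(\mathcal{A})$ is the bipartite graph with vertices $v_P$ ($P\in\mathrm{Sing}(\mathcal{A})$) and $v_L$ ($L\in\mathcal{A}$), with an edge $(P\to L)$, oriented from $v_P$ to $v_L$, exactly when $P\in L$. **Tensor linking group.** $H_1(M(\mathcal{A});\mathbb{Z})$ is generated by the meridians $m_L$, $L\in\mathcal{A}$, with the single relation $\sum_L m_L=0$; for an Abelian group $G$, $H^1(M(\mathcal{A});G)=\mathrm{Hom}(H_1(M(\mathcal{A})),G)$. An element $\Lambda\in H^1(M(\mathcal{A});G)\otimes_{\mathbb{Z}}H_1(\Gamma(\mathcal{A});\mathbb{Z})$ is written $\Lambda=\sum_{P}\sum_{L\ni P}\lambda_{(P\to L)}\otimes(P\to L)$ with $\lambda_{(P\to L)}\in H^1(M(\mathcal{A});G)$ and $\sum_P\sum_{L\ni P}\lambda_{(P\to L)}\otimes(v_L-v_P)=0$. $\mathrm{TLG}(\mathcal{A},G)$ is the subgroup of those $\Lambda$ such that for every edge $(P\to L)$: (I) $\lambda_{(P\to L)}(m_{L'})=0$ for all $L'\in\mathcal{A}$ containing $P$; (II) $\sum_{L'\ni P'}\lambda_{(P\to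 L)}(m_{L'})=0$ for all $P'\in\mathrm{Sing}(\mathcal{A})\cap L$. **Loop linking number.** The boundary manifold $B(\mathcal{A})$ is the boundary of a regular tubular neighborhood of $\mathcal{Z}(\mathcal{A})$. It is a graph manifold over $\Gamma(\mathcal{A})$: a union of pieces $N_P$ (in the boundary of a small ball around $P$) and $N_L$ (a circle bundle over $L$ minus small discs around its singular points), with $N_P$ and $N_L$ glued along a torus $T_{P,L}$ when $P\in L$. A coherent embedding of $\Gamma(\mathcal{A})$ in $B(\mathcal{A})$ is an embedding respecting this structure: $v_P$ goes into $N_P$, $v_L$ into $N_L$, and $(P\to L)$ to an arc in $N_P\cup N_L$ crossing $T_{P,L}$ once. Let $\phi_*:H_1(\Gamma(\mathcal{A}))\to H_1(M(\mathcal{A}))$ be induced by a coherent embedding followed by the inclusion $B(\mathcal{A})\hookrightarrow M(\mathcal{A})$. For $\Lambda\in\mathrm{TLG}(\mathcal{A},G)$, $\mathscr{L}(\mathcal{A},\Lambda)=\pi\big((\mathrm{Id}\otimes \phi_* )(\Lambda)\big)\in G$, where $\pi:H^1(M(\mathcal{A});G)\otimes H_1(M(\mathcal{A});\mathbb{Z})\to G$ is the evaluation pairing. It does not depend on the coherent embedding. **Ordered union.** $\mathcal{A}_1\stackrel{\circ}{\cup}\mathcal{A}_2$ is the ordered arrangement $\{L_1^1,\dots,L_n^1,L_{r+1}^2,\dots,L_m^2\}$, ordered as listed. **Sum of tensors.** For $i=1,2$, let $f_i^*:H^1(M(\mathcal{A}_i);G)\to H^1(M(\mathcal{A}_1\stackrel{\circ}{\cup}\mathcal{A}_2);G)$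 be induced by the inclusion $M(\mathcal{A}_1\stackrel{\circ}{\cup}\mathcal{A}_2)\subset M(\mathcal{A}_i)$ (so $f_i^*(\lambda)(m_L)=\lambda(m_L)$ if $L\in\mathcal{A}_i$ and $0$ otherwise), and let $(g_i)_*:H_1(\Gamma(\mathcal{A}_i))\to H_1(\Gamma(\mathcal{A}_1\stackrel{\circ}{\cup}\mathcal{A}_2))$ be induced by the inclusion of graphs. Then $\Lambda_1\oplus\Lambda_2=(f_1^*\otimes(g_1)_* )(\Lambda_1)+(f_2^*\otimes(g_2)_* )(\Lambda_2)$, which is an element of $\mathrm{TLG}(\mathcal{A}_1\stackrel{\circ}{\cup}\mathcal{A}_2,G)$. *)

(* Defs.v *)
From HB Require Import structures.
From mathcomp Require Import all_boot all_order all_algebra.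
From mathcomp Require Import generic_quotient ring_quotient freeg complex.
From mathcomp Require Import all_classical all_reals all_analysis.

Set Implicit Arguments.
Unset Strict Implicit.
Unset Printing Implicit Defensive.

Import Order.TTheory GRing.Theory Num.Theory.
Import numFieldNormedType.Exports.

Local Open Scope classical_set_scope.
Local Open Scope quotient_scope.
Local Open Scope ring_scope.
Local Open Scope complex_scope.

Section Hom.
Variables U V : zmodType.

Definition is_zmod_morphism : {pred U -> V} := fun f => `[< zmod_morphism f >].

Lemma is_zmod_morphism_closed : zmod_closed is_zmod_morphism.
Proof.
split.
  by apply/asboolP => x y /=; rewrite /GRing.zero /= subr0.
move=> f g /asboolP hf /asboolP hg; apply/asboolP => x y.
have E u : (f - g) u = f u - g u by [].
by rewrite !E hf hg !opprB addrACA [RHS]addrACA; congr (_ + _); rewrite addrC.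
Qed.

HB.instance Definition _ :=
  GRing.isZmodClosed.Build (U -> V) is_zmod_morphism is_zmod_morphism_closed.

Record hom := Hom { hom_fun :> U -> V; _ : hom_fun \in is_zmod_morphism }.

HB.instance Definition _ := [isSub for hom_fun].
HB.instance Definition _ := [Choice of hom by <:].
HB.instance Definition _ := [SubChoice_isSubZmodule of hom by <:].

Lemma hom_is_zmod_morphism (f : hom) : zmod_morphism f.
Proof. by case: f => f /= /asboolP. Qed.

End Hom.

Lemma hom_comp_subproof (U V W : zmodType) (f : U -> V) (g : hom V W) :
  zmod_morphism f -> (g \o f) \in @is_zmod_morphism U W.
Proof.
by move=> hf; apply/asboolP => x y /=; rewrite hf hom_is_zmod_morphism.
Qed.

Section Tensor.
Variables U V : zmodType.

Definition bilinear_relations : set {freeg (U * V)} :=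
  [set z | (exists u u' v, z = << (u + u', v) >> - << (u, v) >> - << (u', v) >>)
        \/ (exists u v v', z = << (u, v + v') >> - << (u, v) >> - << (u, v') >>)].

Definition tensor_zero : {pred {freeg (U * V)}} := fun z =>
  `[< forall S : {pred {freeg (U * V)}}, zmod_closed S ->
        (forall y, bilinear_relations y -> y \in S) -> z \in S >].

Lemma tensor_zero_closed : zmod_closed tensor_zero.
Proof.
split.
  by apply/asboolP => S [S0 _] _.
move=> x y /asboolP hx /asboolP hy; apply/asboolP => S hS hr.
by case: (hS) => _; apply; [exact: hx | exact: hy].
Qed.

HB.instance Definition _ :=
  GRing.isZmodClosed.Build {freeg (U * V)} tensor_zero tensor_zero_closed.

Definition tensor := Quotient.quot tensor_zero.
HB.instance Definition _ := GRing.Zmodule.on tensor.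

Definition tensor_pure (u : U) (v : V) : tensor := \pi << (u, v) >>.

(* The map induced by a biadditive [b]; [zmodule W] is [W] seen as a module
   over the integers. *)
Definition tensor_lift (W : zmodType) (b : U -> V -> W) (t : tensor) : W :=
  fglift (fun uv => b uv.1 uv.2 : zmodule W) (repr t).

End Tensor.

Definition tensor_map (U V U' V' : zmodType) (f : U -> U') (g : V -> V')
    (t : tensor U V) : tensor U' V' :=
  tensor_lift (fun u v => tensor_pure (f u) (g v)) t.

(* Universal property: [tensor_lift b] is the homomorphism determined by [b]. *)
Section TensorLift.
Variables (U V W : zmodType) (b : U -> V -> W).
Hypothesis bl : forall v, zmod_morphism (b^~ v).
Hypothesis br : forall u, zmod_morphism (b u).

Let F : {freeg (U * V)} -> zmodule W := fglift (fun uv => b uv.1 uv.2 : zmodule W).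

Let F_pure uv : F << uv >> = b uv.1 uv.2.
Proof. by rewrite /F liftU scale1r. Qed.

Let F_morph : zmod_morphism F. Proof. exact: lift_is_additive. Qed.

Let F0 : F 0 = 0. Proof. by rewrite -[X in F X](subrr 0) F_morph subrr. Qed.

Let F_tensor_zero z : z \in @tensor_zero U V -> F z = 0.
Proof.
move=> /asboolP hz; apply/eqP.
have := hz [pred z | F z == 0]; rewrite inE; apply.
  split; first by rewrite inE F0.
  by move=> x y; rewrite !inE => /eqP hx /eqP hy; rewrite F_morph hx hy subrr.
have bD1 u u' v : b (u + u') v = b u v + b u' v.
  by have /= := bl v (u + u') u'; rewrite addrK => ->; rewrite subrK.
have bD2 u v v' : b u (v + v') = b u v + b u v'.
  by have := br u (v + v') v'; rewrite addrK => ->; rewrite subrK.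
by move=> y [] [u [u' [v ->]]]; rewrite inE !F_morph !F_pure /=
  ?bD1 ?bD2 [X in X - _]addrAC subrr add0r subrr.
Qed.

Let F_repr z : F (repr (\pi_(tensor U V) z)) = F z.
Proof.
apply/eqP; rewrite -subr_eq0 -F_morph F_tensor_zero//.
by rewrite Quotient.idealrBE reprK.
Qed.

Lemma tensor_lift_pure u v : tensor_lift b (tensor_pure u v) = b u v.
Proof. by rewrite /tensor_lift /tensor_pure -/F F_repr F_pure. Qed.

Lemma tensor_lift_is_zmod_morphism : zmod_morphism (tensor_lift b).
Proof.
move=> s t; rewrite /tensor_lift -/F -[s]reprK -[t]reprK.
by rewrite -[_ - _](raddfB \pi_(tensor U V)) !F_repr F_morph.
Qed.

End TensorLift.

Lemma freeg_morphism_eq (K : choiceType) (M : zmodType) (f g : {freeg K} -> M)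
    (c : {freeg K}) :
  zmod_morphism f -> zmod_morphism g ->
  (forall x, x \in dom c -> f << x >> = g << x >>) -> f c = g c.
Proof.
move=> fB gB fg.
pose F : {additive {freeg K} -> M} := HB.pack f (GRing.isZmodMorphism.Build _ _ f fB).
pose G : {additive {freeg K} -> M} := HB.pack g (GRing.isZmodMorphism.Build _ _ g gB).
rewrite -[f]/(F : _ -> _) -[g]/(G : _ -> _) -(freeg_sumE c) !raddf_sum.
rewrite !big_seq; apply: eq_bigr => x xc.
have -> : << coeff x c *g x >> = << x >> *~ coeff x c by rewrite freegU_mulz intz.
by rewrite !raddfMz; congr (_ *~ _); exact: fg.
Qed.

Section Singular.
Variable R : realType.

Definition std_simplex (n : nat) : set 'rV[R]_n.+1 :=
  [set x | (forall i, 0 <= x 0 i) /\ \sum_i x 0 i = 1].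
Arguments std_simplex n : clear implicits.

Definition face_row n (i : 'I_n.+2) (x : 'rV[R]_n.+1) : 'rV[R]_n.+2 :=
  \row_j (if unlift i j is Some k then x 0 k else 0).

Lemma face_row_in n (i : 'I_n.+2) (x : std_simplex n) :
  face_row i (\val x) \in std_simplex n.+1.
Proof.
case: x => x /= /set_mem [x0 x1]; apply/mem_set; split.
  by move=> j; rewrite mxE; case: unliftP.
rewrite (bigD1_ord i)//= mxE unlift_none add0r -x1.
by apply: eq_bigr => k _; rewrite mxE liftK.
Qed.

Definition face n (i : 'I_n.+2) (x : std_simplex n) : std_simplex n.+1 :=
  SigSub (face_row_in i x).

Lemma face_continuous n (i : 'I_n.+2) : continuous (@face n i).
Proof.
apply: (@continuous_comp_initial _ _ _ set_val) => x.
apply: (@continuous_comp _ _ _ set_val (face_row i)); first exact: initial_continuous.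
move=> P [Q hQ hP].
pose F := nbhs (set_val x : 'rV[R]_n.+1).
have FF : Filter F by exact: nbhs_filter.
have H (k : 'I_1) (j : 'I_n.+2) :
    F (fun y => Q k j (face_row i y k j)).
  have := hQ k j; rewrite mxE; case E : (unlift i j) => [l|] hQl; last first.
    by apply: (@nearW _ F) => y; rewrite mxE E; exact: nbhs_singleton.
  have /(_ _ hQl) := @coord_continuous R 1 n.+1 0 l (set_val x).
  by apply: (@filterS _ F _) => y; rewrite /= mxE E.
have := @filter_forall _ _ _ F FF (fun k => @filter_forall _ _ _ F FF (H k)).
by apply: (@filterS _ F _) => y hy; apply: hP => k j; exact: hy.
Qed.

Variable X : topologicalType.

Definition sing (n : nat) := continuousType (std_simplex n) X.

Definition chain (n : nat) := {freeg (sing n)}.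

Definition sing_face n (i : 'I_n.+2) (s : sing n.+1) : sing n :=
  s \o mkcts (@face_continuous n i).

Definition boundary n : chain n.+1 -> chain n :=
  fglift (fun s => \sum_(i < n.+2) (-1) ^+ i *: << sing_face i s >>).

Lemma boundary_is_zmod_morphism n : zmod_morphism (@boundary n).
Proof. exact: lift_is_additive. Qed.

Definition chain_in n (A : set X) (c : chain n) : Prop :=
  forall s : sing n, s \in dom c -> range s `<=` A.

Lemma chain_in0 n A : @chain_in n A 0.
Proof. by move=> s; rewrite dom0. Qed.

Lemma chain_inB n A (c d : chain n) :
  chain_in A c -> chain_in A d -> chain_in A (c - d).
Proof.
by move=> hc hd s /domB; rewrite mem_cat => /orP[/hc|/hd].
Qed.

Lemma chain_in_sub n (A B : set X) (c : chain n) :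
  A `<=` B -> chain_in A c -> chain_in B c.
Proof. by move=> AB hc s /hc sA; exact: subset_trans sA AB. Qed.

Definition is_cycle (A : set X) : {pred chain 1} :=
  fun c => `[< chain_in A c /\ boundary c = 0 >].

Lemma is_cycle_closed A : zmod_closed (is_cycle A).
Proof.
have b0 : @boundary 0 0 = 0.
  by rewrite -[X in boundary X](subrr 0) boundary_is_zmod_morphism subrr.
split; first by apply/asboolP; split=> //; exact: chain_in0.
move=> c d /asboolP[cA c0] /asboolP[dA d0]; apply/asboolP; split.
  exact: chain_inB.
by rewrite boundary_is_zmod_morphism c0 d0 subrr.
Qed.

HB.instance Definition _ A :=
  GRing.isZmodClosed.Build (chain 1) (is_cycle A) (is_cycle_closed A).

Record cycle1 (A : set X) := Cycle1 { cycle_val : chain 1; _ : cycle_val \in is_cycle A }.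

HB.instance Definition _ A := [isSub for @cycle_val A].
HB.instance Definition _ A := [Choice of cycle1 A by <:].
HB.instance Definition _ A := [SubChoice_isSubZmodule of cycle1 A by <:].

Definition is_boundary (A : set X) : {pred cycle1 A} :=
  fun z => `[< exists b : chain 2, chain_in A b /\ boundary b = \val z >].

Lemma is_boundary_closed A : zmod_closed (@is_boundary A).
Proof.
split.
  apply/asboolP; exists 0; split; first exact: chain_in0.
  by rewrite -[X in boundary X](subrr 0) boundary_is_zmod_morphism subrr raddf0.
move=> y z /asboolP[b [bA by_]] /asboolP[c [cA cz]]; apply/asboolP.
exists (b - c); split; first exact: chain_inB.
by rewrite boundary_is_zmod_morphism by_ cz raddfB.
Qed.

HB.instance Definition _ A :=
  GRing.isZmodClosed.Build (cycle1 A) (@is_boundary A) (is_boundary_closed A).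

Definition H1 (A : set X) := Quotient.quot (@is_boundary A).
HB.instance Definition _ A := GRing.Zmodule.on (H1 A).

Definition homology_class (A : set X) (z : cycle1 A) : H1 A := \pi_(H1 A) z.

Lemma is_cycle_sub (A B : set X) (z : cycle1 A) :
  A `<=` B -> \val z \in is_cycle B.
Proof.
case: z => z /= /asboolP[zA z0] AB; apply/asboolP; split=> //.
exact: chain_in_sub zA.
Qed.

Definition H1_incl (A B : set X) (AB : A `<=` B) (h : H1 A) : H1 B :=
  homology_class (Cycle1 (is_cycle_sub (repr h) AB)).

Lemma H1_incl_is_zmod_morphism (A B : set X) (AB : A `<=` B) :
  zmod_morphism (H1_incl AB).
Proof.
pose F (z : cycle1 A) : cycle1 B := Cycle1 (is_cycle_sub z AB).
have FB y z : F (y - z) = F y - F z.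
  by apply: val_inj; rewrite raddfB /=; exact: (raddfB (\val : cycle1 A -> chain 1)).
have F_repr z : \pi_(H1 B) (F (repr (\pi_(H1 A) z))) = \pi_(H1 B) (F z).
  apply/eqP; rewrite -Quotient.idealrBE -FB; apply/asboolP => /=.
  have : repr (\pi_(H1 A) z) - z \in @is_boundary A.
    by rewrite Quotient.idealrBE reprK.
  move=> /asboolP[b [bA bz]]; exists b; split=> //.
  exact: chain_in_sub bA.
move=> g h; rewrite /H1_incl /homology_class -[g]reprK -[h]reprK.
by rewrite -[_ - _](raddfB \pi_(H1 A)) !F_repr FB raddfB.
Qed.

(* H_0 is free, so there is no Ext term. *)
Definition coH1 (A : set X) (G : zmodType) := hom (H1 A) G.

Definition coH1_restrict (A B : set X) (AB : A `<=` B) (G : zmodType)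
    (l : coH1 B G) : coH1 A G :=
  Hom (hom_comp_subproof l (H1_incl_is_zmod_morphism AB)).

End Singular.

Arguments std_simplex R n : clear implicits.

HB.instance Definition _ (R : realType) := PseudoPointedMetric.copy R[i] R[i]^o.
HB.instance Definition _ (R : realType) := NormedModule.copy R[i] R[i]^o.

Section ProjectivePlane.
Variable R : realType.

Definition nonzero_vectors : set 'rV[R[i]]_3 := [set v | v != 0].

Definition collinear : rel nonzero_vectors :=
  fun v w => (\val v == \val w)%MS.

Lemma collinear_is_equiv : equiv_class_of collinear.
Proof.
split=> [v|v w|w v u].
- by rewrite /collinear; apply/eqmxP.
- by rewrite /collinear andbC.
- move=> /eqmxP vw /eqmxP wu; apply/eqmxP; exact: eqmx_trans vw wu.
Qed.

Canonical collinear_equiv := EquivRelPack collinear_is_equiv.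
Canonical collinear_encModRel := defaultEncModRel collinear.

Definition CP2 := quotient_topology {eq_quot collinear}.
HB.instance Definition _ := Topological.on CP2.
HB.instance Definition _ := Quotient.on CP2.

Definition coords (p : CP2) : 'rV[R[i]]_3 := \val (repr p).

Lemma ones_nonzero : (const_mx 1 : 'rV[R[i]]_3) \in nonzero_vectors.
Proof.
apply/mem_set => /=; apply/eqP => /matrixP/(_ 0 0).
by rewrite !mxE; apply/eqP; exact: oner_neq0.
Qed.

(* Only meaningful when [v != 0]. *)
Definition proj (v : 'rV[R[i]]_3) : CP2 :=
  \pi_CP2 (insubd (SigSub ones_nonzero : nonzero_vectors) v).

Lemma proj_coords p : proj (coords p) = p.
Proof. by rewrite /proj /coords valKd reprK. Qed.

(* A line is represented by the point of the dual plane given by the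
   coefficients of an equation of it. *)
Definition line := CP2.

Definition pairing (a v : 'rV[R[i]]_3) : R[i] := \sum_i a 0 i * v 0 i.

Definition on_line (p : CP2) (L : line) : bool :=
  pairing (coords L) (coords p) == 0.

Definition hnorm (v : 'rV[R[i]]_3) : R :=
  Num.sqrt (\sum_i Normc.normc (v 0 i) ^+ 2).

(* The sine of the Fubini-Study distance between two points, resp. between a
   point and a line. *)
Definition point_dist (p q : CP2) : R :=
  Num.sqrt (1 - (Normc.normc (pairing (coords p) (map_mx conjc (coords q)))
                 / (hnorm (coords p) * hnorm (coords q))) ^+ 2).

Definition line_dist (p : CP2) (L : line) : R :=
  Normc.normc (pairing (coords L) (coords p)) / (hnorm (coords L) * hnorm (coords p)).

End ProjectivePlane.

Section Arrangement.
Variable R : realType.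
Implicit Types (A B : seq (line R)) (p P : CP2 R) (L : line R).

Definition arrangement A : Prop :=
  uniq A /\ ~ exists P, forall L, L \in A -> on_line P L.

Definition complement A : set (CP2 R) :=
  [set p | forall L, L \in A -> ~~ on_line p L].

Definition Sing A : set (CP2 R) :=
  [set P | exists L L', [/\ L \in A, L' \in A, L != L', on_line P L & on_line P L']].

Lemma complement_sub A B : {subset A <= B} -> complement B `<=` complement A.
Proof. by move=> AB p pB L /AB; exact: pB. Qed.

Definition incidence_edge A (P : CP2 R) (L : line R) : Prop :=
  [/\ Sing A P, L \in A & on_line P L].

Lemma incidence_edge_sub A B P L :
  {subset A <= B} -> incidence_edge A P L -> incidence_edge B P L.
Proof.
move=> AB [[K [K' [KA KA' KK' PK PK']]] LA PL]; split=> //; last exact: AB.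
by exists K, K'; split=> //; exact: AB.
Qed.

(* 1-chains and boundary: the vertices are [inl P] for points and [inr L] for
   lines, and the pair [(P, L)] is the edge oriented from [P] to [L]. *)
Definition graph_boundary (c : {freeg (CP2 R * line R)}) : {freeg (CP2 R + line R)} :=
  fglift (fun e => << inr e.2 >> - << inl e.1 >>) c.

Lemma graph_boundary_is_zmod_morphism : zmod_morphism graph_boundary.
Proof. exact: lift_is_additive. Qed.

Definition is_graph_cycle A : {pred {freeg (CP2 R * line R)}} := fun c =>
  `[< (forall e, e \in dom c -> incidence_edge A e.1 e.2) /\ graph_boundary c = 0 >].

Lemma is_graph_cycle_closed A : zmod_closed (is_graph_cycle A).
Proof.
split.
  apply/asboolP; split; first by move=> e; rewrite dom0.
  by rewrite -[X in graph_boundary X](subrr 0) graph_boundary_is_zmod_morphism subrr.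
move=> c d /asboolP[cA c0] /asboolP[dA d0]; apply/asboolP; split.
  by move=> e /domB; rewrite mem_cat => /orP[/cA|/dA].
by rewrite graph_boundary_is_zmod_morphism c0 d0 subrr.
Qed.

HB.instance Definition _ A := GRing.isZmodClosed.Build
  {freeg (CP2 R * line R)} (is_graph_cycle A) (is_graph_cycle_closed A).

(* The first homology group of the incidence graph: a graph has no 2-cells. *)
Record graphH1 A := GraphH1 {
  graph_cycle : {freeg (CP2 R * line R)};
  _ : graph_cycle \in is_graph_cycle A }.

HB.instance Definition _ A := [isSub for @graph_cycle A].
HB.instance Definition _ A := [Choice of graphH1 A by <:].
HB.instance Definition _ A := [SubChoice_isSubZmodule of graphH1 A by <:].

Lemma is_graph_cycle_sub A B (c : graphH1 A) :
  {subset A <= B} -> graph_cycle c \in is_graph_cycle B.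
Proof.
case: c => c /= /asboolP[cA c0] AB; apply/asboolP; split=> // e /cA.
exact: incidence_edge_sub.
Qed.

Definition graphH1_incl A B (AB : {subset A <= B}) (c : graphH1 A) : graphH1 B :=
  GraphH1 (is_graph_cycle_sub c AB).

Definition edge_param (s : std_simplex R 1) : R := (\val s) 0 ord_max.

Definition expi (t : R) : R[i] := cos t +i* sin t.

(* [v] lies on [L] and [v + u *: w], for [u] in a closed disc of radius [rho],
   parametrises a disc transverse to [L] and disjoint from the other lines of
   [A]; the meridian is its positively oriented boundary. *)
Definition is_meridian A L (m : H1 R (complement A)) : Prop :=
  exists (v w : 'rV[R[i]]_3) (rho : R) (s : sing R (CP2 R) 1)
       (z : cycle1 R (complement A)),
    [/\ v != 0, pairing (coords L) v = 0, pairing (coords L) w != 0, 0 < rho &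
     [/\ forall (u : R[i]) L', Normc.normc u <= rho -> L' \in A -> L' != L ->
           pairing (coords L') (v + u *: w) != 0,
         forall x, s x = proj (v + (rho%:C * expi (2 * pi * edge_param x)) *: w) &
         cycle_val z = << s >> /\ m = homology_class z]].

(* All meridians of [L] are homologous. *)
Definition meridian A L : H1 R (complement A) := xget 0 [set m | is_meridian L m].

Lemma coords_neq0 (p : CP2 R) : coords p != 0.
Proof. by rewrite /coords; case: (repr p) => v /= /set_mem. Qed.

Lemma coords_proj (v : 'rV[R[i]]_3) : v != 0 -> exists2 c, c != 0 & coords (proj v) = c *: v.
Proof.
move=> v0.
have : collinear (repr (proj v)) (insubd (SigSub (ones_nonzero R) : @nonzero_vectors R) v).
  by apply/eqmodP; rewrite reprK.
rewrite /collinear val_insubd mem_set// -/(coords _) => /andP[/sub_rVP[c cE] _].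
exists c => //; apply/eqP => c0; have := coords_neq0 (proj v).
by rewrite cE c0 scale0r eqxx.
Qed.

Lemma pairingZr a c (v : 'rV[R[i]]_3) : pairing a (c *: v) = c * pairing a v.
Proof. by rewrite /pairing mulr_sumr; apply: eq_bigr => i _; rewrite mxE mulrCA. Qed.

Lemma lines_meet L L' : exists P, on_line P L /\ on_line P L'.
Proof.
pose M : 'M[R[i]]_(3, 2) := \matrix_(i, j) (if j == 0 then coords L 0 i else coords L' 0 i).
have : kermx M != 0.
  rewrite -mxrank_eq0 mxrank_ker -lt0n subn_gt0.
  exact: leq_ltn_trans (rank_leq_col M) _.
move=> /matrix0Pn[i [j Kij]].
have r0 : row i (kermx M) != 0 by apply/rV0Pn; exists j; rewrite mxE.
have := row_sub i (kermx M); rewrite sub_kermx => /eqP/rowP rM.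
exists (proj (row i (kermx M))).
have [c c0 cE] := coords_proj r0.
rewrite /on_line cE !pairingZr !mulf_eq0 (negPf c0) /=; split; apply/eqP.
  have := rM 0; rewrite !mxE => <-; apply: eq_bigr => k _.
  by rewrite !mxE/= mulrC.
have := rM 1; rewrite !mxE => <-; apply: eq_bigr => k _.
by rewrite !mxE/= mulrC.
Qed.

Lemma line_dist_on_line (p : CP2 R) L : on_line p L -> line_dist p L = 0.
Proof. by rewrite /on_line /line_dist => /eqP ->; rewrite Normc.normc0 mul0r. Qed.

End Arrangement.

Section TensorLinking.
Variable R : realType.
Implicit Types (A B : seq (line R)) (P : CP2 R) (L : line R).

Definition tensor_chains A (G : zmodType) :=
  tensor (coH1 R (complement A) G) (graphH1 A).

(* For [Lam] the sum of the [l_k (x) c_k], this is the sum of the [c_k(P, L) l_k],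
   the coefficient of the edge [(P, L)]. *)
Definition edge_coeff A (G : zmodType) P L (Lam : tensor_chains A G) :
    coH1 R (complement A) G :=
  tensor_lift (fun l c => l *~ coeff (P, L) (graph_cycle c)) Lam.

Definition TLG A (G : zmodType) (Lam : tensor_chains A G) : Prop :=
  forall P L, incidence_edge A P L ->
    (forall L', L' \in A -> on_line P L' ->
       edge_coeff P L Lam (meridian A L') = 0) /\
    (forall P', Sing A P' -> on_line P' L ->
       \sum_(L' <- A | on_line P' L') edge_coeff P L Lam (meridian A L') = 0).

(* The neighbourhood of the arrangement is the union of the balls of radius
   [eps] around the singular points and of the tubes of radius [del] around the
   lines. These conditions make it a regular neighbourhood: distinct balls are
   disjoint, a ball only meets the tubes of the lines through its centre, and
   two tubes only meet inside the ball around their common point. They hold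
   whenever [eps], and then [del], are small enough. *)
Definition regular_radii A (eps del : R) : Prop :=
  [/\ 0 < del, del < eps,
      forall P Q p, Sing A P -> Sing A Q -> P != Q ->
        point_dist p P <= eps -> eps < point_dist p Q,
      forall P L p, Sing A P -> L \in A -> ~~ on_line P L ->
        point_dist p P <= eps -> del < line_dist p L &
      forall L L' P p, L \in A -> L' \in A -> L != L' ->
        on_line P L -> on_line P L' ->
        line_dist p L <= del -> line_dist p L' <= del -> point_dist p P < eps].

Definition N_point A (eps del : R) P : set (CP2 R) :=
  [set p | point_dist p P = eps /\
           forall L, L \in A -> on_line P L -> del <= line_dist p L].

Definition N_line A (eps del : R) L : set (CP2 R) :=
  [set p | line_dist p L = del /\
           forall P, Sing A P -> on_line P L -> eps <= point_dist p P].

Definition gluing_torus A eps del P L : set (CP2 R) :=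
  N_point A eps del P `&` N_line A eps del L.

Lemma N_point_complement A eps del P : regular_radii A eps del -> Sing A P ->
  N_point A eps del P `<=` complement A.
Proof.
move=> [d0 _ _ h _] SP p [pP hp] L LA; apply/negP => /line_dist_on_line pL.
have [PL|PL] := boolP (on_line P L).
  by have := hp L LA PL; rewrite pL leNgt d0.
by have := h P L p SP LA PL; rewrite pP lexx pL => /(_ isT); rewrite ltNge (ltW d0).
Qed.

Lemma N_line_complement A eps del L : regular_radii A eps del -> L \in A ->
  N_line A eps del L `<=` complement A.
Proof.
move=> [d0 _ _ _ h] LA p [pL hp] L' L'A; apply/negP => /line_dist_on_line pL'.
have [LL'|LL'] := eqVneq L L'; first by move: d0; rewrite -pL LL' pL' ltxx.
have [P [PL PL']] := lines_meet L L'.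
have := h L L' P p LA L'A LL' PL PL'; rewrite pL pL' lexx (ltW d0) => /(_ isT isT).
by rewrite ltNge hp//; exists L, L'; split.
Qed.

Record coherent_embedding A := CoherentEmbedding {
  ce_eps : R;
  ce_del : R;
  ce_radii : regular_radii A ce_eps ce_del;
  ce_point : CP2 R -> CP2 R;
  ce_line : line R -> CP2 R;
  ce_arc : CP2 R -> line R -> sing R (CP2 R) 1;
  ce_source : forall P L x, incidence_edge A P L ->
    edge_param x = 0 -> ce_arc P L x = ce_point P;
  ce_target : forall P L x, incidence_edge A P L ->
    edge_param x = 1 -> ce_arc P L x = ce_line L;
  ce_crossing : forall P L, incidence_edge A P L ->
    exists t, [/\ 0 < t, t < 1,
      forall x, edge_param x <= t -> N_point A ce_eps ce_del P (ce_arc P L x),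
      forall x, t <= edge_param x -> N_line A ce_eps ce_del L (ce_arc P L x) &
      forall x, gluing_torus A ce_eps ce_del P L (ce_arc P L x) ->
        edge_param x = t];
  ce_injective : forall P L P' L' x x',
    incidence_edge A P L -> incidence_edge A P' L' ->
    ce_arc P L x = ce_arc P' L' x' ->
    [\/ [/\ P = P', L = L' & x = x'],
        [/\ P = P', edge_param x = 0 & edge_param x' = 0] |
        [/\ L = L', edge_param x = 1 & edge_param x' = 1]]
}.

Definition embed_chain A (phi : coherent_embedding A) (c : {freeg (CP2 R * line R)}) :
    chain R (CP2 R) 1 :=
  fglift (fun e => << ce_arc phi e.1 e.2 >>) c.

Lemma ce_arc_complement A (phi : coherent_embedding A) P L :
  incidence_edge A P L -> range (ce_arc phi P L) `<=` complement A.
Proof.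
move=> e _ [x _ <-]; have [t [_ _ h1 h2 _]] := ce_crossing phi e.
case: (e) => SP LA PL; have [xt|tx] := leP (edge_param x) t.
  exact: N_point_complement (ce_radii phi) SP _ (h1 _ xt).
exact: N_line_complement (ce_radii phi) LA _ (h2 _ (ltW tx)).
Qed.

Lemma edge_param_face (x : std_simplex R 0) (i : 'I_2) :
  edge_param (face i x) = (i == 0)%:R.
Proof.
case: x => x xS; have /set_mem[_] := xS; rewrite big_ord1 => x1.
rewrite /edge_param /= mxE; case: unliftP => [j|] E.
  rewrite ord1 x1; case: (eqVneq i 0) => //= i0.
  have : i = ord_max by apply: val_inj; case: i i0 {E} => -[|[]].
  by move=> Ei; have := neq_lift i j; rewrite -E Ei eqxx.
by rewrite -E.
Qed.

Lemma embed_chain_is_cycle A (phi : coherent_embedding A) (c : graphH1 A) :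
  embed_chain phi (graph_cycle c) \in is_cycle (complement A).
Proof.
case: c => c /= /asboolP[cA c0]; apply/asboolP; split.
  move=> s; rewrite /embed_chain -{1}(Freeg_dom c) fglift_Freeg /prelift big_map.
  move=> /dom_sum_subset/flatten_mapP[e] /=; rewrite mem_filter /= => ec.
  move=> /domZ_subset; rewrite domU1 inE => /eqP ->.
  by apply: ce_arc_complement; apply: cA.
pose pt (v : CP2 R + line R) := match v with inl P => ce_point phi P | inr L => ce_line phi L end.
pose q : {freeg (CP2 R + line R)} -> chain R (CP2 R) 0 :=
  fglift (fun v => << (cst (pt v) : continuousType _ _) >>).
have qM : zmod_morphism q by exact: lift_is_additive.
suff -> : boundary (embed_chain phi c) = q (graph_boundary c).
  by rewrite c0 -[X in q X](subrr 0) qM subrr.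
apply: (@freeg_morphism_eq _ _ (fun d => boundary (embed_chain phi d)) (fun d => q (graph_boundary d))).
- move=> x y /=; rewrite -boundary_is_zmod_morphism; congr boundary.
  exact: lift_is_additive.
- by move=> x y /=; rewrite graph_boundary_is_zmod_morphism qM.
move=> [P L] /cA e /=.
rewrite /embed_chain /graph_boundary !liftU !scale1r qM /boundary /q !liftU !scale1r.
rewrite big_ord_recl big_ord1 /= expr0 expr1 scale1r scaleN1r.
congr (<< _ >> - << _ >>); apply/continuousEP => x /=.
  by apply: ce_target => //; rewrite edge_param_face.
by apply: ce_source => //; rewrite edge_param_face.
Qed.

Definition embed_star A (phi : coherent_embedding A) (c : graphH1 A) :
    H1 R (complement A) :=
  homology_class (Cycle1 (embed_chain_is_cycle phi c)).

(* For [Lam] in [TLG A G] the value does not depend on [phi]. *)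
Definition loop_linking A (G : zmodType) (phi : coherent_embedding A)
    (Lam : tensor_chains A G) : G :=
  tensor_lift (fun l h => (l : coH1 R (complement A) G) h)
    (tensor_map id (embed_star phi) Lam).

(* The first [r] lines are common, and no other line is. *)
Definition common_prefix (r : nat) A B : Prop :=
  [/\ (r <= size A)%N, (r <= size B)%N, take r A = take r B,
      forall L, L \in drop r A -> L \notin B &
      forall L, L \in drop r B -> L \notin A].

Definition ordered_union (r : nat) A B : seq (line R) := A ++ drop r B.

Lemma sub_union_l r A B : {subset A <= ordered_union r A B}.
Proof. by move=> L LA; rewrite mem_cat LA. Qed.

Lemma sub_union_r r A B :
  common_prefix r A B -> {subset B <= ordered_union r A B}.
Proof.
move=> [_ _ AB _ _] L; rewrite -{1}(cat_take_drop r B) -AB !mem_cat.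
by case/orP => [/mem_take ->//|->]; rewrite orbT.
Qed.

Definition tensor_incl A B (AB : {subset A <= B}) (G : zmodType)
    (Lam : tensor_chains A G) : tensor_chains B G :=
  tensor_map (fun l => coH1_restrict (complement_sub AB) l) (graphH1_incl AB) Lam.

Definition tensor_sum (r : nat) A1 A2 (h : common_prefix r A1 A2) (G : zmodType)
    (Lam1 : tensor_chains A1 G) (Lam2 : tensor_chains A2 G) :
    tensor_chains (ordered_union r A1 A2) G :=
  tensor_incl (@sub_union_l r A1 A2) Lam1 + tensor_incl (sub_union_r h) Lam2.

End TensorLinking.

(* Main.v *)
(* A coherent embedding for the union restricts, up to the crossing conditions, to an
   embedding of the graph of each A_i in the same kind of neighbourhood, so it
   suffices that the loop linking number does not depend on the embedding.

   Every 1-cycle in the complement of A is homologous to a combination of meridians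
   of the lines other than a fixed L0, and the coefficient of L is the winding
   number of L/L0 along the cycle. To see this, paths are replaced by cones over
   polygons, so that only triangles remain; a generic triangle is cut by chords
   until it is met by at most one line.

   For two embeddings and a line L', the windings along the two images of an
   edge (P, L), corrected by angles at the vertices, differ by an integer. In N_P
   and in N_L the quotient of two equations L', L'' of lines that do not contain P
   but meet L in the same point Q stays in a half plane around its constant value on L,
   so this integer depends on L' only through Q. Condition (II) at Q and
   condition (I) then cancel the contribution of the edge to the difference of
   the two linking numbers. *)

Require Import Defs.
From HB Require Import structures.
From mathcomp Require Import all_boot all_order all_algebra.
From mathcomp Require Import generic_quotient ring_quotient freeg complex.
From mathcomp Require Import all_classical all_reals all_analysis.
From mathcomp Require Import ring lra.
Require Import Defs.

Set Implicit Arguments.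
Unset Strict Implicit.
Unset Printing Implicit Defensive.

Import Order.TTheory GRing.Theory Num.Theory.
Import numFieldNormedType.Exports.

Local Open Scope classical_set_scope.
Local Open Scope quotient_scope.
Local Open Scope ring_scope.
Local Open Scope complex_scope.

(** * Continuity in homogeneous coordinates *)

Section Continuity.
Variable R : realType.
Implicit Types (T : topologicalType).

(** Only quotients of line equations are functions on the plane, so one line L0 serves as common
    denominator and as line at infinity. A vertex has different images under the two embeddings, so
    the raw difference of the windings along an edge need not be a multiple of 2 pi. Angles attached
    to the vertices with the right exponentials repair this and cancel along a cycle; the difficulty
    is to choose them so that the integer is the same for all lines through Q that miss P. Principal
    arguments do it where quotients stay in a half plane, because there the argument of a quotient
    is the difference of the arguments. The half planes come from the metric conditions on the
    radii: if the perturbation of L' were as large as its main value, rescaling one orthogonal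
    component would give a point of L' in a ball that L' must miss, or a point of two tubes outside
    the ball around their intersection. For lines through P no half plane is available, and
    condition (I) removes their terms. *)

Lemma Re_continuous : continuous (@complex.Re R : R[i] -> R).
Proof.
move=> z; apply/(@cvgrPdist_lt _ R^o _ _ (nbhs_filter z)) => e e0.
have e0C : 0 < e%:C by rewrite ltcR.
have H : nbhs z (fun w => `|z - w| < e%:C) by apply/nbhs_ballP; exists e%:C.
apply: (@filterS _ _ (nbhs_filter z) _ _ _ H) => w.
rewrite -ltcR; apply: le_lt_trans.
have -> : complex.Re z - complex.Re w = complex.Re (z - w) by case: (z) => ? ?; case: (w).
exact: normc_ge_Re.
Qed.

Lemma Im_continuous : continuous (@complex.Im R : R[i] -> R).
Proof.
have -> : @complex.Im R = (fun z => complex.Re (z * (- 'i%C))).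
  have ReN (w : R[i]) : complex.Re (- w) = - complex.Re w by case: w.
  by apply/funext => z; rewrite mulrN ReN ReiNIm opprK.
move=> z; apply: (@continuous_comp _ _ _ (fun z : R[i] => z * - 'i%C)); last exact: Re_continuous.
apply: (@cvgM R[i] _ (nbhs z) (nbhs_filter z) id (fun=> - 'i%C) z (- 'i%C)); [exact: cvg_id|exact: cvg_cst].
Qed.

Lemma real_complex_continuous : continuous (fun x : R => x%:C).
Proof.
move=> x; apply/(@cvgrPdist_lt _ R[i]^o _ _ (nbhs_filter x)) => e e0.
have [_ eR] : complex.Im e = 0 /\ (complex.Re e)%:C = e.
  by case: e e0 => a b; rewrite ltcE /= => /andP[/eqP -> _].
near=> y.
rewrite -rmorphB /= normc_def /= expr0n addr0 sqrtr_sqr -eR ltcR.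
near: y; apply: (@cvgr_dist_lt _ _ _ (nbhs x) _ id x); first exact: cvg_id.
by rewrite -ltcR eR.
Unshelve. all: by end_near. Qed.

Lemma cvg_complex T (F : set_system T) (FF : Filter F) (f g : T -> R) a b :
  f @ F --> a -> g @ F --> b ->
  (fun t => f t +i* g t) @ F --> (a +i* b : R[i]).
Proof.
move=> fa gb.
have E (x y : R) : x +i* y = x%:C + 'i%C * y%:C by rewrite [LHS]complexE.
rewrite E (_ : (fun t => _) = (fun t => (f t)%:C + 'i%C * (g t)%:C)); last first.
  by apply/funext => t; rewrite E.
apply: (@cvgD _ R[i]^o); last apply: (@cvgM R[i]).
- exact: (continuous_cvg _ (@real_complex_continuous a) fa).
- exact: cvg_cst.
- exact: (continuous_cvg _ (@real_complex_continuous b) gb).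
Qed.

Lemma cvg_mx T (K : topologicalType) m n (F : set_system T) (FF : Filter F) (f : T -> 'M[K]_(m, n)) (A : 'M[K]_(m, n)) :
  (forall i j, (fun t => f t i j) @ F --> A i j) -> f @ F --> A.
Proof.
move=> h P [Q hQ hP].
have H i j : F (fun t => Q i j (f t i j)) by exact: h (hQ i j).
have := @filter_forall _ _ _ F FF (fun i => @filter_forall _ _ _ F FF (H i)).
by apply: (@filterS _ F _) => y hy; apply: hP => k j; exact: hy.
Qed.

End Continuity.

(** * Linear forms on homogeneous coordinates, and affine charts *)

Section Pairing.
Variable R : realType.
Implicit Types (a v w : 'rV[R[i]]_3) (L : line R).

Lemma pairingD a v w : pairing a (v + w) = pairing a v + pairing a w.
Proof. by rewrite /pairing -big_split; apply: eq_bigr => i _; rewrite mxE mulrDr. Qed.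

Lemma pairingN a v : pairing a (- v) = - pairing a v.
Proof. by rewrite -scaleN1r pairingZr mulN1r. Qed.

Lemma pairingB a v w : pairing a (v - w) = pairing a v - pairing a w.
Proof. by rewrite pairingD pairingN. Qed.

Lemma pairing0 a : pairing a 0 = 0.
Proof. by rewrite -(scale0r (0 : 'rV_3)) pairingZr mul0r. Qed.

Lemma pairingC a v : pairing a v = pairing v a.
Proof. by apply: eq_bigr => i _; rewrite mulrC. Qed.

Definition pairingE := (pairingD, pairingN, pairingZr, pairing0).

Lemma on_line_proj v L : v != 0 -> on_line (proj v) L = (pairing (coords L) v == 0).
Proof.
move=> v0; rewrite /on_line; have [c c0 ->] := coords_proj v0.
by rewrite pairingZr mulf_eq0 (negPf c0).
Qed.

Lemma projZ c v : c != 0 -> v != 0 -> proj (c *: v) = proj v.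
Proof.
move=> c0 v0; have cv0 : c *: v != 0 by rewrite scaler_eq0 negb_or c0.
rewrite /proj; apply/eqmodP; rewrite /equiv/= /collinear !val_insubd !mem_set//.
by apply/eqmxP; exact: eqmx_scale.
Qed.

Lemma pairing_neq0 a v : pairing a v != 0 -> v != 0.
Proof. by apply: contraNneq => ->; rewrite pairing0. Qed.

(** [coords] is an arbitrary choice of representative without any continuity; dividing by the value
    of L gives a representative that is continuous off L. *)
Definition chart L (p : CP2 R) : 'rV[R[i]]_3 := (pairing (coords L) (coords p))^-1 *: coords p.

Lemma chart1 L p : ~~ on_line p L -> pairing (coords L) (chart L p) = 1.
Proof. by move=> h; rewrite pairingZr mulVf. Qed.

Lemma proj_chart L p : ~~ on_line p L -> proj (chart L p) = p.
Proof. by move=> h; rewrite projZ ?invr_eq0 ?coords_neq0// proj_coords. Qed.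

Lemma chart_proj L v : pairing (coords L) v != 0 ->
  chart L (proj v) = (pairing (coords L) v)^-1 *: v.
Proof.
move=> h; rewrite /chart; have [c c0 ->] := coords_proj (pairing_neq0 h).
by rewrite pairingZr scalerA invfM mulrAC mulVf// mul1r.
Qed.

Lemma pairing_chart_neq0 L L' p : ~~ on_line p L -> ~~ on_line p L' ->
  pairing (coords L') (chart L p) != 0.
Proof. by move=> pL pL'; rewrite pairingZr mulf_neq0 ?invr_eq0. Qed.

End Pairing.

(** * Continuity of the projection to the plane and of the charts *)

Section ProjContinuity.
Variable R : realType.
Local Notation C := R[i].
Implicit Types (T : topologicalType) (a v w : 'rV[R[i]]_3) (L : line R).

Lemma eq_cts T (U : topologicalType) (f g : T -> U) x : f =1 g ->
  {for x, continuous f} -> {for x, continuous g}.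
Proof. by move=> /funext ->. Qed.

Lemma ctsD T (f g : T -> C) x : {for x, continuous f} -> {for x, continuous g} ->
  {for x, continuous (fun t => f t + g t)}.
Proof. by move=> fx gx; exact: (@cvgD _ R[i]^o _ (nbhs x) (nbhs_filter x) _ _ _ _ fx gx). Qed.

Lemma ctsM T (f g : T -> C) x : {for x, continuous f} -> {for x, continuous g} ->
  {for x, continuous (fun t => f t * g t)}.
Proof. by move=> fx gx; exact: (@cvgM R[i] _ (nbhs x) (nbhs_filter x) _ _ _ _ fx gx). Qed.

Lemma ctsV T (f : T -> C) x : f x != 0 -> {for x, continuous f} ->
  {for x, continuous (fun t => (f t)^-1)}.
Proof. by move=> f0 fx; exact: (@cvgV R[i] _ (nbhs x) (nbhs_filter x) _ _ f0 fx). Qed.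

Lemma cts_cst T (U : topologicalType) (c : U) (x : T) : {for x, continuous (fun=> c)}.
Proof. exact: cvg_cst. Qed.

Lemma cts_complex T (f g : T -> R) x : {for x, continuous f} -> {for x, continuous g} ->
  {for x, continuous (fun t => f t +i* g t)}.
Proof. by move=> fx gx; exact: (cvg_complex (nbhs_filter x) fx gx). Qed.

Lemma cts_comp T (U V : topologicalType) (f : T -> U) (g : U -> V) x :
  {for x, continuous f} -> {for f x, continuous g} -> {for x, continuous (fun t => g (f t))}.
Proof. by move=> fx gx; exact: continuous_comp. Qed.

Lemma ctsC T (f : T -> R) x : {for x, continuous f} -> {for x, continuous (fun t => (f t)%:C)}.
Proof. by move=> fx; exact: (cts_comp fx (@real_complex_continuous _ _)). Qed.

Lemma cts_rowP T n (f : T -> 'rV[C]_n) x :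
  {for x, continuous f} <-> forall j, {for x, continuous (fun t => f t 0 j)}.
Proof.
split=> h; last by apply: cvg_mx => i j; rewrite ord1; exact: h.
by move=> j; apply: (@cts_comp _ _ _ f (fun M : 'rV[C]_n => M 0 j)) => //; exact: coord_continuous.
Qed.

Lemma cts_addv T n (f g : T -> 'rV[C]_n) x : {for x, continuous f} -> {for x, continuous g} ->
  {for x, continuous (fun t => f t + g t)}.
Proof.
move=> /cts_rowP fx /cts_rowP gx; apply/cts_rowP => j.
by apply: eq_cts (ctsD (fx j) (gx j)) => t; rewrite mxE.
Qed.

Lemma cts_scalev T n (c : T -> C) (f : T -> 'rV[C]_n) x :
  {for x, continuous c} -> {for x, continuous f} ->
  {for x, continuous (fun t => c t *: f t)}.
Proof.
move=> cx /cts_rowP fx; apply/cts_rowP => j.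
by apply: eq_cts (ctsM cx (fx j)) => t; rewrite mxE.
Qed.

Lemma cts_pairing T a (f : T -> 'rV[C]_3) x :
  {for x, continuous f} -> {for x, continuous (fun t => pairing a (f t))}.
Proof.
move=> /cts_rowP fx.
have h (j : 'I_3) : {for x, continuous (fun t => a 0 j * f t 0 j)}.
  by apply: ctsM; [exact: cts_cst|exact: fx].
apply: eq_cts (ctsD (h 0) (ctsD (h 1) (h ord_max))) => t.
rewrite /pairing big_ord_recl big_ord_recl big_ord1.
by congr (_ + (_ + _)); congr (_ * _); congr (_ 0 _); apply: val_inj.
Qed.

Lemma neq0_nbhs T (U : topologicalType) (f : T -> U) x (c : U) : hausdorff_space U ->
  {for x, continuous f} -> f x != c -> \forall t \near x, f t != c.
Proof.
move=> hU fx fc.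
have o : open [set y : U | y != c].
  rewrite (_ : [set y | _] = ~` [set c]); last first.
    by apply/seteqP; split=> y /=; [move/eqP|move=> /eqP].
  by apply: closed_openC; apply: compact_closed => //; exact: compact_set1.
exact: (fx _ (open_nbhs_nbhs (conj o (fc : [set y : U | y != c] (f x))))).
Qed.

Lemma complex_hausdorff : hausdorff_space R[i].
Proof. exact: (@norm_hausdorff _ R[i]^o). Qed.

Lemma cts_neq0 T n (f : T -> 'rV[C]_n) x : {for x, continuous f} -> f x != 0 ->
  \forall t \near x, f t != 0.
Proof.
move=> fx /rV0Pn[j f0]; have /cts_rowP/(_ j) fj := fx.
have := neq0_nbhs complex_hausdorff fj f0.
apply: (@filterS _ _ (nbhs_filter x)) => t h; apply/rV0Pn; by exists j.
Qed.

Lemma cts_proj T (f : T -> 'rV[C]_3) x : f x != 0 -> {for x, continuous f} ->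
  {for x, continuous (fun t => proj (f t))}.
Proof.
move=> f0 fx.
pose F t : @nonzero_vectors R := insubd (SigSub (ones_nonzero R) : @nonzero_vectors R) (f t).
suff h : {for x, continuous F}.
  exact: (cts_comp h (@pi_continuous _ {eq_quot (@collinear R)} (F x))).
rewrite /F.
move=> U; rewrite /nbhs/= => -[_ [[W oW <-] /= Wx WU]].
move: Wx; rewrite -[set_val _]/(\val _) val_insubd mem_set// => Wx.
have h1 : \forall t \near x, W (f t) by apply: fx; exact: open_nbhs_nbhs.
(* [insubd] returns [f t] only where [f t] is nonzero, which holds near x. *)
have h2 := cts_neq0 fx f0.
have FF := nbhs_filter x.
apply: (@filterS2 _ _ FF _ _ _ _ h1 h2) => t Wt t0; apply: WU => /=.
by rewrite -[set_val _]/(\val _) val_insubd mem_set.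
Qed.

Lemma cts_normalize T a (f : T -> 'rV[C]_3) x : pairing a (f x) != 0 -> {for x, continuous f} ->
  {for x, continuous (fun t => (pairing a (f t))^-1 *: f t)}.
Proof.
move=> h fx; apply: cts_scalev => //; apply: ctsV => //; exact: cts_pairing.
Qed.

(** In the quotient topology a set is open when its preimage among the nonzero vectors is, and
    upstairs the chart is the explicit map v / L(v). *)
Lemma chart_continuous L p : ~~ on_line p L -> {for p, continuous (chart L)}.
Proof.
move=> pL V; rewrite nbhsE => -[W [oW Wp] WV].
rewrite nbhsE; exists [set q | ~~ on_line q L /\ W (chart L q)]; last first.
  by move=> q [_ /WV].
split=> //; rewrite /open/= /quotient_open.
have vin (v : @nonzero_vectors R) : \pi_(CP2 R) v = proj (\val v).
  by rewrite /proj valKd.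
have v0 (v : @nonzero_vectors R) : \val v != 0 by case: v => v /= /set_mem.
rewrite openE => v /= [].
rewrite vin on_line_proj// => vL; rewrite chart_proj// => Wv.
have c1 : {for v, continuous (fun v : @nonzero_vectors R => \val v : 'rV[C]_3)}.
  exact: initial_continuous.
have h1 := @cts_normalize _ (coords L) _ v vL c1 _ (open_nbhs_nbhs (conj oW Wv)).
have h2 := neq0_nbhs complex_hausdorff (@cts_pairing _ (coords L) _ v c1) vL.
have FF := nbhs_filter v.
rewrite /interior; apply: (@filterS2 _ _ FF _ _ _ _ h1 h2) => w /= Ww wL.
by rewrite vin on_line_proj// chart_proj.
Qed.

Lemma cts_chart T (s : T -> CP2 R) L x : ~~ on_line (s x) L ->
  {for x, continuous s} -> {for x, continuous (fun t => chart L (s t))}.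
Proof. by move=> h sx; exact: (cts_comp sx (chart_continuous h)). Qed.

End ProjContinuity.
(** Formal sums agree when all coefficients do, so an identity between chains becomes a ring
    identity over the integers with the coefficients as unknowns. *)
Ltac freeg_ring :=
  apply/eqP/freeg_eqP => ?; rewrite ?(coeffB, coeffD, coeffN, coeff0);
  first [repeat (match goal with |- context [coeff ?x ?y] => generalize (coeff x y) end); intros; ring | ring].

(** * Paths and homotopies as singular chains *)

Section Simplices.
Variable R : realType.
Local Notation simplex := (std_simplex R).

Definition bary n (i : 'I_n.+1) (x : simplex n) : R := (\val x) 0 i.

Lemma bary_cts n (i : 'I_n.+1) x : {for x, continuous (@bary n i)}.
Proof.
apply: (@cts_comp _ _ _ (fun x : simplex n => \val x : 'rV[R]_n.+1) (fun M => M 0 i)).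
  exact: initial_continuous.
exact: coord_continuous.
Qed.

Lemma bary_ge0 n (i : 'I_n.+1) x : 0 <= @bary n i x.
Proof. by case: x => x h; have /set_mem[h1 h2] := h; first [exact: h1|exact: h2]. Qed.

Lemma sum_bary n (x : simplex n) : \sum_i bary i x = 1.
Proof. by case: x => x h; have /set_mem[h1 h2] := h; first [exact: h1|exact: h2]. Qed.

Lemma bary_le1 n (i : 'I_n.+1) x : @bary n i x <= 1.
Proof.
rewrite -(sum_bary x) (bigD1 i)//= lerDl; apply: sumr_ge0 => j _; exact: bary_ge0.
Qed.

Lemma bary_face n (i : 'I_n.+2) (j : 'I_n.+2) (x : simplex n) :
  bary j (face i x) = if unlift i j is Some k then bary k x else 0.
Proof. by rewrite /bary /= mxE. Qed.

Lemma bary_faceE n (i : 'I_n.+2) (j : 'I_n.+1) (x : simplex n) :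
  bary (fintype.lift i j) (face i x) = bary j x.
Proof. by rewrite bary_face liftK. Qed.

Lemma bary_face0 n (i : 'I_n.+2) (x : simplex n) : bary i (face i x) = 0.
Proof. by rewrite bary_face unlift_none. Qed.

Lemma simplex_eq n (x y : simplex n) : (forall i, bary i x = bary i y) -> x = y.
Proof. by move=> h; apply: val_inj; apply/rowP => i; exact: h. Qed.

Lemma edge_paramE (x : simplex 1) : edge_param x = bary ord_max x. Proof. by []. Qed.

Lemma edge_param0 (x : simplex 1) : bary 0 x = 1 - edge_param x.
Proof.
have := sum_bary x; rewrite big_ord_recl big_ord1 => <-.
by rewrite edge_paramE (_ : fintype.lift _ _ = ord_max) ?addrK//; apply: val_inj.
Qed.

Lemma edge_param_ge0 (x : simplex 1) : 0 <= edge_param x. Proof. exact: bary_ge0. Qed.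
Lemma edge_param_le1 (x : simplex 1) : edge_param x <= 1. Proof. exact: bary_le1. Qed.

Lemma edge_param_cts x : {for x, continuous (@edge_param R)}.
Proof. exact: bary_cts. Qed.

Lemma edge_param_inj : injective (@edge_param R).
Proof.
move=> x y xy; apply: simplex_eq => i.
case: (unliftP ord_max i) => [j|] ->; last by rewrite -!edge_paramE.
by rewrite (_ : fintype.lift _ _ = 0) ?edge_param0 ?xy//; apply: val_inj; rewrite /= ord1.
Qed.

(** Retraction of the line onto [0, 1]: it makes every real number a parameter of the 1-simplex and
    extends functions on [0, 1] to the whole line. *)
Definition clamp (t : R) : R := Num.max 0 (Num.min t 1).

Lemma clamp_ge0 t : 0 <= clamp t. Proof. by rewrite le_max lexx. Qed.
Lemma clamp_le1 t : clamp t <= 1.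
Proof. by rewrite ge_max ler01/= ge_min lexx orbT. Qed.
Lemma clampE t : 0 <= t <= 1 -> clamp t = t.
Proof. by move=> /andP[t0 t1]; rewrite /clamp min_l// max_r. Qed.

Lemma clamp_cts t : {for t, continuous clamp}.
Proof.
apply: (@cts_comp _ _ _ (fun t : R => Num.min t 1) (fun t : R => Num.max 0 t)).
  by apply: (@continuous_min _ _ id (fun=> 1)); [exact: cvg_id|exact: cvg_cst].
by apply: (@continuous_max _ _ (fun=> 0) id); [exact: cvg_cst|exact: cvg_id].
Qed.

Lemma pt1_proof t : (\row_(i < 2) (if i == 0 then 1 - clamp t else clamp t)) \in simplex 1.
Proof.
apply/mem_set; split.
  by move=> i; rewrite mxE; case: ifP => _; rewrite ?subr_ge0 ?clamp_le1 ?clamp_ge0.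
by rewrite big_ord_recl big_ord1 !mxE/= subrK.
Qed.

Definition pt1 t : simplex 1 := SigSub (pt1_proof t).

Lemma edge_param_pt1 t : edge_param (pt1 t) = clamp t.
Proof. by rewrite /edge_param /= mxE. Qed.

Lemma pt1_edge_param x : pt1 (edge_param x) = x.
Proof.
apply: edge_param_inj; rewrite edge_param_pt1 clampE// edge_param_ge0; exact: edge_param_le1.
Qed.

Lemma cts_simplex (T : topologicalType) n (f : T -> simplex n) x :
  (forall i, {for x, continuous (fun t => bary i (f t))}) -> {for x, continuous f}.
Proof.
move=> h U; rewrite /nbhs/= => -[_ [[W oW <-] /= Wx WU]].
have c : {for x, continuous (fun t => \val (f t) : 'rV[R]_n.+1)}.
  by apply: cvg_mx => i j; rewrite ord1; exact: h.
have h1 : \forall t \near x, W (\val (f t)) by apply: c; exact: open_nbhs_nbhs.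
by apply: (@filterS _ _ (nbhs_filter x) _ _ _ h1) => t Wt; exact: WU.
Qed.

Lemma pt1_cts t : {for t, continuous pt1}.
Proof.
apply: cts_simplex => i.
have [i0|i0] := eqVneq i 0.
  have h : {for t, continuous (fun t => 1 - clamp t)}.
    apply: (@cvgB _ R^o _ (nbhs t) (nbhs_filter t) (fun=> 1)); [exact: cvg_cst|exact: clamp_cts].
  by apply: eq_cts h => s; rewrite /bary /= mxE i0.
by apply: eq_cts (@clamp_cts t) => s; rewrite /bary /= mxE (negPf i0).
Qed.

End Simplices.

Section Homotopies.
Variable R : realType.
Local Notation C := R[i].
Local Notation V := 'rV[C]_3.
Local Notation simplex := (std_simplex R).
Variable A : seq (line R).

Definition bounds (c : chain R (CP2 R) 1) : Prop :=
  exists b : chain R (CP2 R) 2, chain_in (complement A) b /\ boundary b = c.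

Lemma bounds_eq c d : bounds c -> c = d -> bounds d.
Proof. by move=> h <-. Qed.

Lemma bounds0 : bounds 0.
Proof.
exists 0; split; first exact: chain_in0.
by rewrite -[X in boundary X](subrr 0) boundary_is_zmod_morphism subrr.
Qed.

Lemma boundsB c d : bounds c -> bounds d -> bounds (c - d).
Proof.
move=> [b [bA <-]] [b' [bA' <-]]; exists (b - b'); split; first exact: chain_inB.
by rewrite boundary_is_zmod_morphism.
Qed.

Lemma boundsN c : bounds c -> bounds (- c).
Proof. by rewrite -(sub0r c); apply: boundsB; exact: bounds0. Qed.

Lemma boundsD c d : bounds c -> bounds d -> bounds (c + d).
Proof. by move=> hc hd; rewrite -(opprK d); apply: boundsB => //; exact: boundsN. Qed.

(** A discontinuous map is sent to a constant simplex, so that paths can be written down first and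
    their continuity supplied where their values are used. *)
Definition psing n (f : simplex n -> CP2 R) : sing R (CP2 R) n :=
  if pselect (continuous f) is left h then mkcts h else mkcts (@cst_continuous _ _ (proj (const_mx 1) : CP2 R)).

Lemma psingE n (f : simplex n -> CP2 R) : continuous f -> psing f = f :> (_ -> _).
Proof. by rewrite /psing; case: pselect. Qed.

Definition avoid (v : V) : Prop := forall L, L \in A -> pairing (coords L) v != 0.

Hypothesis A0 : A != [::].

Lemma avoid_neq0 v : avoid v -> v != 0.
Proof.
have [L LA] : exists L, L \in A by case: A A0 => // L s _; exists L; rewrite mem_head.
by move=> /(_ L LA); exact: pairing_neq0.
Qed.

Lemma proj_complement v : avoid v -> complement A (proj v).
Proof. by move=> h L LA; rewrite on_line_proj ?avoid_neq0//; exact: h. Qed.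

Lemma bounds_triangle (f : simplex 2 -> CP2 R) (s0 s1 s2 : sing R (CP2 R) 1) :
  continuous f -> (forall x, complement A (f x)) ->
  (forall x, s0 x = f (face 0 x)) -> (forall x, s1 x = f (face 1 x)) ->
  (forall x, s2 x = f (face ord_max x)) -> bounds (<< s0 >> - << s1 >> + << s2 >>).
Proof.
move=> fc fA h0 h1 h2; exists << psing f >>; split.
  by move=> s; rewrite domU1 inE => /eqP -> _ [x _ <-]; rewrite psingE.
rewrite /boundary liftU scale1r 2!big_ord_recl big_ord1.
rewrite expr0 scale1r scaleN1r expr2 mulrNN mulr1 scale1r addrA.
congr (_ - _ + _); congr (<< _ >>); apply/continuousEP => x /=.
- by rewrite h0 psingE.
- by rewrite h1 psingE//; congr (f (face _ _)); apply: val_inj.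
- by rewrite h2 psingE//; congr (f (face _ _)); apply: val_inj.
Qed.

(** Continuity on [0, 1], tested by composition with arbitrary maps into [0, 1]. Nothing is said
    outside the interval, and reparametrisations and homotopies built from g inherit continuity at
    once. *)
Definition cts01 (g : R -> V) : Prop := forall (T : topologicalType) (f : T -> R) x,
  (forall t, 0 <= f t <= 1) -> {for x, continuous f} -> {for x, continuous (fun t => g (f t))}.

Definition cts2 (h : R -> R -> V) : Prop := forall (T : topologicalType) (f g : T -> R) x,
  (forall t, 0 <= f t <= 1) -> (forall t, 0 <= g t <= 1) ->
  {for x, continuous f} -> {for x, continuous g} -> {for x, continuous (fun t => h (f t) (g t))}.

Definition path (g : R -> V) : sing R (CP2 R) 1 := psing (fun x => proj (g (edge_param x))).

Definition admissible (g : R -> V) := cts01 g /\ forall t, 0 <= t <= 1 -> avoid (g t).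

Lemma edge_param01 (x : simplex 1) : 0 <= edge_param x <= 1.
Proof. by rewrite edge_param_ge0 edge_param_le1. Qed.

Lemma bary01 n i (x : simplex n) : 0 <= bary i x <= 1.
Proof. by rewrite bary_ge0 bary_le1. Qed.

Lemma pathE g x : admissible g -> path g x = proj (g (edge_param x)).
Proof.
move=> [gc ga]; rewrite /path psingE// => y; apply: cts_proj.
  by apply: avoid_neq0; apply: ga; exact: edge_param01.
by apply: gc; [exact: edge_param01|exact: edge_param_cts].
Qed.

Lemma path_ext g g' : admissible g -> (forall t, 0 <= t <= 1 -> g t = g' t) -> path g = path g'.
Proof.
move=> ga h; rewrite /path; congr psing; apply/funext => x.
by rewrite h// edge_param01.
Qed.

Lemma path_proj_ext g g' : (forall t, 0 <= t <= 1 -> proj (g t) = proj (g' t)) -> path g = path g'.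
Proof.
by move=> h; rewrite /path; congr psing; apply/funext => x; rewrite h// edge_param01.
Qed.

(* The edges of the triangle are [H (1 - t) t], [H 0 t] and [H t 0]. *)
Lemma bounds_triangle_map (H : simplex 2 -> V) g0 g1 g2 :
  continuous H -> (forall x, avoid (H x)) ->
  admissible g0 -> admissible g1 -> admissible g2 ->
  (forall x, g0 (edge_param x) = H (face 0 x)) -> (forall x, g1 (edge_param x) = H (face 1 x)) ->
  (forall x, g2 (edge_param x) = H (face ord_max x)) ->
  bounds (<< path g0 >> - << path g1 >> + << path g2 >>).
Proof.
move=> Hc Ha a0 a1 a2 h0 h1 h2.
apply: (@bounds_triangle (fun x => proj (H x))).
- by move=> x; apply: cts_proj; [exact: avoid_neq0|exact: Hc].
- by move=> x; exact: proj_complement.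
- by move=> x; rewrite pathE// h0.
- by move=> x; rewrite pathE// h1.
- by move=> x; rewrite pathE// h2.
Qed.

Lemma face_bary (x : simplex 1) :
  [/\ bary 0 (face 0 x) = 0, bary 1 (face 0 x) = 1 - edge_param x & bary ord_max (face 0 x) = edge_param x] /\
  [/\ bary 0 (face 1 x) = 1 - edge_param x, bary 1 (face 1 x) = 0 & bary ord_max (face 1 x) = edge_param x] /\
  [/\ bary 0 (face ord_max x) = 1 - edge_param x, bary 1 (face ord_max x) = edge_param x & bary ord_max (face ord_max x) = 0].
Proof.
have E0 (i j : 'I_3) : fintype.lift i 0 = j -> bary j (face i x) = 1 - edge_param x.
  by move=> <-; rewrite bary_faceE edge_param0.
have E1 (i j : 'I_3) : fintype.lift i ord_max = j -> bary j (face i x) = edge_param x.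
  by move=> <-; rewrite bary_faceE -edge_paramE.
split; [split|split; split]; rewrite ?bary_face0//;
  by [apply: E0; apply: val_inj|apply: E1; apply: val_inj].
Qed.

Definition sub_path (g : R -> V) (a b : R) := fun t => g (a + t * (b - a)).

Lemma affine01 (a b t : R) : 0 <= a <= 1 -> 0 <= b <= 1 -> 0 <= t <= 1 -> 0 <= a + t * (b - a) <= 1.
Proof. by move=> ? ? ?; nra. Qed.

Lemma ctsRD (T : topologicalType) (f g : T -> R) x : {for x, continuous f} -> {for x, continuous g} ->
  {for x, continuous (fun t => f t + g t)}.
Proof. by move=> fx gx; exact: (@cvgD _ R^o _ (nbhs x) (nbhs_filter x) _ _ _ _ fx gx). Qed.

Lemma ctsRN (T : topologicalType) (f : T -> R) x : {for x, continuous f} -> {for x, continuous (fun t => - f t)}.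
Proof. by move=> fx; exact: (@cvgN _ R^o _ (nbhs x) (nbhs_filter x) _ _ fx). Qed.

Lemma ctsRM (T : topologicalType) (f g : T -> R) x : {for x, continuous f} -> {for x, continuous g} ->
  {for x, continuous (fun t => f t * g t)}.
Proof. by move=> fx gx; exact: (@cvgM R _ (nbhs x) (nbhs_filter x) _ _ _ _ fx gx). Qed.

Lemma admissible_sub g a b : 0 <= a <= 1 -> 0 <= b <= 1 -> admissible g -> admissible (sub_path g a b).
Proof.
move=> ha hb [gc ga]; split.
  move=> T f x f01 fx; apply: (gc _ (fun t => a + f t * (b - a))); first by move=> t; exact: affine01.
  by apply: ctsRD; [exact: cts_cst|apply: ctsRM => //; exact: cts_cst].
by move=> t t01; apply: ga; exact: affine01.
Qed.

(** The affine map of the 2-simplex to the parameters with vertices a, b, c, followed by g, has this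
    chain as boundary. The parameters may come in any order, so reversal of a path is a special
    case. *)
Lemma bounds_split g a b c : 0 <= a <= 1 -> 0 <= b <= 1 -> 0 <= c <= 1 -> admissible g ->
  bounds (<< path (sub_path g a b) >> + << path (sub_path g b c) >> - << path (sub_path g a c) >>).
Proof.
move=> ha hb hc ga.
have -> : << path (sub_path g a b) >> + << path (sub_path g b c) >> - << path (sub_path g a c) >> =
  << path (sub_path g b c) >> - << path (sub_path g a c) >> + << path (sub_path g a b) >> :> chain R (CP2 R) 1.
  by freeg_ring.
have [gc gav] := ga.
have r01 (x : simplex 2) : 0 <= bary 0 x * a + (bary 1 x * b + bary ord_max x * c) <= 1.
  have := sum_bary x; rewrite 2!big_ord_recl big_ord1.
  have -> : fintype.lift ord0 ord0 = 1 :> 'I_3 by apply: val_inj.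
  have -> : fintype.lift ord0 (fintype.lift ord0 ord0) = ord_max :> 'I_3 by apply: val_inj.
  have := bary_ge0 0 x; have := bary_ge0 1 x; have := bary_ge0 ord_max x.
  by move=> x2 x1 x0 xs; apply/andP; split; nra.
apply: (@bounds_triangle_map (fun x => g (bary 0 x * a + (bary 1 x * b + bary ord_max x * c)))).
- move=> x; apply: (gc _ (fun x => bary 0 x * a + (bary 1 x * b + bary ord_max x * c))) => //.
  by apply: ctsRD; last apply: ctsRD; apply: ctsRM; solve [exact: bary_cts|exact: cts_cst].
- by move=> x; exact: gav.
- exact: admissible_sub.
- exact: admissible_sub.
- exact: admissible_sub.
- by move=> x; have [[-> -> ->] _] := face_bary x; rewrite /sub_path; congr g; ring.
- by move=> x; have [_ [[-> -> ->] _]] := face_bary x; rewrite /sub_path; congr g; ring.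
- by move=> x; have [_ [_ [-> -> ->]]] := face_bary x; rewrite /sub_path; congr g; ring.
Qed.

Lemma bounds_split_ext g g1 g2 g3 a b c : 0 <= a <= 1 -> 0 <= b <= 1 -> 0 <= c <= 1 -> admissible g ->
  (forall t, 0 <= t <= 1 -> g1 t = g (a + t * (b - a))) ->
  (forall t, 0 <= t <= 1 -> g2 t = g (b + t * (c - b))) ->
  (forall t, 0 <= t <= 1 -> g3 t = g (a + t * (c - a))) ->
  bounds (<< path g1 >> + << path g2 >> - << path g3 >>).
Proof.
move=> ha hb hc ga h1 h2 h3; have := bounds_split ha hb hc ga.
have -> : path (sub_path g a b) = path g1.
  by apply: path_ext (admissible_sub ha hb ga) _ => t t01; rewrite h1.
have -> : path (sub_path g b c) = path g2.
  by apply: path_ext (admissible_sub hb hc ga) _ => t t01; rewrite h2.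
have -> // : path (sub_path g a c) = path g3.
by apply: path_ext (admissible_sub ha hc ga) _ => t t01; rewrite h3.
Qed.

Lemma bounds_const v : avoid v -> bounds << path (fun=> v) >>.
Proof.
move=> va; have ad : admissible (fun=> v) by split=> // T f x _ _; exact: cts_cst.
(* With all parameters equal the splitting relation reads c + c - c. *)
have := @bounds_split _ 0 0 0 _ _ _ ad; rewrite lexx ler01.
rewrite (_ : sub_path _ _ _ = fun=> v)// addrK; exact.
Qed.

(** The diagonal [H t t] cuts the square into two singular triangles and cancels between their
    boundaries. *)
Lemma bounds_square (H : R -> R -> V) : cts2 H ->
  (forall s t, 0 <= s <= 1 -> 0 <= t <= 1 -> avoid (H s t)) ->
  bounds (<< path (H^~ 0) >> + << path (H 1) >> - << path (H 0) >> - << path (H^~ 1) >>).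
Proof.
move=> Hc Ha.
have i01 : 0 <= (0 : R) <= 1 by rewrite lexx ler01.
have i11 : 0 <= (1 : R) <= 1 by rewrite lexx ler01.
have ad_l (a : R) : 0 <= a <= 1 -> admissible (H a).
  by move=> a01; split=> [T f x f01 fx|t t01]; [apply: Hc => //; exact: cts_cst|exact: Ha].
have ad_r (a : R) : 0 <= a <= 1 -> admissible (H^~ a).
  by move=> a01; split=> [T f x f01 fx|t t01]; [apply: Hc => //; exact: cts_cst|exact: Ha].
have ad_d : admissible (fun t => H t t).
  by split=> [T f x f01 fx|t t01]; [exact: Hc|exact: Ha].
have s01 (x : simplex 2) : 0 <= bary 1 x + bary ord_max x <= 1.
  have := sum_bary x; rewrite 2!big_ord_recl big_ord1.
  have -> : fintype.lift ord0 ord0 = 1 :> 'I_3 by apply: val_inj.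
  have -> : fintype.lift ord0 (fintype.lift ord0 ord0) = ord_max :> 'I_3 by apply: val_inj.
  have := bary_ge0 0 x; have := bary_ge0 1 x; have := bary_ge0 ord_max x.
  by move=> x2 x1 x0 xs; apply/andP; split; lra.
have sc (x : simplex 2) : {for x, continuous (fun x => bary 1 x + bary ord_max x : R)}.
  by apply: ctsRD; exact: bary_cts.
have T1 : bounds (<< path (H 1) >> - << path (fun t => H t t) >> + << path (H^~ 0) >>).
  apply: (@bounds_triangle_map (fun x => H (bary 1 x + bary ord_max x) (bary ord_max x))).
  - by move=> x; exact: (Hc _ (fun x => bary 1 x + bary ord_max x) (bary ord_max) x s01 (bary01 _) (sc x) (@bary_cts _ _ _ x)).
  - by move=> x; apply: Ha; [exact: s01|exact: bary01].
  - exact: ad_l.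
  - exact: ad_d.
  - exact: ad_r.
  - by move=> x; have [[_ -> ->] _] := face_bary x; rewrite subrK.
  - by move=> x; have [_ [[_ -> ->] _]] := face_bary x; rewrite add0r.
  - by move=> x; have [_ [_ [_ -> ->]]] := face_bary x; rewrite addr0.
have T2 : bounds (<< path (H^~ 1) >> - << path (fun t => H t t) >> + << path (H 0) >>).
  apply: (@bounds_triangle_map (fun x => H (bary ord_max x) (bary 1 x + bary ord_max x))).
  - by move=> x; exact: (Hc _ (bary ord_max) (fun x => bary 1 x + bary ord_max x) x (bary01 _) s01 (@bary_cts _ _ _ x) (sc x)).
  - by move=> x; apply: Ha; [exact: bary01|exact: s01].
  - exact: ad_r.
  - exact: ad_d.
  - exact: ad_l.
  - by move=> x; have [[_ -> ->] _] := face_bary x; rewrite subrK.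
  - by move=> x; have [_ [[_ -> ->] _]] := face_bary x; rewrite add0r.
  - by move=> x; have [_ [_ [_ -> ->]]] := face_bary x; rewrite addr0.
have := boundsB T1 T2; congr bounds.
by freeg_ring.
Qed.

Lemma bounds_square_ext (H : R -> R -> V) b r l t : cts2 H ->
  (forall s t, 0 <= s <= 1 -> 0 <= t <= 1 -> avoid (H s t)) ->
  (forall s, 0 <= s <= 1 -> b s = H s 0) -> (forall s, 0 <= s <= 1 -> r s = H 1 s) ->
  (forall s, 0 <= s <= 1 -> l s = H 0 s) -> (forall s, 0 <= s <= 1 -> t s = H s 1) ->
  bounds (<< path b >> + << path r >> - << path l >> - << path t >>).
Proof.
move=> Hc Ha hb hr hl ht; have := bounds_square Hc Ha.
have e (f g : R -> V) : (forall s, 0 <= s <= 1 -> f s = g s) -> path g = path f.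
  by move=> fg; apply: path_proj_ext => s s01; rewrite fg.
by rewrite (e _ _ hb) (e _ _ hr) (e _ _ hl) (e _ _ ht).
Qed.

End Homotopies.

#[global] Opaque path.

Ltac path_ring := repeat (match goal with |- context [path ?g] => generalize (path g) end); intros; freeg_ring.

(** * Avoiding the roots of finitely many polynomials *)

Section Generic.
Variable R : realType.

(** The product P has fewer than [size P] roots, so one of the [size P] distinct candidates e / (i +
    2) is none of them; starting the denominators at 2 keeps the candidates strictly below e. *)
Lemma generic_nonroot (ps : seq {poly R}) (e : R) : 0 < e -> (forall p, p \in ps -> p != 0) ->
  exists t, [/\ 0 < t, t < e & forall p, p \in ps -> p.[t] != 0].
Proof.
move=> e0 ps0; pose P := \prod_(p <- ps) p.
have P0 : P != 0 by rewrite /P prodf_seq_neq0; apply/allP => p /ps0.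
pose rs := [seq e / (i.+2)%:R | i <- iota 0 (size P)].
have urs : uniq rs.
  rewrite map_inj_uniq ?iota_uniq// => i j /(mulfI (lt0r_neq0 e0)) /invr_inj /eqP.
  by rewrite eqr_nat => /eqP[].
have : ~~ all (root P) rs.
  by apply/negP => h; have := max_poly_roots P0 h urs; rewrite size_map size_iota ltnn.
move=> /allPn[t /mapP[i _ ->] tP]; exists (e / i.+2%:R); split.
- by rewrite divr_gt0.
- by rewrite ltr_pdivrMr// ltr_pMr// ltr1n.
- move=> p pps; apply: contraNneq tP => p0; rewrite /root /P horner_prod.
  by rewrite (big_rem p)//= p0 mul0r.
Qed.

End Generic.

(** * Norm estimates and uniform bounds on the unit interval *)

Section Bounds.
Variable R : realType.
Local Notation C := R[i].
Local Notation normc := Normc.normc.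

Lemma normcE' (z : C) : normc z = Num.sqrt (complex.Re z ^+ 2 + complex.Im z ^+ 2).
Proof. by case: z. Qed.

Lemma normC_normc (z : C) : `|z| = (normc z)%:C.
Proof. by rewrite normc_def normcE'. Qed.

Lemma normc_ge0 (z : C) : 0 <= normc z. Proof. by rewrite normcE' sqrtr_ge0. Qed.

Lemma normc_eq0 (z : C) : (normc z == 0) = (z == 0).
Proof.
by apply/eqP/eqP => [/Normc.eq0_normc//|->]; rewrite Normc.normc0.
Qed.

Lemma normc_gt0 (z : C) : (0 < normc z) = (z != 0).
Proof. by rewrite lt_def normc_ge0 andbT normc_eq0. Qed.

Lemma normc_real (x : R) : normc (x%:C) = `|x|.
Proof. by rewrite normcE' /= expr0n addr0 sqrtr_sqr. Qed.

Lemma normc_expi (t : R) : normc (expi t) = 1.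
Proof. by rewrite /expi /= cos2Dsin2 sqrtr1. Qed.

Lemma ler_normcD (z w : C) : normc (z + w) <= normc z + normc w.
Proof. by rewrite -lecR rmorphD /= -!normC_normc ler_normD. Qed.

Lemma ler_normcB (z w : C) : normc z - normc w <= normc (z + w).
Proof.
rewrite lerBlDr; have := ler_normcD (z + w) (- w).
rewrite addrK => h; apply: le_trans h _.
by rewrite (_ : normc (- w) = normc w)//; case: (w) => a b /=; rewrite !sqrrN.
Qed.

Lemma normc_cts (T : topologicalType) (f : T -> C) x :
  {for x, continuous f} -> {for x, continuous (fun t => normc (f t))}.
Proof.
move=> fx; apply: (@eq_cts _ _ (fun t => Num.sqrt (complex.Re (f t) ^+ 2 + complex.Im (f t) ^+ 2))).
  by move=> t; rewrite normcE'.
have fRe : {for x, continuous (fun t => complex.Re (f t))} := cts_comp fx (@Re_continuous _ _).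
have fIm : {for x, continuous (fun t => complex.Im (f t))} := cts_comp fx (@Im_continuous _ _).
have h : {for x, continuous (fun t => complex.Re (f t) ^+ 2 + complex.Im (f t) ^+ 2)}.
  exact: (ctsRD (ctsRM fRe fRe) (ctsRM fIm fIm)).
exact: (cts_comp h (@sqrt_continuous _ _)).
Qed.

Definition ctsC01 (g : R -> C) : Prop := forall (T : topologicalType) (f : T -> R) x,
  (forall t, 0 <= f t <= 1) -> {for x, continuous f} -> {for x, continuous (fun t => g (f t))}.

Lemma clamp01 (t : R) : 0 <= clamp t <= 1. Proof. by rewrite clamp_ge0 clamp_le1. Qed.

Lemma cts01_pairing (g : R -> 'rV[C]_3) a : cts01 g -> ctsC01 (fun t => pairing a (g t)).
Proof. by move=> h T f x f01 fx; apply: cts_pairing; exact: h. Qed.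

Lemma normc_minimum (g : R -> C) : ctsC01 g -> (forall t, 0 <= t <= 1 -> g t != 0) ->
  exists m, 0 < m /\ forall t, 0 <= t <= 1 -> m <= normc (g t).
Proof.
move=> gc g0.
(* Clamping extends the function to the whole line, so that the extreme value theorem applies on
   [0, 1]. *)
have c : continuous (fun t => normc (g (clamp t))).
  by move=> t; apply: normc_cts; apply: gc; [exact: clamp01|exact: clamp_cts].
have [c0 _ c1] := @EVT_min R _ 0 1 ler01 (continuous_subspaceT c).
exists (normc (g (clamp c0))); split; first by rewrite normc_gt0; apply: g0; exact: clamp01.
by move=> t t01; have := c1 t; rewrite in_itv/= (clampE t01); exact.
Qed.

Lemma normc_maximum (g : R -> C) : ctsC01 g ->
  exists m, 0 < m /\ forall t, 0 <= t <= 1 -> normc (g t) <= m.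
Proof.
move=> gc.
have c : continuous (fun t => normc (g (clamp t))).
  by move=> t; apply: normc_cts; apply: gc; [exact: clamp01|exact: clamp_cts].
have [c0 _ c1] := @EVT_max R _ 0 1 ler01 (continuous_subspaceT c).
exists (normc (g (clamp c0)) + 1); split; first by rewrite ltr_wpDl// normc_ge0.
move=> t t01; have := c1 t; rewrite in_itv/= (clampE t01) => h.
by rewrite (le_trans (h t01))// lerDl.
Qed.

(** Each condition is assumed for all small r and not for one r, so the minimum of the finitely many
    thresholds serves all of them. *)
Lemma seq_minimum (T : eqType) (s : seq T) (P : T -> R -> Prop) :
  (forall x, x \in s -> exists m, 0 < m /\ forall r, 0 < r -> r <= m -> P x r) ->
  exists m, 0 < m /\ forall x, x \in s -> forall r, 0 < r -> r <= m -> P x r.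
Proof.
elim: s => [_|x s IH h]; first by exists 1.
have [m [m0 mP]] := IH (fun y ys => h y (mem_behead (ys : y \in behead (x :: s)))).
have [m' [m'0 m'P]] := h x (mem_head x s).
exists (Num.min m m'); split; first by rewrite lt_min m0.
move=> y; rewrite inE => /orP[/eqP ->|ys] r r0; rewrite le_min => /andP[h1 h2]; first exact: m'P.
exact: mP.
Qed.

End Bounds.

(** * Meridian circles *)

Section Circles.
Variable R : realType.
Local Notation C := R[i].
Local Notation V := 'rV[C]_3.
Local Notation normc := Normc.normc.
Variable A : seq (line R).
Hypothesis A0 : A != [::].

Lemma expi_cts (T : topologicalType) (f : T -> R) x : {for x, continuous f} ->
  {for x, continuous (fun t => expi (f t))}.
Proof.
move=> fx; apply: cts_complex; first exact: (cts_comp fx (@continuous_cos _ _)).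
exact: (cts_comp fx (@continuous_sin _ _)).
Qed.

Lemma expiD (s t : R) : expi (s + t) = expi s * expi t.
Proof. by rewrite /expi cosD sinD; apply/eqP; rewrite eq_complex /= eqxx /= addrC. Qed.

Lemma expi0 : expi (0 : R) = 1.
Proof. by rewrite /expi cos0 sin0. Qed.

Lemma expi2pi : expi (2 * pi : R) = 1.
Proof. by rewrite /expi mulr_natl cos2pi sin2pi. Qed.

Lemma expi_neq0 (t : R) : expi t != 0.
Proof. by rewrite -normc_gt0 normc_expi. Qed.

Definition circ (v w : V) (rho : R) (t : R) : V := v + (rho%:C * expi (2 * pi * t)) *: w.

(** Off L the avoidance of the closed disc is encoded as a norm inequality: the zero u of L'(v + u
    w) has modulus |L'(v)| / |L'(w)|, which must exceed rho. *)
Definition disc L (v w : V) (rho : R) : Prop :=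
  [/\ pairing (coords L) v = 0, pairing (coords L) w != 0, 0 < rho &
    forall L', L' \in A -> L' != L ->
      normc (pairing (coords L') w) * rho < normc (pairing (coords L') v)].

Lemma disc_avoid L v w rho (u : C) : disc L v w rho -> u != 0 -> normc u <= rho -> avoid A (v + u *: w).
Proof.
move=> [Lv Lw rho0 h] u0 ur L' L'A; rewrite pairingD pairingZr.
have [->|LL'] := eqVneq L' L; first by rewrite Lv add0r mulf_neq0.
rewrite -normc_gt0; apply: lt_le_trans (ler_normcB _ _).
rewrite subr_gt0 Normc.normcM; apply: le_lt_trans (h L' L'A LL').
by rewrite mulrC ler_wpM2l// normc_ge0.
Qed.

Lemma circ_normc (rho t : R) : 0 < rho -> normc (rho%:C * expi (2 * pi * t)) = rho.
Proof. by move=> r0; rewrite Normc.normcM normc_expi mulr1 normc_real gtr0_norm. Qed.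

Lemma circ_coeff_neq0 (rho t : R) : 0 < rho -> rho%:C * expi (2 * pi * t) != 0.
Proof. by move=> r0; rewrite -normc_gt0 circ_normc. Qed.

(** The two ends of the moving loop trace the same path, and these two sides of the square
    cancel. *)
Lemma bounds_free_homotopy (H : R -> R -> V) : cts2 H ->
  (forall s t, 0 <= s <= 1 -> 0 <= t <= 1 -> avoid A (H s t)) ->
  (forall s, 0 <= s <= 1 -> H s 0 = H s 1) ->
  bounds A (<< path (H 0) >> - << path (H 1) >>).
Proof.
move=> Hc Ha H01; have h := bounds_square A0 Hc Ha.
have e : path (H^~ 0) = path (H^~ 1).
  apply: (@path_ext _ A) => //; split; last by move=> t t01; apply: Ha; rewrite ?lexx ?ler01.
  by move=> T f x f01 fx; apply: Hc => //; [move=> _; rewrite lexx ler01|exact: cts_cst].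
by apply: (bounds_eq (boundsN h)); rewrite e; path_ring.
Qed.

Lemma circ_homotopy L (v w : R -> V) rho : cts01 v -> cts01 w ->
  (forall s, 0 <= s <= 1 -> disc L (v s) (w s) rho) ->
  bounds A (<< path (circ (v 0) (w 0) rho) >> - << path (circ (v 1) (w 1) rho) >>).
Proof.
move=> vc wc vw.
have r0 : 0 < rho by have [] := vw 0; rewrite ?lexx ?ler01.
apply: (@bounds_free_homotopy (fun s => circ (v s) (w s) rho)).
- move=> T f g x f01 g01 fx gx; rewrite /circ.
  apply: cts_addv; first exact: vc.
  apply: cts_scalev; last exact: wc.
  apply: ctsM; first exact: cts_cst.
  by apply: expi_cts; apply: ctsRM => //; exact: cts_cst.
- move=> s t s01 t01; apply: disc_avoid (vw s s01) _ _; first exact: circ_coeff_neq0.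
  by rewrite circ_normc.
- by move=> s s01; rewrite /circ mulr0 mulr1 expi0 expi2pi.
Qed.

Lemma circ_shrink L v w rho rho' : 0 < rho' -> rho' <= rho -> disc L v w rho ->
  bounds A (<< path (circ v w rho) >> - << path (circ v w rho') >>).
Proof.
move=> r0 r d; pose g (s : R) := rho + s * (rho' - rho).
have g0 s : 0 <= s <= 1 -> 0 < g s by move=> ?; rewrite /g; nra.
have gr s : 0 <= s <= 1 -> g s <= rho by move=> ?; rewrite /g; nra.
have -> : circ v w rho = (fun s => circ v w (g s)) 0 by rewrite /g mul0r addr0.
have -> : circ v w rho' = (fun s => circ v w (g s)) 1 by rewrite /g mul1r addrC subrK.
apply: (@bounds_free_homotopy (fun s => circ v w (g s))).
- move=> T f h x f01 h01 fx hx; rewrite /circ.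
  apply: cts_addv; first exact: cts_cst.
  apply: cts_scalev; last exact: cts_cst.
  apply: ctsM; last by apply: expi_cts; apply: ctsRM => //; exact: cts_cst.
  apply: ctsC; apply: ctsRD; first exact: cts_cst.
  by apply: ctsRM => //; exact: cts_cst.
- move=> s t s01 t01; apply: disc_avoid d _ _; first by apply: circ_coeff_neq0; exact: g0.
  by rewrite circ_normc ?gr// g0.
- by move=> s s01; rewrite /circ mulr0 mulr1 expi0 expi2pi.
Qed.

Lemma disc_radius L v w : pairing (coords L) v = 0 -> pairing (coords L) w != 0 ->
  (forall L', L' \in A -> L' != L -> pairing (coords L') v != 0) ->
  exists rho, disc L v w rho.
Proof.
move=> Lv Lw h.
have [|m [m0 mP]] := @seq_minimum R _ A (fun L' r => L' != L ->
    normc (pairing (coords L') w) * r < normc (pairing (coords L') v)).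
  move=> L' L'A; have [->|LL'] := eqVneq L' L; first by exists 1; split.
  have n0 : 0 < normc (pairing (coords L') v) by rewrite normc_gt0 h.
  have k0 : 0 < normc (pairing (coords L') w) + 1 by rewrite ltr_wpDl// normc_ge0.
  exists (normc (pairing (coords L') v) / (normc (pairing (coords L') w) + 1)).
  split; first by rewrite divr_gt0.
  move=> r r0; rewrite ler_pdivlMr// => hr _; apply: lt_le_trans hr.
  by rewrite mulrC mulrDr mulr1 ltrDl.
by exists m; split=> // L' L'A LL'; apply: mP => //.
Qed.

(** The radii given at the two ends may be too large in between. Both circles are first shrunk to a
    radius that fits along the whole homotopy, which exists by compactness. *)
Lemma circ_homotopy_any L (v w : R -> V) rho rho' : cts01 v -> cts01 w ->
  (forall s, 0 <= s <= 1 -> pairing (coords L) (v s) = 0) ->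
  (forall s, 0 <= s <= 1 -> pairing (coords L) (w s) != 0) ->
  (forall s L', 0 <= s <= 1 -> L' \in A -> L' != L -> pairing (coords L') (v s) != 0) ->
  disc L (v 0) (w 0) rho -> disc L (v 1) (w 1) rho' ->
  bounds A (<< path (circ (v 0) (w 0) rho) >> - << path (circ (v 1) (w 1) rho') >>).
Proof.
move=> vc wc Lv Lw h d d'.
have [|m [m0 mP]] := @seq_minimum R _ A (fun L' r => L' != L -> forall s, 0 <= s <= 1 ->
    normc (pairing (coords L') (w s)) * r < normc (pairing (coords L') (v s))).
  move=> L' L'A; have [->|LL'] := eqVneq L' L; first by exists 1; split.
  have [a [a0 aP]] := normc_minimum (@cts01_pairing _ _ (coords L') vc) (fun s s01 => h s L' s01 L'A LL').
  have [b [b0 bP]] := normc_maximum (@cts01_pairing _ _ (coords L') wc).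
  (* Minimum of |L'(v)| over maximum of |L'(w)|, halved to get a strict inequality. *)
  exists (a / (b * 2)); split; first by rewrite divr_gt0// mulr_gt0.
  move=> r r0; rewrite ler_pdivlMr ?mulr_gt0// => hr _ s s01.
  apply: lt_le_trans (aP s s01); apply: lt_le_trans hr.
  have := bP s s01; have := normc_ge0 (pairing (coords L') (w s)).
  by move: (normc _) => n n0 nb; nra.
pose r := Num.min m (Num.min rho rho').
have [_ _ rho0 _] := d; have [_ _ rho'0 _] := d'.
have r0 : 0 < r by rewrite !lt_min m0 rho0.
have rrho : r <= rho by rewrite !ge_min lexx orbT.
have rrho' : r <= rho' by rewrite !ge_min lexx !orbT.
have h1 := circ_shrink r0 rrho d.
have h3 := circ_shrink r0 rrho' d'.
have h2 : bounds A (<< path (circ (v 0) (w 0) r) >> - << path (circ (v 1) (w 1) r) >>).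
  apply: (@circ_homotopy L v w r vc wc) => s s01; split; [exact: Lv|exact: Lw|exact: r0|].
  by move=> L' L'A LL'; apply: mP => //; rewrite ge_min lexx.
by apply: (bounds_eq (boundsB (boundsD h1 h2) h3)); path_ring.
Qed.

End Circles.
(** * Arguments and windings *)

Section Argument.
Variable R : realType.
Local Notation C := R[i].
Local Notation normc := Normc.normc.
Local Notation Re := (@complex.Re R).
Local Notation Im := (@complex.Im R).

(* [2 * atan (Im z / (normc z + Re z))] is the principal argument except on
   the negative real axis, where the denominator vanishes. *)
Definition Arg (z : C) : R :=
  if (Im z == 0) && (Re z < 0) then pi else 2 * atan (Im z / (normc z + Re z)).

Definition slit (z : C) := (Im z != 0) || (0 < Re z).

Lemma normc_sqr (z : C) : normc z ^+ 2 = Re z ^+ 2 + Im z ^+ 2.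
Proof. by rewrite normcE' sqr_sqrtr// addr_ge0 ?sqr_ge0. Qed.

Lemma Re_le_normc (z : C) : `|Re z| <= normc z.
Proof.
by rewrite normcE' -sqrtr_sqr ler_wsqrtr// lerDl sqr_ge0.
Qed.

Lemma Im_le_normc (z : C) : `|Im z| <= normc z.
Proof.
by rewrite normcE' -sqrtr_sqr ler_wsqrtr// lerDr sqr_ge0.
Qed.

Lemma slit_denom (z : C) : slit z -> 0 < normc z + Re z.
Proof.
move=> /orP[i0|r0]; last by rewrite ltr_wpDl// normc_ge0.
have h := normc_sqr z; have n0 := normc_ge0 z.
have i2 : 0 < Im z ^+ 2 by rewrite exprn_even_gt0.
rewrite ltNge; apply/negP => le0.
have : normc z ^+ 2 <= Re z ^+ 2 by rewrite -[X in _ <= X]sqrrN ler_sqr ?nnegrE//; lra.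
by rewrite h gerDl leNgt i2.
Qed.

Lemma slit_neq0 (z : C) : slit z -> z != 0.
Proof. by apply: contraTneq => ->; rewrite /slit /= eqxx ltxx. Qed.

Lemma not_slit (z : C) : z != 0 -> ~~ slit z -> (Im z == 0) && (Re z < 0).
Proof.
move=> z0; rewrite negb_or negbK -leNgt => /andP[/eqP i0 r0]; rewrite i0 eqxx /= lt_neqAle r0 andbT.
by apply: contra z0 => /eqP r00; rewrite eq_complex /= r00 i0 !eqxx.
Qed.

Lemma slitE (z : C) : slit z -> Arg z = 2 * atan (Im z / (normc z + Re z)).
Proof.
by rewrite /slit /Arg; case: ifP => // /andP[/eqP -> r0]; rewrite eqxx /= ltNge ltW.
Qed.

(** Off the negative axis Im z / (|z| + Re z) is the tangent of half the angle, so the duplication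
    formulas return Re z / |z| and Im z / |z|. *)
Lemma ArgE (z : C) : z != 0 -> z = (normc z)%:C * expi (Arg z).
Proof.
move=> z0; have n0 : 0 < normc z by rewrite normc_gt0.
have [sz|] := boolP (slit z); last first.
  move=> /(not_slit z0) h; rewrite /Arg h; case/andP: h => /eqP i0 r0.
  rewrite /expi cospi sinpi normcE' i0 expr0n addr0 sqrtr_sqr ltr0_norm//.
  by apply/eqP; rewrite eq_complex /= i0 !mul0r mulr0 addr0 subr0 mulrN1 opprK !eqxx.
have d0 := slit_denom sz; rewrite slitE//.
set t := _ / _; have ct : cos (atan t) != 0.
  by rewrite cos_atan invr_eq0 gt_eqF// sqrtr_gt0 ltr_pwDl// sqr_ge0.
have c2 : cos (atan t) ^+ 2 = (normc z + Re z) / (normc z *+ 2).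
  rewrite cos_atan exprVn sqr_sqrtr; last by rewrite addr_ge0// sqr_ge0.
  have h : Im z ^+ 2 = normc z ^+ 2 - Re z ^+ 2 by rewrite normc_sqr addrC addKr.
  have e : 1 + (Im z / (normc z + Re z)) ^+ 2 = (normc z *+ 2) / (normc z + Re z).
    by rewrite expr_div_n h; field; rewrite gt_eqF.
  by rewrite e invf_div.
have s1 : sin (atan t) = t * cos (atan t) by rewrite -{2}(atanK t) /tan mulfVK.
have C2 : cos (2 * atan t) = Re z / normc z.
  by rewrite mulr_natl cos_mulr2n c2; field; rewrite gt_eqF.
have S2 : sin (2 * atan t) = Im z / normc z.
  rewrite mulr_natl sin_mulr2n s1 mulrC -mulrA -expr2 c2 /t.
  by field; rewrite !gt_eqF.
have e (a : R) : normc z * (a / normc z) = a by rewrite mulrC divfK// gt_eqF.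
by rewrite /expi C2 S2; apply/eqP; rewrite eq_complex /= !mul0r addr0 subr0 !e !eqxx.
Qed.

Lemma Arg_gtNpi (z : C) : - pi < Arg z.
Proof.
rewrite /Arg; case: ifP => _; first by have := @pi_gt0 R; lra.
by have := atan_gtNpi2 (Im z / (normc z + Re z)); lra.
Qed.

Lemma Arg_lepi (z : C) : Arg z <= pi.
Proof.
rewrite /Arg; case: ifP => _; first by [].
by have := atan_ltpi2 (Im z / (normc z + Re z)); lra.
Qed.

Lemma Arg_ltpi (z : C) : slit z -> Arg z < pi.
Proof. by move=> sz; rewrite slitE//; have := atan_ltpi2 (Im z / (normc z + Re z)); lra. Qed.

Lemma Arg_cts (T : topologicalType) (f : T -> C) x : slit (f x) -> {for x, continuous f} ->
  {for x, continuous (fun t => Arg (f t))}.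
Proof.
move=> sf fx.
have fRe : {for x, continuous (fun t => Re (f t))} := cts_comp fx (@Re_continuous _ _).
have fIm : {for x, continuous (fun t => Im (f t))} := cts_comp fx (@Im_continuous _ _).
have fn := normc_cts fx.
have FF := nbhs_filter x.
have near : \forall t \near x, slit (f t).
  case/orP: sf => [i0|r0].
    have := neq0_nbhs (@norm_hausdorff _ R^o) fIm i0.
    by apply: (@filterS _ _ FF) => t h; rewrite /slit h.
  have := @cvgr_gt _ _ _ FF (fun t => Re (f t)) _ fRe _ r0.
  by apply: (@filterS _ _ FF) => t h; rewrite /slit h orbT.
have d : normc (f x) + Re (f x) != 0 by rewrite gt_eqF// slit_denom.
have h : {for x, continuous (fun t => 2 * atan (Im (f t) / (normc (f t) + Re (f t))))}.
  apply: ctsRM; first exact: cts_cst.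
  apply: (cts_comp _ (@continuous_atan R _)).
  apply: ctsRM => //.
  exact: (@cvgV _ _ _ FF _ _ d (ctsRD fn fRe)).
move: h; rewrite /prop_for /continuous_at /= -(slitE sf) => h; apply: cvg_trans h.
apply: near_eq_cvg; apply: (@filterS _ _ FF _ _ _ near) => t st.
by rewrite slitE.
Qed.

Lemma expiN (t : R) : expi (- t) = (expi t)^-1.
Proof.
apply: (mulfI (expi_neq0 t)); rewrite -expiD subrr expi0 divff//; exact: expi_neq0.
Qed.

(** After a change of sign t is nonnegative. Injectivity of the cosine on [0, pi] settles t <= pi;
    applied to [2 * pi - t] it excludes the larger values. *)
Lemma expi_pi2 (t : R) : expi t = 1 -> - (2 * pi) < t < 2 * pi -> t = 0.
Proof.
have p0 := @pi_gt0 R.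
move=> e; wlog t0 : t e / 0 <= t.
  move=> H /andP[h1 h2]; have [t0|t0] := leP 0 t; first by apply: H => //; rewrite h1.
  apply/oppr_inj; rewrite oppr0; apply: H; [by rewrite expiN e invr1|lra|].
  by apply/andP; split; lra.
move: e => [c s] /andP[_ h].
have [tp|tp] := leP t pi.
  by apply: (@cos_inj R); rewrite ?in_itv/= ?lexx ?t0 ?tp ?ltW// c cos0.
have : cos (2 * pi - t) = cos 0.
  by rewrite mulr_natl cosB cos2pi sin2pi mul0r mul1r addr0 c cos0.
move=> /(@cos_inj R); rewrite !in_itv/= lexx (ltW p0) => H.
have : 2 * pi - t = 0 by apply: H => //; apply/andP; split; lra.
by move=> H2; lra.
Qed.

Lemma expi_inj_near (s t : R) : expi s = expi t -> - (2 * pi) < s - t < 2 * pi -> s = t.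
Proof.
move=> e h; apply/eqP; rewrite -subr_eq0; apply/eqP; apply: expi_pi2 => //.
by rewrite expiD expiN e divff// expi_neq0.
Qed.

Lemma expi_period (k : int) : expi (2 * pi * k%:~R : R) = 1.
Proof.
have h (n : nat) : expi (2 * pi * n%:R : R) = 1.
  elim: n => [|n IH]; first by rewrite mulr0 expi0.
  by rewrite -[n.+1%:R]natr1 mulrDr mulr1 expiD IH expi2pi mulr1.
by case: k => n; rewrite ?h// NegzE mulrNz mulrN expiN h invr1.
Qed.

Lemma expi_eq1 (t : R) : expi t = 1 -> exists k : int, t = 2 * pi * k%:~R.
Proof.
have p0 := @pi_gt0 R.
move=> e; pose k := Num.floor (t / (2 * pi)); exists k.
have /andP[h1 h2] := floor_itv (t / (2 * pi)).
apply: expi_inj_near; first by rewrite expi_period.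
rewrite ler_pdivlMr ?mulr_gt0// in h1; rewrite ltr_pdivrMr ?mulr_gt0// in h2.
move: h1 h2; rewrite -/k intrD => h1 h2; apply/andP; split; lra.
Qed.

Lemma Arg_unique (r t : R) : 0 < r -> - pi < t < pi -> Arg (r%:C * expi t) = t.
Proof.
move=> r0 /andP[t1 t2]; set z := _ * _.
have z0 : z != 0 by rewrite mulf_neq0 ?expi_neq0// -normc_gt0 normc_real normr_gt0 gt_eqF.
have nz : normc z = r by rewrite Normc.normcM normc_expi normc_real mulr1 gtr0_norm.
have := ArgE z0; rewrite nz /z => /mulfI e.
apply/esym/expi_inj_near; first by apply: e; rewrite -normc_gt0 normc_real normr_gt0 gt_eqF.
have := Arg_gtNpi z; have := Arg_lepi z; rewrite /z => a1 a2; apply/andP; split; lra.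
Qed.

Lemma Arg_Re_gt0 (z : C) : 0 < Re z -> - (pi / 2) < Arg z < pi / 2.
Proof.
move=> r0; have sz : slit z by rewrite /slit r0 orbT.
rewrite slitE//; have d0 := slit_denom sz.
have := Im_le_normc z; rewrite ler_norml => /andP[i1 i2].
have n0 := normc_ge0 z.
have t1 : Im z / (normc z + Re z) < 1 by rewrite ltr_pdivrMr// mul1r; lra.
have t2 : - 1 < Im z / (normc z + Re z) by rewrite ltr_pdivlMr// mulN1r; lra.
have := lt_atan t1; have := lt_atan t2; rewrite atanN atan1 => a1 a2.
by apply/andP; split; lra.
Qed.

(** Both arguments lie in (-pi/2, pi/2), so their difference lies in (-pi, pi) and no multiple of 2
    pi is lost. The half plane estimates of the final comparison are used through this lemma. *)
Lemma Arg_div (z w : C) : 0 < Re z -> 0 < Re w -> Arg (z / w) = Arg z - Arg w.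
Proof.
move=> z0 w0; have /andP[a1 a2] := Arg_Re_gt0 z0; have /andP[b1 b2] := Arg_Re_gt0 w0.
have zn : z != 0 by apply: contraTneq z0 => ->; rewrite ltxx.
have wn : w != 0 by apply: contraTneq w0 => ->; rewrite ltxx.
have nz : 0 < normc z by rewrite normc_gt0.
have nw : 0 < normc w by rewrite normc_gt0.
rewrite (_ : z / w = (normc z / normc w)%:C * expi (Arg z - Arg w)).
  rewrite Arg_unique// ?divr_gt0//; apply/andP; split; lra.
rewrite {1}(ArgE zn) {1}(ArgE wn) expiD expiN fmorph_div /= invfM mulrACA//.
Qed.

Lemma slit_Re_div (z w : C) : 0 < Re z -> 0 < Re w -> slit (z / w).
Proof.
move=> z0 w0; apply/negPn/negP => h.
have wn : w != 0 by apply: contraTneq w0 => ->; rewrite ltxx.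
have zn : z != 0 by apply: contraTneq z0 => ->; rewrite ltxx.
have q0 : z / w != 0 by rewrite mulf_neq0 ?invr_eq0.
have /andP[/eqP i0 r0] := not_slit q0 h.
have : z = (Re (z / w))%:C * w.
  rewrite (_ : (Re (z / w))%:C = z / w) ?divfK//.
  by apply/eqP; rewrite eq_complex /= i0 !eqxx.
move=> /(congr1 Re); have -> : Re ((Re (z / w))%:C * w) = Re (z / w) * Re w.
  by case: (w) => a b /=; rewrite mul0r subr0.
by move=> e; move: z0; rewrite e pmulr_lgt0// ltNge ltW.
Qed.

End Argument.

(** * All circles around a line are homologous *)

Section Meridians.
Variable R : realType.
Local Notation C := R[i].
Local Notation V := 'rV[C]_3.
Local Notation normc := Normc.normc.
Variable A : seq (line R).
Hypothesis A0 : A != [::].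

(** As a polynomial in t, Im ((1 + i t) z) is Im z + t Re z, which is nonzero when z is. *)
Lemma generic_complex (zs : seq C) (e : R) : 0 < e -> (forall z, z \in zs -> z != 0) ->
  exists t, [/\ 0 < t, t < e & forall z, z \in zs -> complex.Im ((1 +i* t) * z) != 0].
Proof.
move=> e0 zs0.
pose ps : seq {poly R} := [seq (complex.Im z)%:P + complex.Re z *: 'X | z <- zs].
have ps0 p : p \in ps -> p != 0.
  move=> /mapP[z zzs ->]; apply: contra (zs0 z zzs) => /eqP/polyP h.
  have := h 0%N; have := h 1%N; rewrite !coefD !coefZ !coefC !coefX /= !mulr1 !mulr0 !addr0 add0r.
  by move=> re im; rewrite eq_complex re im !eqxx.
have [t [t0 te tP]] := generic_nonroot e0 ps0.
exists t; split=> // z zzs; have := tP _ (map_f _ zzs); rewrite !hornerE.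
by case: (z) => a b /=; rewrite mul1r [t * a]mulrC.
Qed.

Lemma cts01_cst (v : V) : cts01 (fun=> v). Proof. by move=> T f x _ _; exact: cts_cst. Qed.

Lemma cts01_scale (c : R -> C) (w : R -> V) : ctsC01 c -> cts01 w -> cts01 (fun s => c s *: w s).
Proof. by move=> cc wc T f x f01 fx; apply: cts_scalev; [exact: cc|exact: wc]. Qed.

Lemma cts01_add (v w : R -> V) : cts01 v -> cts01 w -> cts01 (fun s => v s + w s).
Proof. by move=> cc wc T f x f01 fx; apply: cts_addv; [exact: cc|exact: wc]. Qed.

Lemma ctsC01_real : ctsC01 (fun s : R => s%:C).
Proof. by move=> T f x f01 fx; exact: ctsC. Qed.

Lemma ctsC01_1sub : ctsC01 (fun s : R => (1 - s)%:C).
Proof.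
move=> T f x f01 fx; apply: ctsC; apply: ctsRD; [exact: cts_cst|exact: ctsRN].
Qed.

Lemma circ_rotate L v w c rho rho' : c != 0 -> disc A L v w rho -> disc A L v (c *: w) rho' ->
  bounds A (<< path (circ v w rho) >> - << path (circ v (c *: w) rho') >>).
Proof.
move=> c0 d d'.
(* A path from 1 to c through nonzero numbers: modulus and angle are interpolated separately. *)
pose g (s : R) : C := (1 + s * (normc c - 1))%:C * expi (s * Arg c).
have g0 : g 0 = 1 by rewrite /g !mul0r addr0 expi0 mulr1.
have g1 : g 1 = c by rewrite /g !mul1r addrC subrK -ArgE.
have gn0 s : 0 <= s <= 1 -> g s != 0.
  move=> s01; rewrite mulf_neq0 ?expi_neq0// -normc_gt0 normc_real normr_gt0.
  have n0 : 0 < normc c by rewrite normc_gt0.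
  by rewrite gt_eqF//; nra.
have gc : ctsC01 g.
  move=> T f x f01 fx; apply: ctsM.
    apply: ctsC; apply: ctsRD; first exact: cts_cst.
    by apply: ctsRM => //; exact: cts_cst.
  by apply: expi_cts; apply: ctsRM => //; exact: cts_cst.
have [Lv Lw rho0 h] := d.
have := @circ_homotopy_any _ A A0 L (fun=> v) (fun s => g s *: w) rho rho' (@cts01_cst v)
  (cts01_scale gc (@cts01_cst w)).
rewrite g0 g1 scale1r; apply=> //.
- by move=> s s01; rewrite pairingZr mulf_neq0// gn0.
- move=> s L' s01 L'A LL'; rewrite -normc_gt0; apply: le_lt_trans (h L' L'A LL').
  by rewrite mulr_ge0 ?normc_ge0// ltW.
Qed.

Lemma disc_neq0 L L' v w rho : disc A L v w rho -> L' \in A -> L' != L -> pairing (coords L') v != 0.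
Proof.
move=> [_ _ r0 h] L'A LL'; rewrite -normc_gt0; apply: le_lt_trans (h L' L'A LL').
by rewrite mulr_ge0 ?normc_ge0// ltW.
Qed.

Lemma disc_admissible L v w rho : disc A L v w rho -> admissible A (circ v w rho).
Proof.
move=> d; have [_ _ r0 _] := d; split.
  move=> T f x f01 fx; apply: cts_addv; first exact: cts_cst.
  apply: cts_scalev; last exact: cts_cst.
  apply: ctsM; first exact: cts_cst.
  by apply: expi_cts; apply: ctsRM => //; exact: cts_cst.
move=> t _; apply: disc_avoid d _ _; first exact: circ_coeff_neq0.
by rewrite circ_normc.
Qed.

Lemma sqr_normcE (z : C) : z * conjc z = (normc z ^+ 2)%:C.
Proof. by rewrite -sqr_normc normC_normc rmorphXn. Qed.

(* The factor [1 +i* t] is chosen so that the segment from [v] to [(1 +i* t) *: v']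
   meets no line of [A] other than [L]. *)
Lemma circ_unique L v w rho v' w' rho' : disc A L v w rho -> disc A L v' w' rho' ->
  bounds A (<< path (circ v w rho) >> - << path (circ v' w' rho') >>).
Proof.
move=> d d'; have [Lv Lw r0 h] := d; have [Lv' Lw' r'0 h'] := d'.
pose zs := [seq pairing (coords L') v' * conjc (pairing (coords L') v) | L' <- A & L' != L].
have [t [t0 _ tP]] : exists t, [/\ 0 < t, t < 1 & forall z, z \in zs -> complex.Im ((1 +i* t) * z) != 0].
  apply: generic_complex => // z /mapP[L']; rewrite mem_filter => /andP[LL' L'A] ->.
  by rewrite mulf_neq0 ?conjc_eq0 ?(disc_neq0 d') ?(disc_neq0 d).
pose k : C := 1 +i* t.
have k0 : k != 0 by rewrite eq_complex /= oner_eq0.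
pose vs s : V := (1 - s)%:C *: v + s%:C *: (k *: v').
(* Both transverse directions are normalised to L = 1, so that their convex combinations stay
   transverse to L. *)
have [w1 w1E] : exists u, u = (pairing (coords L) w)^-1 *: w by eexists.
have [w1' w1E'] : exists u, u = (pairing (coords L) w')^-1 *: w' by eexists.
have Lw1 : pairing (coords L) w1 = 1 by rewrite w1E pairingZr mulVf.
have Lw1' : pairing (coords L) w1' = 1 by rewrite w1E' pairingZr mulVf.
pose ws s : V := (1 - s)%:C *: w1 + s%:C *: w1'.
have vs0 : vs 0 = v by rewrite /vs subr0 scale1r scale0r addr0.
have vs1 : vs 1 = k *: v' by rewrite /vs subrr scale1r scale0r add0r.
have ws0 : ws 0 = w1 by rewrite /ws subr0 scale1r scale0r addr0.
have ws1 : ws 1 = w1' by rewrite /ws subrr scale1r scale0r add0r.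
have hv s : pairing (coords L) (vs s) = 0 by rewrite !pairingE Lv Lv' !mulr0 addr0.
have hw s : pairing (coords L) (ws s) != 0.
  by rewrite pairingD pairingZr [X in _ + X]pairingZr Lw1 Lw1' !mulr1 -rmorphD subrK oner_eq0.
have hvs s L' : 0 <= s <= 1 -> L' \in A -> L' != L -> pairing (coords L') (vs s) != 0.
  move=> s01 L'A LL'; apply/eqP => e.
  have lv := disc_neq0 d L'A LL'.
  have zin : pairing (coords L') v' * conjc (pairing (coords L') v) \in zs.
    by apply/mapP; exists L' => //; rewrite mem_filter LL'.
  have := tP _ zin; rewrite -/k; move: e; rewrite !pairingE => e.
  set z := pairing _ v' * _ => Iz.
  (* Multiplied by the conjugate of L'(v) the first summand is real, so the imaginary part leaves s
     times a nonzero number. *)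
  have /(congr1 (@complex.Im R)) : (1 - s)%:C * (pairing (coords L') v * conjc (pairing (coords L') v)) +
     s%:C * (k * z) = 0.
    by rewrite -(mul0r (conjc (pairing (coords L') v))) -e /z; ring.
  rewrite sqr_normcE; move: Iz; case: (k * z) => a b /= b0.
  rewrite mulr0 !mul0r !addr0 add0r => /eqP; rewrite mulf_eq0 (negPf b0) orbF => /eqP s0.
  by move: e; rewrite s0 subr0 !mul0r addr0 mul1r => /eqP; rewrite (negPf lv).
have [rho1 d1] : exists rho1, disc A L v w1 rho1.
  apply: disc_radius; rewrite ?Lw1 ?oner_eq0//.
  by move=> L' L'A LL'; exact: (disc_neq0 d).
have [rho2 d2] : exists rho2, disc A L (k *: v') w1' rho2.
  apply: disc_radius; rewrite ?Lw1' ?oner_eq0 ?pairingZr ?Lv' ?mulr0//.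
  by move=> L' L'A LL'; rewrite pairingZr mulf_neq0// (disc_neq0 d').
have d3 : disc A L v' (k^-1 *: w1') rho2.
  have [_ _ r2 h2] := d2; split=> //; first by rewrite pairingZr Lw1' mulr1 invr_eq0.
  move=> L' L'A LL'; have := h2 L' L'A LL'.
  rewrite (pairingZr _ k v') (pairingZr _ k^-1 w1') (Normc.normcM k) (Normc.normcM k^-1) Normc.normcV.
  by rewrite -mulrA ltr_pdivrMl ?normc_gt0.
(* The vectors of the two circles differ by the scalar k, so the projective points agree. *)
have e23 : path (circ (k *: v') w1' rho2) = path (circ v' (k^-1 *: w1') rho2).
  apply: path_proj_ext => s s01.
  have n0 := avoid_neq0 A0 ((disc_admissible d3).2 s s01).
  rewrite -(projZ k0 n0) /circ; congr proj.
  by rewrite scalerDr !scalerA; congr (_ + _ *: _); move: (expi _) => ee; field.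
have h1 : bounds A (<< path (circ v w rho) >> - << path (circ v w1 rho1) >>).
  by move: d1; rewrite w1E; apply: circ_rotate d; rewrite invr_eq0.
have h2 : bounds A (<< path (circ v w1 rho1) >> - << path (circ v' (k^-1 *: w1') rho2) >>).
  have vsc : cts01 vs := cts01_add (cts01_scale ctsC01_1sub (@cts01_cst v)) (cts01_scale ctsC01_real (@cts01_cst (k *: v'))).
  have wsc : cts01 ws := cts01_add (cts01_scale ctsC01_1sub (@cts01_cst w1)) (cts01_scale ctsC01_real (@cts01_cst w1')).
  have := @circ_homotopy_any _ A A0 L vs ws rho1 rho2 vsc wsc (fun s _ => hv s) (fun s _ => hw s) hvs.
  by rewrite vs0 vs1 ws0 ws1 e23 => H; exact: H d1 d2.
have h3 : bounds A (<< path (circ v' w' rho') >> - << path (circ v' (k^-1 *: w1') rho2) >>).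
  move: d3; rewrite w1E' scalerA => d3; apply: circ_rotate d' d3.
  by rewrite mulf_neq0 ?invr_eq0.
by apply: (bounds_eq (boundsB (boundsD h1 h2) h3)); path_ring.
Qed.

Lemma homology_class_eq (z z' : cycle1 R (complement A)) :
  bounds A (cycle_val z - cycle_val z') -> homology_class z = homology_class z'.
Proof.
move=> [b [bA bz]]; apply/eqP; rewrite -Quotient.idealrBE; apply/asboolP.
by exists b; split=> //; rewrite bz raddfB.
Qed.

Lemma circ_cycle L v w rho : disc A L v w rho ->
  (<< path (circ v w rho) >> : chain R (CP2 R) 1) \in is_cycle (complement A).
Proof.
move=> d; have ad := disc_admissible d; apply/asboolP; split.
  move=> s; rewrite domU1 inE => /eqP -> _ [x _ <-]; rewrite (pathE A0 _ ad).
  by apply: (proj_complement A0); apply: ad.2; exact: edge_param01.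
rewrite /boundary liftU scale1r big_ord_recl big_ord1 expr0 expr1 scale1r scaleN1r.
apply/eqP; rewrite subr_eq0; apply/eqP; congr (<< _ >>); apply/continuousEP => x /=.
rewrite !(pathE A0 _ ad) !edge_param_face /= /circ mulr1 mulr0 expi0 expi2pi.
by [].
Qed.

Lemma disc_is_meridian L v w rho : L \in A -> v != 0 -> disc A L v w rho ->
  forall z : cycle1 R (complement A), cycle_val z = << path (circ v w rho) >> ->
  is_meridian L (homology_class z).
Proof.
move=> LA v0 d z zE; have [Lv Lw r0 h] := d.
exists v, w, rho, (path (circ v w rho)), z; split=> //; split=> //.
  move=> u L' ur L'A LL'; rewrite pairingD pairingZr -normc_gt0.
  apply: lt_le_trans (ler_normcB _ _); rewrite subr_gt0; apply: le_lt_trans (h L' L'A LL').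
  by rewrite Normc.normcM mulrC ler_wpM2l// normc_ge0.
by move=> x; rewrite (pathE A0 x (disc_admissible d)).
Qed.

Lemma is_meridian_disc L m : is_meridian (A := A) L m -> exists v w rho z,
  [/\ disc A L v w rho, cycle_val z = << path (circ v w rho) >> & m = homology_class z].
Proof.
move=> [v [w [rho [s [z [v0 Lv Lw r0 [h sE [zE mE]]]]]]]].
have d : disc A L v w rho.
  split=> // L' L'A LL'; rewrite ltNge; apply/negP => le.
  have vn : pairing (coords L') v != 0.
    have := h 0 L' _ L'A LL'; rewrite scale0r addr0 Normc.normc0; apply; exact: ltW.
  have wn : pairing (coords L') w != 0.
    apply: contraNneq vn => w0; move: le; rewrite w0 Normc.normc0 mul0r.
    by rewrite le_eqVlt normc_eq0 ltNge normc_ge0 orbF.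
  (* This u is the zero of L' in the complex line of the disc; under the negated inequality its
     modulus is at most rho. *)
  have := h (- pairing (coords L') v / pairing (coords L') w) L' _ L'A LL'.
  rewrite pairingD pairingZr divfK// subrr eqxx => H; suff : false by [].
  apply: H; rewrite Normc.normcM Normc.normcV ler_pdivrMr ?normc_gt0// mulrC.
    by rewrite (_ : normc (- _) = normc (pairing (coords L') v))//; case: (pairing _ v) => a b /=; rewrite !sqrrN.
exists v, w, rho, z; split=> //; rewrite zE; congr (<< _ >>).
apply/continuousEP => x; by rewrite sE (pathE A0 x (disc_admissible d)).
Qed.

(** [meridian] is a choice among circles of discs, and all of these are homologous, so any disc
    computes it. *)
Lemma meridianE L v w rho (z : cycle1 R (complement A)) : L \in A -> v != 0 ->
  disc A L v w rho -> cycle_val z = << path (circ v w rho) >> -> meridian A L = homology_class z.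
Proof.
move=> LA v0 d zE.
have : is_meridian L (meridian A L).
  rewrite /meridian; apply: (@xgetPex _ 0 [set m | is_meridian L m]).
  by exists (homology_class z); exact: (disc_is_meridian LA v0 d).
move=> /is_meridian_disc[v' [w' [rho' [z' [d' zE' ->]]]]].
apply: homology_class_eq; rewrite zE zE'; exact: circ_unique d' d.
Qed.

End Meridians.

(** * Continuous arguments on simplices *)

Section Lifts.
Variable R : realType.
Local Notation C := R[i].
Local Notation normc := Normc.normc.
Local Notation simplex := (std_simplex R).

Lemma std_simplex_compact n : compact (simplex n).
Proof.
have -> : simplex n = [set v : 'rV[R]_n.+1 | forall i, `[0, 1]%classic (v ord0 i)] `&`
    (fun v : 'rV[R]_n.+1 => \sum_i v 0 i) @^-1` [set 1].
  apply/seteqP; split=> v /= [h1 h2]; split=> // i.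
    rewrite in_itv/=; apply/andP; split; first exact: h1.
    by rewrite -h2 (bigD1 i)//= lerDl; apply: sumr_ge0 => j _; exact: h1.
  by have := h1 i; rewrite in_itv/= => /andP[].
apply: compact_closedI; first by apply: (@rV_compact R n.+1 (fun=> `[0, 1]%classic)) => i; exact: segment_compact.
apply: preimage_closed; last exact: closed_eq.
move=> v _; apply: (@eq_cts _ _ (fun v : 'rV[R]_n.+1 => \sum_(i <- enum 'I_n.+1) v 0 i)).
  by move=> u; rewrite big_enum.
elim: (enum _) => [|i s IH].
  by apply: (@eq_cts _ _ (fun=> 0)) => [u|]; [rewrite big_nil|exact: cts_cst].
apply: (@eq_cts _ _ (fun u : 'rV[R]_n.+1 => u 0 i + \sum_(j <- s) u 0 j)).
  by move=> u; rewrite big_cons.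
by apply: ctsRD; [exact: coord_continuous|exact: IH].
Qed.

Definition near_pts n (e : R) (x y : simplex n) : Prop := forall i, `|bary i x - bary i y| < e.

Lemma nbhs_near_pts n (x : simplex n) (U : set (simplex n)) : nbhs x U ->
  exists e, 0 < e /\ forall y, near_pts e x y -> U y.
Proof.
rewrite /nbhs/= => -[_ [[W oW <-] /= Wx WU]].
have /nbhs_ballP[e e0 h] : nbhs (\val x : 'rV[R]_n.+1) W by exact: open_nbhs_nbhs.
exists e; split=> // y xy; apply: WU => /=; apply: h; split=> // i j; rewrite ord1; exact: xy.
Qed.

(** Uniform continuity relative to the size of f. Near x, values vary by less than |f x| / 3; for x'
    and y there, |f y - f x'| < 2/3 |f x| < |f x'|. Compactness makes the distance e uniform, and f
    y / f x then has positive real part. *)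
Lemma uniform_ratio n (f : simplex n -> C) : continuous f -> (forall x, f x != 0) ->
  exists e, 0 < e /\ forall x y, near_pts e x y -> normc (f y - f x) < normc (f x).
Proof.
move=> fc f0.
have := @std_simplex_compact n; move/compact_near_coveringP/near_covering_withinP.
pose P (e : R) (v : 'rV[R]_n.+1) := forall x y : simplex n, \val x = v ->
  near_pts e x y -> normc (f y - f x) < normc (f x).
move=> /(_ _ (0:R)^'+ P (@at_right_proper_filter _ _)) H.
have : \forall e \near 0^'+, simplex n `<=` P e.
  apply: H => v /mem_set vS; pose x : simplex n := SigSub vS.
  have nx : 0 < normc (f x) / 3 by rewrite divr_gt0// normc_gt0.
  have hU : nbhs x [set y | normc (f y - f x) < normc (f x) / 3].
    have c : {for x, continuous (fun y => normc (f y - f x))}.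
      by apply: normc_cts; apply: ctsD; [exact: fc|exact: cts_cst].
    have := @cvgr_lt _ _ _ (nbhs_filter x) _ _ c (normc (f x) / 3).
    by rewrite subrr Normc.normc0; apply.
  have [e [e0 he]] := nbhs_near_pts hU.
  have h1 : nbhs v [set v' : 'rV[R]_n.+1 | forall i, `|v 0 i - v' 0 i| < e / 2].
    apply/nbhs_ballP; exists (e / 2) => /=; first by rewrite divr_gt0.
    by move=> v' [_ h] i; exact: h.
  have h2 : \forall r \near 0^'+, r < e / 2 by apply: nbhs_right_lt; rewrite divr_gt0.
  exists ([set v' : 'rV[R]_n.+1 | forall i, `|v 0 i - v' 0 i| < e / 2], [set r | r < e / 2]) => //.
  move=> [v' r] [/= hv' hr] v'S x' y x'v' xy.
  have hx' : normc (f x' - f x) < normc (f x) / 3.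
    apply: he => i; apply: (@lt_trans _ _ (e / 2)); last lra.
    by rewrite /bary x'v'; exact: hv'.
  have hy : normc (f y - f x) < normc (f x) / 3.
    apply: he => i; rewrite -(subrK (bary i x') (bary i x)) -addrA.
    apply: le_lt_trans (ler_normD _ _) _.
    have u1 : `|bary i x - bary i x'| < e / 2 by rewrite /bary x'v'; exact: hv'.
    by have := xy i; have hr' : r < e / 2 := hr; lra.
  have t1 : normc (f y - f x') <= normc (f y - f x) + normc (f x' - f x).
    have -> : f y - f x' = (f y - f x) + - (f x' - f x) by rewrite opprB addrA subrK.
    apply: le_trans (ler_normcD _ _) _; rewrite lerD2l.
    by case: (f x' - f x) => a b /=; rewrite !sqrrN.
  have t2 : normc (f x) - normc (f x' - f x) <= normc (f x').
    have := ler_normcB (f x) (f x' - f x); rewrite addrCA subrr addr0; exact.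
  by lra.
move=> [e /= e0 he].
exists (e / 2); split; first by rewrite divr_gt0.
move=> x y xy; apply: (he (e / 2) _ _ (\val x) _ x y) => //.
- by rewrite /= sub0r normrN gtr0_norm ?divr_gt0//; lra.
- by rewrite divr_gt0.
- by apply: set_mem; case: (x).
Qed.

Lemma contract_proof n (t : R) (x : simplex n) :
  (\row_i ((1 - clamp t) * (i == 0)%:R + clamp t * bary i x)) \in simplex n.
Proof.
apply/mem_set; split=> [i|].
  by rewrite mxE addr_ge0 ?mulr_ge0 ?bary_ge0 ?clamp_ge0 ?subr_ge0 ?clamp_le1.
rewrite (eq_bigr (fun i => (1 - clamp t) * (i == 0)%:R + clamp t * bary i x)); last first.
  by move=> i _; rewrite mxE.
rewrite big_split/= -!mulr_sumr sum_bary mulr1 (bigD1 0)//= big1 ?addr0 ?mulr1 ?subrK//.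
by move=> i /negPf ->.
Qed.

(** Contraction onto the vertex 0; along its rays an argument is continued from that vertex to x. *)
Definition contract n (t : R) (x : simplex n) : simplex n := SigSub (contract_proof t x).

Lemma bary_contract n (t : R) (x : simplex n) i :
  bary i (contract t x) = (1 - clamp t) * (i == 0)%:R + clamp t * bary i x.
Proof. by rewrite /bary /= mxE. Qed.

Lemma contract1 n (x : simplex n) : contract 1 x = x.
Proof.
by apply: simplex_eq => i; rewrite bary_contract clampE ?lexx ?ler01// subrr mul0r add0r mul1r.
Qed.

Lemma contract0 n (x y : simplex n) : contract 0 x = contract 0 y.
Proof.
by apply: simplex_eq => i; rewrite !bary_contract clampE ?lexx ?ler01// !mul0r.
Qed.

Lemma contract_cts n (t : R) (x : simplex n) : {for x, continuous (@contract n t)}.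
Proof.
apply: cts_simplex => i; apply: (@eq_cts _ _ (fun y => (1 - clamp t) * (i == 0)%:R + clamp t * bary i y)).
  by move=> y; rewrite bary_contract.
apply: ctsRD; first exact: cts_cst.
by apply: ctsRM; [exact: cts_cst|exact: bary_cts].
Qed.

Lemma contract_near n (s t e : R) (x : simplex n) : 0 <= s <= 1 -> 0 <= t <= 1 -> `|s - t| < e ->
  near_pts e (contract s x) (contract t x).
Proof.
move=> s01 t01 st i; rewrite !bary_contract !clampE//.
have -> : (1 - s) * (i == 0)%:R + s * bary i x - ((1 - t) * (i == 0)%:R + t * bary i x) =
  (s - t) * (bary i x - (i == 0)%:R) by ring.
rewrite normrM; apply: le_lt_trans st; rewrite ler_piMr// ler_norml.
have := bary_ge0 i x; have := bary_le1 i x; case: (i == 0) => /= h1 h2; apply/andP; split; lra.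
Qed.

Definition unitc (z : C) : C := z / (normc z)%:C.

Lemma unitcM z w : unitc (z * w) = unitc z * unitc w.
Proof. by rewrite /unitc Normc.normcM rmorphM /= invfM mulrACA. Qed.

Lemma expi_Arg z : z != 0 -> expi (Arg z) = unitc z.
Proof.
move=> z0; rewrite /unitc {2}(ArgE z0) mulrC mulKf//.
by rewrite -normc_gt0 normc_real normr_gt0 gt_eqF// normc_gt0.
Qed.

Lemma unitcV z : unitc z^-1 = (unitc z)^-1.
Proof. by rewrite /unitc Normc.normcV fmorphV /= invfM. Qed.

Definition is_lift n (f : simplex n -> C) (F : simplex n -> R) : Prop :=
  continuous F /\ forall x, expi (F x) = unitc (f x).

(** Quotients of f at consecutive stages of the contraction lie in the right half plane, where [Arg]
    is continuous. Their arguments, added to the one at the vertex, give a continuous argument of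
    f. *)
Lemma lift_exists n (f : simplex n -> C) : continuous f -> (forall x, f x != 0) ->
  exists F, is_lift f F.
Proof.
move=> fc f0; have [e [e0 he]] := uniform_ratio fc f0.
have [N Ne] : exists N : nat, e^-1 < N.+1%:R.
  exists (Num.truncn e^-1); exact: truncnS_gt.
pose tj (j : nat) : R := j%:R / N.+1%:R.
have tj01 j : (j <= N.+1)%N -> 0 <= tj j <= 1.
  move=> jN; rewrite /tj divr_ge0//= ler_pdivrMr ?ltr0n// mul1r ler_nat//.
have step j : (j < N.+1)%N -> `|tj j - tj j.+1| < e.
  move=> jN; rewrite -mulrBl -natr1 opprD addrA subrr sub0r mulN1r normrN gtr0_norm ?invr_gt0 ?ltr0n//.
  by rewrite -[e]invrK ltf_pV2 ?posrE ?ltr0n ?invr_gt0.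
have r0 j x : (j < N.+1)%N -> 0 < complex.Re (f (contract (tj j.+1) x) / f (contract (tj j) x)).
  move=> jN; have := he _ _ (contract_near x (tj01 j (ltnW jN)) (tj01 j.+1 jN) (step j jN)).
  set a := f _; set b := f _ => h.
  have b0 : b != 0 by exact: f0.
  have -> : a / b = 1 + (a - b) / b by field.
  have h2 : normc ((a - b) / b) < 1 by rewrite Normc.normcM Normc.normcV ltr_pdivrMr ?mul1r ?normc_gt0.
  have := Re_le_normc ((a - b) / b); rewrite ler_norml => /andP[h3 _].
  by move: h2 h3; case: ((a - b) / b) => u v /=; lra.
pose F k x := Arg (f (contract 0 x)) +
  \sum_(0 <= j < k) Arg (f (contract (tj j.+1) x) / f (contract (tj j) x)).
have FP k : (k <= N.+1)%N -> continuous (F k) /\ forall x, expi (F k x) = unitc (f (contract (tj k) x)).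
  elim: k => [_|k IH kN].
    rewrite /F; split=> x.
      apply: (@eq_cts _ _ (fun=> Arg (f (contract 0 x)))); last exact: cts_cst.
      by move=> y; rewrite big_geq// addr0 (contract0 x y).
    by rewrite big_geq// addr0 expi_Arg// /tj mul0r.
  have [IH1 IH2] := IH (ltnW kN).
  have FS x : F k.+1 x = F k x + Arg (f (contract (tj k.+1) x) / f (contract (tj k) x)).
    by rewrite /F big_nat_recr//= addrA.
  split=> x.
    apply: (@eq_cts _ _ (fun x => F k x + Arg (f (contract (tj k.+1) x) / f (contract (tj k) x)))).
      by move=> y; rewrite FS.
    apply: ctsRD; first exact: IH1.
    apply: Arg_cts; first by rewrite /slit r0// orbT.
    apply: ctsM; first exact: (cts_comp (@contract_cts n _ x) (fc _)).
    by apply: ctsV; [exact: f0|exact: (cts_comp (@contract_cts n _ x) (fc _))].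
  rewrite FS expiD IH2 expi_Arg ?mulf_neq0 ?invr_eq0// -unitcM mulrC divfK//.
exists (F N.+1); have [h1 h2] := FP N.+1 (leqnn _); split=> // x.
by rewrite h2 /tj divff ?pnatr_eq0// contract1.
Qed.

Lemma lift_diff n (f : simplex n -> C) F F' : is_lift f F -> is_lift f F' ->
  forall x, expi (F x - F' x) = 1.
Proof.
move=> [_ h1] [_ h2] x; rewrite expiD expiN h1 -h2 divff//; exact: expi_neq0.
Qed.

(** Two lifts differ by a continuous function with values in the multiples of 2 pi. If it were not
    equal at the ends, it would take the value [D 0 + pi] in between, where the exponential is
    -1. *)
Lemma lift_unique (f : simplex 1 -> C) F F' : is_lift f F -> is_lift f F' ->
  F (pt1 1) - F (pt1 0) = F' (pt1 1) - F' (pt1 0).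
Proof.
have p0 := @pi_gt0 R.
wlog le : F F' / F (pt1 0) - F' (pt1 0) <= F (pt1 1) - F' (pt1 1).
  move=> H hF hF'.
  have [h|/ltW h] := leP (F (pt1 0) - F' (pt1 0)) (F (pt1 1) - F' (pt1 1)); first exact: H.
  by apply/esym/H => //; lra.
move=> hF hF'; pose D t := F (pt1 t) - F' (pt1 t).
have Dc : continuous D.
  move=> t.
  exact: (ctsRD (cts_comp (@pt1_cts _ t) (hF.1 _)) (ctsRN (cts_comp (@pt1_cts _ t) (hF'.1 _)))).
have D1 t : expi (D t) = 1 := lift_diff hF hF' (pt1 t).
have [E|NE] := eqVneq (D 0) (D 1); first by move: E; rewrite /D; lra.
have lt : D 0 < D 1 by rewrite lt_neqAle NE.
have lt2 : D 0 + 2 * pi <= D 1.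
  rewrite leNgt; apply/negP => h; move: NE; rewrite (expi_inj_near (s := D 1) (t := D 0)) ?eqxx ?D1//.
  by apply/andP; split; lra.
have mm : Num.min (D 0) (D 1) <= D 0 + pi <= Num.max (D 0) (D 1).
  rewrite min_l ?(ltW lt)// max_r ?(ltW lt)//; apply/andP; split; lra.
have [c _ cE] := @IVT R D 0 1 (D 0 + pi) ler01 (continuous_subspaceT Dc) mm.
have := D1 c; rewrite cE expiD D1 mul1r /expi cospi sinpi => /eqP; rewrite eq_complex /= => /andP[/eqP].
by lra.
Qed.

(** The increment of a continuous argument along f; by [lift_unique] the choice of the lift does not
    affect it, and [lift_exists] keeps continuous nowhere vanishing f away from the default 0. *)
Definition wind (f : simplex 1 -> C) : R :=
  xget 0 [set d | exists F, is_lift f F /\ d = F (pt1 1) - F (pt1 0)].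

Lemma windE (f : simplex 1 -> C) F : is_lift f F -> wind f = F (pt1 1) - F (pt1 0).
Proof.
move=> hF; rewrite /wind.
have : [set d | exists F, is_lift f F /\ d = F (pt1 1) - F (pt1 0)] (wind f).
  by apply: (@xgetPex _ 0); exists (F (pt1 1) - F (pt1 0)), F.
by rewrite -/(wind f) => -[F' [hF' ->]]; exact: lift_unique hF' hF.
Qed.

Lemma is_lift_div n (f g : simplex n -> C) F G : is_lift f F -> is_lift g G ->
  is_lift (fun x => f x / g x) (fun x => F x - G x).
Proof.
move=> [Fc FE] [Gc GE]; split; first by move=> x; exact: (ctsRD (Fc x) (ctsRN (Gc x))).
by move=> x; rewrite expiD expiN FE GE unitcM unitcV.
Qed.

Lemma wind_div (f g : simplex 1 -> C) : continuous f -> continuous g ->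
  (forall x, f x != 0) -> (forall x, g x != 0) ->
  wind (fun x => f x / g x) = wind f - wind g.
Proof.
move=> fc gc f0 g0; have [F hF] := lift_exists fc f0; have [G hG] := lift_exists gc g0.
by rewrite (windE (is_lift_div hF hG)) (windE hF) (windE hG); lra.
Qed.

Lemma is_lift_slit n (f : simplex n -> C) : continuous f -> (forall x, slit (f x)) ->
  is_lift f (fun x => Arg (f x)).
Proof.
move=> fc fs; split=> x; first by exact: (Arg_cts (fs x) (fc x)).
by rewrite expi_Arg//; exact: slit_neq0.
Qed.

Lemma wind_slit (f : simplex 1 -> C) : continuous f -> (forall x, slit (f x)) ->
  wind f = Arg (f (pt1 1)) - Arg (f (pt1 0)).
Proof. by move=> fc fs; rewrite (windE (is_lift_slit fc fs)). Qed.

Lemma wind_scale (f : simplex 1 -> C) c : c != 0 -> continuous f -> (forall x, f x != 0) ->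
  wind (fun x => f x * c) = wind f.
Proof.
move=> c0 fc f0; have [F hF] := lift_exists fc f0.
have h : is_lift (fun x => f x * c) (fun x => F x + Arg c).
  split=> x; first by exact: (ctsRD (hF.1 x) (@cts_cst _ _ (Arg c) x)).
  by rewrite expiD hF.2 expi_Arg// unitcM.
by rewrite (windE h) (windE hF); lra.
Qed.

Lemma eq_wind (f g : simplex 1 -> C) : f =1 g -> wind f = wind g.
Proof. by move=> /funext ->. Qed.

Lemma face_pt1 : [/\ face 0 (pt1 1) = face 1 (pt1 (1 : R)), face 0 (pt1 0) = face ord_max (pt1 (1 : R))
  & face 1 (pt1 0) = face ord_max (pt1 (0 : R))].
Proof.
have e1 : edge_param (pt1 1) = 1 :> R by rewrite edge_param_pt1 clampE ?lexx ?ler01.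
have e0 : edge_param (pt1 0) = 0 :> R by rewrite edge_param_pt1 clampE ?lexx ?ler01.
have H (x y : simplex 2) : bary 0 x = bary 0 y -> bary 1 x = bary 1 y ->
    bary ord_max x = bary ord_max y -> x = y.
  move=> h0 h1 h2; apply: simplex_eq => -[[|[|[|//]]] p].
  - by rewrite (_ : Ordinal p = 0)//; apply: val_inj.
  - by rewrite (_ : Ordinal p = 1)//; apply: val_inj.
  - by rewrite (_ : Ordinal p = ord_max)//; apply: val_inj.
have [[a1 a2 a3] [[b1 b2 b3] [c1 c2 c3]]] := face_bary (pt1 (1 : R)).
have [[a1' a2' a3'] [[b1' b2' b3'] [c1' c2' c3']]] := face_bary (pt1 (0 : R)).
split; [apply: (H (face 0 _) (face 1 _))|apply: (H (face 0 _) (face ord_max _))|apply: (H (face 1 _) (face ord_max _))]; rewrite ?a1 ?a2 ?a3 ?b1 ?b2 ?b3 ?c1 ?c2 ?c3 ?a1' ?a2' ?a3' ?b1' ?b2' ?b3' ?c1' ?c2' ?c3' ?e1 ?e0 ?subrr ?subr0//.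
Qed.

(** A lift on the whole triangle restricts to lifts on the edges, and its values at the vertices
    cancel. *)
Lemma wind_boundary (f : simplex 2 -> C) : continuous f -> (forall x, f x != 0) ->
  wind (fun x => f (face 0 x)) - wind (fun x => f (face 1 x)) + wind (fun x => f (face ord_max x)) = 0.
Proof.
move=> fc f0; have [F hF] := lift_exists fc f0.
have h i : is_lift (fun x => f (face i x)) (fun x => F (face i x)).
  split=> x; last exact: hF.2.
  exact: (cts_comp (@face_continuous R 1 i x) (hF.1 _)).
rewrite !(windE (h _)); have [-> -> ->] := face_pt1; lra.
Qed.

End Lifts.

(** * Winding of a line equation along a chain *)

Section Winding.
Variable R : realType.
Local Notation C := R[i].
Local Notation normc := Normc.normc.
Local Notation simplex := (std_simplex R).
Variable A : seq (line R).
Hypothesis A0 : A != [::].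
Variable L0 : line R.
Hypothesis L0A : L0 \in A.

(* The affine equation of [L], the line [L0] being at infinity. *)
Definition aff (L : line R) (p : CP2 R) : C := pairing (coords L) (chart L0 p).

Lemma aff_neq0 L p : L \in A -> complement A p -> aff L p != 0.
Proof. by move=> LA pA; apply: pairing_chart_neq0; exact: pA. Qed.

Lemma aff_cts n (s : simplex n -> CP2 R) L : continuous s -> (forall x, complement A (s x)) ->
  continuous (fun x => aff L (s x)).
Proof.
by move=> sc sA x; exact: (@cts_pairing _ _ (coords L) _ x (cts_chart (sA x L0 L0A) (sc x))).
Qed.

Definition winding (L : line R) (c : chain R (CP2 R) 1) : R :=
  fglift (fun s : sing R (CP2 R) 1 => wind (fun x => aff L (s x)) : zmodule R) c.

Lemma windingU L s : winding L << s >> = wind (fun x => aff L (s x)).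
Proof. by rewrite /winding liftU scale1r. Qed.

Lemma winding_is_zmod_morphism L : zmod_morphism (winding L).
Proof.
pose F : chain R (CP2 R) 1 -> zmodule R :=
  fglift (fun s : sing R (CP2 R) 1 => wind (fun x => aff L (s x)) : zmodule R).
have h : zmod_morphism F by exact: lift_is_additive.
exact: h.
Qed.

Lemma windingB L c d : winding L (c - d) = winding L c - winding L d.
Proof. exact: winding_is_zmod_morphism. Qed.

Lemma winding0 L : winding L 0 = 0.
Proof. by have := windingB L 0 0; rewrite !subrr. Qed.

Lemma windingN L c : winding L (- c) = - winding L c.
Proof. by have := windingB L 0 c; rewrite winding0 !sub0r. Qed.

Lemma windingD L c d : winding L (c + d) = winding L c + winding L d.
Proof. by rewrite -{1}(opprK d) windingB windingN opprK. Qed.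

Lemma boundary_simplex (s : sing R (CP2 R) 2) :
  boundary << s >> = << sing_face 0 s >> - << sing_face 1 s >> + << sing_face ord_max s >>.
Proof.
rewrite /boundary liftU scale1r 2!big_ord_recl big_ord1.
rewrite expr0 scale1r scaleN1r expr2 mulrNN mulr1 scale1r addrA.
have fE (i j : 'I_3) : i = j -> << sing_face i s >> = << sing_face j s >> :> chain R (CP2 R) 1 by move=> ->.
by rewrite (fE (fintype.lift ord0 ord0) 1) ?(fE (fintype.lift ord0 (fintype.lift ord0 ord0)) ord_max)//; apply: val_inj.
Qed.

Lemma winding_boundary L b : L \in A -> chain_in (complement A) b -> winding L (boundary b) = 0.
Proof.
move=> LA bA.
apply: (@freeg_morphism_eq _ _ (fun b => winding L (boundary b)) (fun=> 0)).
- by move=> x y; rewrite boundary_is_zmod_morphism windingB.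
- by move=> x y; rewrite subr0.
move=> s /bA sA; have sA' x : complement A (s x) by apply: sA; exists x.
rewrite boundary_simplex windingD windingB !windingU.
have sc : continuous s by exact: cts_fun.
exact: (@wind_boundary R (fun x => aff L (s x)) (aff_cts sc sA') (fun x => aff_neq0 LA (sA' x))).
Qed.

Lemma winding_bounds L c d : L \in A -> bounds A (c - d) -> winding L c = winding L d.
Proof.
move=> LA [b [bA bE]]; have := winding_boundary LA bA; rewrite bE windingB.
by move/eqP; rewrite subr_eq0 => /eqP.
Qed.

Lemma aff_proj L v : pairing (coords L0) v != 0 ->
  aff L (proj v) = pairing (coords L) v / pairing (coords L0) v.
Proof. by move=> h; rewrite /aff chart_proj// pairingZr mulrC. Qed.

Lemma admissible_cts L g : admissible A g ->
  continuous (fun x : simplex 1 => pairing (coords L) (g (edge_param x))).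
Proof.
move=> [gc _] x.
exact: (@cts_pairing _ _ (coords L) _ x (gc _ _ x (@edge_param01 R) (@edge_param_cts R x))).
Qed.

Lemma winding_path L g : L \in A -> admissible A g ->
  winding L << path g >> = wind (fun x => pairing (coords L) (g (edge_param x))) -
    wind (fun x => pairing (coords L0) (g (edge_param x))).
Proof.
move=> LA ga; have [_ g0] := ga.
rewrite windingU -wind_div; [|exact: admissible_cts|exact: admissible_cts| |].
- by apply: eq_wind => x; rewrite (pathE A0 x ga) aff_proj// g0// edge_param01.
- by move=> x; apply: g0 => //; exact: edge_param01.
- by move=> x; apply: g0 => //; exact: edge_param01.
Qed.

Lemma edge_param_ends : edge_param (pt1 (1 : R)) = 1 /\ edge_param (pt1 (0 : R)) = 0.
Proof. by rewrite !edge_param_pt1 !clampE ?lexx ?ler01. Qed.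

(** Divided by L'(v), the values along the circle stay within distance less than 1 of 1. The
    principal argument is therefore a lift, and it agrees at the two ends of the closed curve. *)
Lemma wind_circ_other L L' v w rho : disc A L v w rho -> L' \in A -> L' != L ->
  wind (fun x : simplex 1 => pairing (coords L') (circ v w rho (edge_param x))) = 0.
Proof.
move=> d L'A LL'; have [Lv Lw r0 h] := d.
have ad := disc_admissible d; have v0 := disc_neq0 d L'A LL'.
have c := @admissible_cts L' _ ad.
have n0 (x : simplex 1) : pairing (coords L') (circ v w rho (edge_param x)) != 0.
  by apply: ad.2 => //; exact: edge_param01.
rewrite -(wind_scale (c := (pairing (coords L') v)^-1)) ?invr_eq0//.
rewrite wind_slit.
- by have [-> ->] := edge_param_ends; rewrite /circ mulr1 mulr0 expi2pi expi0 subrr.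
- by move=> x; exact: (ctsM (c x) (@cts_cst _ _ (pairing (coords L') v)^-1 x)).
move=> x; rewrite /slit; apply/orP; right.
rewrite /circ pairingD pairingZr.
have nu := circ_normc (edge_param x) r0; move: nu; set u := (_ * expi _) => nu.
have := h L' L'A LL'; move: v0; set a := pairing _ v; set b := pairing _ w => a0 hab.
pose k := b / a; have -> : (a + u * b) / a = 1 + u * k by rewrite /k; field.
have : normc (u * k) < 1.
  by rewrite Normc.normcM nu Normc.normcM Normc.normcV mulrA ltr_pdivrMr ?normc_gt0// mul1r mulrC.
have := Re_le_normc (u * k); rewrite ler_norml => /andP[h1 _] h2.
by move: h1 h2; case: (u * k) => a' b' /=; lra.
Qed.

Lemma wind_circ_self L v w rho : disc A L v w rho ->
  wind (fun x : simplex 1 => pairing (coords L) (circ v w rho (edge_param x))) = 2 * pi.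
Proof.
move=> d; have [Lv Lw r0 h] := d.
have hl : is_lift (fun x : simplex 1 => pairing (coords L) (circ v w rho (edge_param x)))
    (fun x => 2 * pi * edge_param x + Arg (pairing (coords L) w)).
  split=> x.
    exact: (ctsRD (ctsRM (@cts_cst _ _ (2 * pi) x) (@edge_param_cts _ x)) (@cts_cst _ _ (Arg (pairing (coords L) w)) x)).
  rewrite expiD expi_Arg// /circ pairingD pairingZr Lv add0r unitcM; congr (_ * _).
  by rewrite /unitc circ_normc// [RHS]mulrC mulKf// -normc_gt0 normc_real normr_gt0 gt_eqF.
by rewrite (windE hl); have [-> ->] := edge_param_ends; lra.
Qed.

(** Along the circle around L only the equation of L turns, so the windings divided by 2 pi are dual
    to the meridians of the lines other than L0. *)
Lemma winding_circ L L' v w rho : disc A L v w rho -> L' \in A -> L != L0 -> L' != L0 ->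
  winding L' << path (circ v w rho) >> = if L' == L then 2 * pi else 0.
Proof.
move=> d L'A LL0 L'L0; rewrite winding_path//; last exact: disc_admissible d.
rewrite (wind_circ_other d L0A) 1?eq_sym// subr0.
by have [->|n] := eqVneq L' L; [exact: wind_circ_self d|exact: wind_circ_other d L'A n].
Qed.

End Winding.
(** * Generation of the first homology by meridians *)

Section Generated.
Variable R : realType.
Local Notation C := R[i].
Local Notation V := 'rV[C]_3.
Local Notation normc := Normc.normc.
Local Notation simplex := (std_simplex R).
Local Notation chain1 := (chain R (CP2 R) 1).
Variable A : seq (line R).
Hypothesis A0 : A != [::].
Variable L0 : line R.
Variable mch : line R -> chain1.
Hypothesis mchP : forall L, L \in A -> L != L0 ->
  exists v w rho, disc A L v w rho /\ mch L = << path (circ v w rho) >>.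
Hypothesis Auniq : uniq A.

Definition meridian_sum (k : line R -> int) : chain1 := \sum_(L <- A | L != L0) mch L *~ k L.

Definition generated (c : chain1) : Prop := exists k, bounds A (c - meridian_sum k).

Lemma generated_bounds c : bounds A c -> generated c.
Proof.
move=> h; exists (fun=> 0); rewrite /meridian_sum big1 ?subr0//.
Qed.

Lemma generatedB c d : generated c -> generated d -> generated (c - d).
Proof.
move=> [k hk] [k' hk']; exists (fun L => k L - k' L).
have -> : meridian_sum (fun L => k L - k' L) = meridian_sum k - meridian_sum k'.
  by rewrite /meridian_sum -sumrB; apply: eq_bigr => L _; rewrite mulrzBr.
have h := boundsB hk hk'; apply: bounds_eq h _.
by move: (meridian_sum k) (meridian_sum k') => x y; freeg_ring.
Qed.

Lemma generated0 : generated 0. Proof. exact: generated_bounds (bounds0 A). Qed.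

Lemma generatedN c : generated c -> generated (- c).
Proof. by move=> h; rewrite -(sub0r c); apply: generatedB => //; exact: generated0. Qed.

Lemma generatedD c d : generated c -> generated d -> generated (c + d).
Proof. by move=> h h'; rewrite -(opprK d); apply: generatedB => //; exact: generatedN. Qed.

Lemma generated_eq c d : generated c -> bounds A (c - d) -> generated d.
Proof.
move=> hc h; have := generatedB hc (generated_bounds h).
by rewrite opprB addrC subrK.
Qed.

Lemma generated_circ L v w rho : L \in A -> L != L0 -> disc A L v w rho ->
  generated << path (circ v w rho) >>.
Proof.
move=> LA LL0 d; have [v' [w' [rho' [d' E]]]] := mchP LA LL0.
exists (fun L' => (L' == L)%:Z); rewrite /meridian_sum big_mkcond (bigD1_seq L)//= LL0 eqxx mulr1z.
rewrite big1 ?addr0 ?E; first exact: circ_unique d d'.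
by move=> L' /negPf ->; rewrite mulr0z if_same.
Qed.

Definition seg (p q : V) (t : R) : V := (1 - t)%:C *: p + t%:C *: q.

Definition visible (p q : V) : Prop := forall t, 0 <= t <= 1 -> avoid A (seg p q t).

Lemma seg0 p q : seg p q 0 = p. Proof. by rewrite /seg subr0 scale1r scale0r addr0. Qed.
Lemma seg1 p q : seg p q 1 = q. Proof. by rewrite /seg subrr scale1r scale0r add0r. Qed.

Lemma segC p q t : seg p q (1 - t) = seg q p t.
Proof. by rewrite /seg subKr addrC. Qed.

Lemma seg_cts p q : cts01 (seg p q).
Proof. exact: (cts01_add (cts01_scale (@ctsC01_1sub R) (@cts01_cst R p)) (cts01_scale (@ctsC01_real R) (@cts01_cst R q))). Qed.

Lemma visible_admissible p q : visible p q -> admissible A (seg p q).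
Proof. by move=> h; split; [exact: seg_cts|exact: h]. Qed.

Lemma visible_sym p q : visible p q -> visible q p.
Proof. by move=> h t t01; rewrite -segC; apply: h; lra. Qed.

Definition edge (p q : V) : chain1 := << path (seg p q) >>.

Lemma edge_split p q t : 0 <= t <= 1 -> visible p q ->
  bounds A (edge p (seg p q t) + edge (seg p q t) q - edge p q).
Proof.
move=> t01 h; have ad := visible_admissible h.
have i0 : 0 <= (0 : R) <= 1 by rewrite lexx ler01.
have i1 : 0 <= (1 : R) <= 1 by rewrite lexx ler01.
apply: (bounds_split_ext A0 i0 t01 i1 ad) => u u01; rewrite /seg.
- rewrite !scalerDr !scalerA addrA -!scalerDl -!rmorphM -!rmorphD /=.
  by congr (_%:C *: _ + _%:C *: _); ring.
- rewrite !scalerDr !scalerA -addrA -!scalerDl -!rmorphM -!rmorphD /=.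
  by congr (_%:C *: _ + _%:C *: _); ring.
- by congr (_%:C *: _ + _%:C *: _); ring.
Qed.

(** Splitting a path at the parameters 0, 1, 0 shows that going out and back is homologous to a
    constant path. *)
Lemma edge_rev p q : visible p q -> bounds A (edge p q + edge q p).
Proof.
move=> pq; have ad := visible_admissible pq.
have i0 : 0 <= (0 : R) <= 1 by rewrite lexx ler01.
have i1 : 0 <= (1 : R) <= 1 by rewrite lexx ler01.
have h : bounds A (edge p q + edge q p - << path (fun=> p) >>).
  apply: (bounds_split_ext A0 i0 i1 i0 ad) => u u01.
  - by congr seg; ring.
  - by rewrite -segC; congr seg; ring.
  - by rewrite subrr mulr0 addr0 seg0.
have h2 : bounds A << path (fun=> p) >>.
  by apply: (bounds_const A0); rewrite -(seg0 p q); exact: (pq 0 i0).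
have := boundsD h h2; rewrite subrK; exact.
Qed.

Definition tri (a b c : V) : chain1 := edge b c - edge a c + edge a b.

Definition in_tri (a b c p : V) : Prop := exists x y z : R,
  [/\ 0 <= x, 0 <= y, 0 <= z, x + y + z = 1 & p = x%:C *: a + y%:C *: b + z%:C *: c].

Lemma ctsC01_bary n (i : 'I_n.+1) (x : simplex n) : {for x, continuous (fun x => (bary i x)%:C)}.
Proof. by apply: ctsC; exact: bary_cts. Qed.

Lemma bary_sum3 (x : simplex 2) : bary 0 x + bary 1 x + bary ord_max x = 1.
Proof.
have := sum_bary x; rewrite 2!big_ord_recl big_ord1.
have -> : fintype.lift ord0 ord0 = 1 :> 'I_3 by apply: val_inj.
have -> : fintype.lift ord0 (fintype.lift ord0 ord0) = ord_max :> 'I_3 by apply: val_inj.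
by rewrite addrA.
Qed.

Lemma tri_bounds a b c : (forall p, in_tri a b c p -> avoid A p) -> bounds A (tri a b c).
Proof.
move=> h.
have v (p q : V) : (forall t, 0 <= t <= 1 -> in_tri a b c (seg p q t)) -> visible p q.
  by move=> H t t01; exact: h (H t t01).
have vbc : visible b c.
  apply: v => t t01; exists 0, (1 - t), t; split; [lra|lra|lra|lra|].
  by rewrite scale0r add0r.
have vac : visible a c.
  apply: v => t t01; exists (1 - t), 0, t; split; [lra|lra|lra|lra|].
  by rewrite scale0r addr0.
have vab : visible a b.
  apply: v => t t01; exists (1 - t), t, 0; split; [lra|lra|lra|lra|].
  by rewrite scale0r addr0.
apply: (@bounds_triangle_map _ A A0 (fun x => (bary 0 x)%:C *: a + (bary 1 x)%:C *: b + (bary ord_max x)%:C *: c)).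
- move=> x.
  exact: (cts_addv (cts_addv (cts_scalev (@ctsC01_bary _ 0 x) (@cts_cst _ _ a x))
    (cts_scalev (@ctsC01_bary _ 1 x) (@cts_cst _ _ b x))) (cts_scalev (@ctsC01_bary _ ord_max x) (@cts_cst _ _ c x))).
- move=> x; apply: h; exists (bary 0 x), (bary 1 x), (bary ord_max x); split=> //; try exact: bary_ge0.
  exact: bary_sum3.
- exact: visible_admissible.
- exact: visible_admissible.
- exact: visible_admissible.
- by move=> x; have [[-> -> ->] _] := face_bary x; rewrite scale0r add0r.
- by move=> x; have [_ [[-> -> ->] _]] := face_bary x; rewrite scale0r addr0.
- by move=> x; have [_ [_ [-> -> ->]]] := face_bary x; rewrite scale0r addr0.
Qed.

Lemma tri_rotate a b c : visible a b -> visible a c -> generated (tri b c a) -> generated (tri a b c).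
Proof.
move=> ab ac h; apply: generated_eq h _.
apply: (bounds_eq (boundsB (edge_rev ac) (edge_rev ab))); rewrite /tri /edge; path_ring.
Qed.

Definition trimap (k : V -> V) (a b c : V) : chain1 :=
  << path (fun t => k (seg b c t)) >> - << path (fun t => k (seg a c t)) >> + << path (fun t => k (seg a b t)) >>.

(* A homotopy of the plane moves the three edges of a triangle simultaneously; the
   traces of the vertices cancel. *)
Lemma tri_homotopy (h : R -> V -> V) a b c :
  (forall p q, cts2 (fun s t => h s (seg p q t))) ->
  (forall p q s t, (p, q) \in [:: (b, c); (a, c); (a, b)] -> 0 <= s <= 1 -> 0 <= t <= 1 -> avoid A (h s (seg p q t))) ->
  bounds A (trimap (h 0) a b c - trimap (h 1) a b c).
Proof.
move=> hc ha.
have H p q : (p, q) \in [:: (b, c); (a, c); (a, b)] ->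
    bounds A (<< path (fun s => h s p) >> + << path (fun t => h 1 (seg p q t)) >>
      - << path (fun t => h 0 (seg p q t)) >> - << path (fun s => h s q) >>).
  move=> pq; apply: (bounds_square_ext A0 (hc p q) (fun s t s01 t01 => ha p q s t pq s01 t01)) => s s01 //.
  - by rewrite seg0.
  - by rewrite seg1.
have h1 := H b c (mem_head _ _).
have h2 : bounds A _ := H a c _; have h3 : bounds A _ := H a b _.
have := boundsN (boundsD (boundsB h1 (h2 _)) (h3 _)); rewrite !inE !eqxx !orbT => /(_ isT isT) h4.
by apply: bounds_eq h4 _; rewrite /trimap; path_ring.
Qed.

End Generated.

(** * Polar coordinates around a point of a line *)

Section TriangleBase.
Variable R : realType.
Local Notation C := R[i].
Local Notation V := 'rV[C]_3.
Local Notation normc := Normc.normc.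
Local Notation simplex := (std_simplex R).
Local Notation chain1 := (chain R (CP2 R) 1).
Variable A : seq (line R).
Hypothesis A0 : A != [::].
Variable L0 : line R.
Variable mch : line R -> chain1.
Hypothesis mchP : forall L, L \in A -> L != L0 ->
  exists v w rho, disc A L v w rho /\ mch L = << path (circ v w rho) >>.
Hypothesis Auniq : uniq A.
Local Notation generated := (generated A L0 mch).
Local Notation ev L v := (pairing (coords L) v).

Section Polar.
Variables (L : line R) (x w : V) (a : C) (sg M : R).
Hypothesis a0 : a != 0.
Hypothesis sg0 : 0 < sg.
Hypothesis Lx : ev L x = 0.
Hypothesis Lw : ev L w = a.
Hypothesis far : forall L', L' \in A -> L' != L ->
  sg * (M * (normc (ev L' w) / normc a)) < normc (ev L' x).

(** Polar coordinates on the complex line through x in the direction w: the value of L at this point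
    is sg * r * expi phi. By [far], other lines are missed as long as r <= M. *)
Definition pol (r phi : R) : V := x + (sg%:C * (r%:C * expi phi / a)) *: w.

Lemma expand_avoid y : ev L y != 0 ->
  (forall L', L' \in A -> L' != L -> sg * normc (ev L' y) < normc (ev L' x)) ->
  avoid A (x + sg%:C *: y).
Proof.
move=> Ly h L' L'A; rewrite pairingD pairingZr.
have sgn : sg%:C != 0 :> C by rewrite eq_complex /= gt_eqF.
have [->|LL'] := eqVneq L' L; first by rewrite Lx add0r mulf_neq0.
rewrite -normc_gt0; apply: lt_le_trans (ler_normcB _ _).
by rewrite subr_gt0 Normc.normcM normc_real gtr0_norm//; exact: h.
Qed.

Lemma pol_avoid r phi : 0 < r -> r <= M -> avoid A (pol r phi).
Proof.
move=> r0 rM; rewrite /pol -scalerA; apply: expand_avoid.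
  rewrite pairingZr Lw divfK//.
  by rewrite -normc_gt0 Normc.normcM normc_expi mulr1 normc_real gtr0_norm.
move=> L' L'A LL'; apply: le_lt_trans (far L'A LL').
rewrite ler_pM2l// pairingZr !Normc.normcM normc_expi Normc.normcV mulr1 normc_real gtr0_norm// -mulrA.
by rewrite [_^-1 * _]mulrC ler_wpM2r// divr_ge0// normc_ge0.
Qed.

Lemma cts_pol (T : topologicalType) (f g : T -> R) y :
  {for y, continuous f} -> {for y, continuous g} -> {for y, continuous (fun t => pol (f t) (g t))}.
Proof.
move=> fy gy; apply: cts_addv; first exact: cts_cst.
apply: cts_scalev; last exact: cts_cst.
apply: ctsM; first exact: cts_cst.
apply: ctsM; last exact: cts_cst.
by apply: ctsM; [exact: ctsC|exact: expi_cts].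
Qed.

Definition polseg (r phi r' phi' t : R) : V := pol ((1 - t) * r + t * r') ((1 - t) * phi + t * phi').

Lemma polseg_admissible r phi r' phi' : 0 < r -> r <= M -> 0 < r' -> r' <= M ->
  admissible A (polseg r phi r' phi').
Proof.
move=> r0 rM r'0 r'M; split.
  move=> T f y f01 fy.
  have f1 : {for y, continuous (fun t => 1 - f t)} := ctsRD (@cts_cst _ _ (1 : R) y) (ctsRN fy).
  apply: (@cts_pol _ (fun t => (1 - f t) * r + f t * r') (fun t => (1 - f t) * phi + f t * phi')).
    exact: (ctsRD (ctsRM f1 (@cts_cst _ _ r y)) (ctsRM fy (@cts_cst _ _ r' y))).
  exact: (ctsRD (ctsRM f1 (@cts_cst _ _ phi y)) (ctsRM fy (@cts_cst _ _ phi' y))).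
by move=> t t01; apply: pol_avoid; nra.
Qed.

(** In the coordinates (r, phi) the complement is described by 0 < r <= M, a convex region, so an
    affine triangle there maps into the complement. The angles are real numbers here, not classes
    modulo 2 pi. *)
Lemma pol_triangle r0 p0 r1 p1 r2 p2 : 0 < r0 -> r0 <= M -> 0 < r1 -> r1 <= M -> 0 < r2 -> r2 <= M ->
  bounds A (<< path (polseg r1 p1 r2 p2) >> - << path (polseg r0 p0 r2 p2) >> + << path (polseg r0 p0 r1 p1) >>).
Proof.
move=> h0 h0' h1 h1' h2 h2'.
pose f (x : simplex 2) := bary 0 x * r0 + (bary 1 x * r1 + bary ord_max x * r2).
pose g (x : simplex 2) := bary 0 x * p0 + (bary 1 x * p1 + bary ord_max x * p2).
have fc y : {for y, continuous f}.
  exact: (ctsRD (ctsRM (@bary_cts _ _ 0 y) (@cts_cst _ _ r0 y)) (ctsRD (ctsRM (@bary_cts _ _ 1 y) (@cts_cst _ _ r1 y)) (ctsRM (@bary_cts _ _ ord_max y) (@cts_cst _ _ r2 y)))).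
have gc y : {for y, continuous g}.
  exact: (ctsRD (ctsRM (@bary_cts _ _ 0 y) (@cts_cst _ _ p0 y)) (ctsRD (ctsRM (@bary_cts _ _ 1 y) (@cts_cst _ _ p1 y)) (ctsRM (@bary_cts _ _ ord_max y) (@cts_cst _ _ p2 y)))).
apply: (@bounds_triangle_map _ A A0 (fun x => pol (f x) (g x))).
- by move=> y; exact: cts_pol.
- move=> y; have := bary_sum3 y; have := bary_ge0 0 y; have := bary_ge0 1 y; have := bary_ge0 ord_max y.
  rewrite /f; move: (bary 0 y) (bary 1 y) (bary ord_max y) => u v z z0 v0 u0 s1.
  pose m := Num.min r0 (Num.min r1 r2).
  have m0 : 0 < m by rewrite !lt_min h0 h1.
  have mr0 : m <= r0 by rewrite ge_min lexx.
  have mr1 : m <= r1 by rewrite !ge_min lexx orbT.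
  have mr2 : m <= r2 by rewrite !ge_min lexx !orbT.
  have -> : u = 1 - v - z by lra.
  have u0' : 0 <= 1 - v - z by lra.
  by clearbody m; apply: pol_avoid; nra.
- exact: polseg_admissible.
- exact: polseg_admissible.
- exact: polseg_admissible.
- by move=> y; have [[e0 e1 e2] _] := face_bary y; rewrite /polseg /f /g e0 e1 e2 !mul0r !add0r.
- by move=> y; have [_ [[e0 e1 e2] _]] := face_bary y; rewrite /polseg /f /g e0 e1 e2 !mul0r !add0r.
- by move=> y; have [_ [_ [e0 e1 e2]]] := face_bary y; rewrite /polseg /f /g e0 e1 e2 !mul0r !addr0.
Qed.

Lemma cpol_avoid z : z != 0 -> normc z <= M -> avoid A (x + (sg%:C * (z / a)) *: w).
Proof.
by move=> z0 zM; have := @pol_avoid (normc z) (Arg z); rewrite /pol -ArgE//; apply; rewrite ?normc_gt0.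
Qed.

Lemma slit_of_segment (k : C) : (forall t : R, 0 <= t <= 1 -> (1 - t)%:C + t%:C * k != 0) -> slit k.
Proof.
move=> h; have k0 : k != 0 by have := h 1; rewrite subrr add0r mul1r lexx ler01; apply.
apply/negPn/negP => /(not_slit k0)/andP[/eqP i0 r0].
have kE : k = (complex.Re k)%:C by apply/eqP; rewrite eq_complex /= i0 !eqxx.
move: r0; set u := complex.Re k in kE * => u0.
have d0 : 0 < 1 - u by lra.
(* The parameter at which the segment from 1 to a negative u passes through 0. *)
have := h (1 - u)^-1; rewrite kE -rmorphM -rmorphD /= (_ : 1 - _ + _ = 0) ?eqxx; last by field; rewrite gt_eqF.
move=> H; suff : false by []; apply: H.
by rewrite invr_ge0 ltW//= invf_le1//; lra.
Qed.

(* Both the segment from [1] to [k] and the arc stay in the open half plane of [k]. *)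
Lemma arc_neq0 (k : C) (r t : R) : slit k -> 0 <= r <= 1 -> 0 <= t <= 1 ->
  (1 - r)%:C * ((1 - t)%:C + t%:C * k) + r%:C * ((1 - t + t * normc k)%:C * expi (t * Arg k)) != 0.
Proof.
move=> sk r01 t01; have k0 := slit_neq0 sk; have n0 : 0 < normc k by rewrite normc_gt0.
have th1 := Arg_ltpi sk; have th0 := Arg_gtNpi k.
have kE := ArgE k0; move: kE n0 th0 th1; set th := Arg k; set n := normc k => kE n0 th0 th1.
have ReE : complex.Re k = n * cos th by rewrite kE /= mul0r subr0.
have ImE : complex.Im k = n * sin th by rewrite kE /= mul0r addr0.
have m0 : 0 < 1 - t + t * n by nra.
set m := 1 - t + t * n in m0 *.
have -> : (1 - r)%:C * ((1 - t)%:C + t%:C * k) + r%:C * (m%:C * expi (t * th)) =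
  ((1 - r) * (1 - t + t * (n * cos th)) + r * (m * cos (t * th))) +i*
  ((1 - r) * (t * (n * sin th)) + r * (m * sin (t * th))).
  rewrite -ReE -ImE /expi; case: (k) => u v; apply/eqP; rewrite eq_complex /=.
  by apply/andP; split; apply/eqP; ring.
rewrite eq_complex /= negb_and; apply/orP.
have [t0|t0] := eqVneq t 0.
  by left; rewrite /m t0 !mul0r cos0 !(subr0, addr0, mulr1) subrK oner_eq0.
have tp : 0 < t by rewrite lt_def t0; case/andP: t01.
have [thp|thn|the] := ltgtP th 0.
- right; have s1 : 0 < sin (- th) by apply: sin_gt0_pi; lra.
  have s2 : 0 < sin (- (t * th)) by apply: sin_gt0_pi; nra.
  rewrite !sinN in s1 s2; rewrite lt_eqF//.
  have p1 : 0 < t * (n * - sin th) by rewrite !mulr_gt0.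
  have p2 : 0 < m * - sin (t * th) by rewrite mulr_gt0.
  move: p1 p2; rewrite !mulrN !oppr_gt0; move: (t * _) (m * _) => X Y X0 Y0.
  by nra.
- right; have s1 : 0 < sin th by apply: sin_gt0_pi; lra.
  have s2 : 0 < sin (t * th) by apply: sin_gt0_pi; nra.
  rewrite gt_eqF//.
  have p1 : 0 < t * (n * sin th) by rewrite !mulr_gt0.
  have p2 : 0 < m * sin (t * th) by rewrite mulr_gt0.
  by move: p1 p2; move: (t * _) (m * _) => X Y X0 Y0; nra.
- left; rewrite the mulr0 cos0 !mulr1 -/m gt_eqF//; nra.
Qed.

(** A segment from P to Q that misses 0 turns by the principal argument of Q / P. The linear
    interpolation [u] between the segment and the polar segment stays away from 0 by [arc_neq0] and
    fixes the ends. *)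
Lemma edge_polar (P Q : C) (phi : R) : P != 0 -> Q != 0 ->
  (forall t : R, 0 <= t <= 1 -> (1 - t)%:C * P + t%:C * Q != 0) -> normc P + normc Q <= M ->
  P = (normc P)%:C * expi phi ->
  bounds A (<< path (fun t => x + (sg%:C * (((1 - t)%:C * P + t%:C * Q) / a)) *: w) >>
    - << path (polseg (normc P) phi (normc Q) (phi + Arg (Q / P))) >>).
Proof.
move=> P0 Q0 PQ PQM PE; set th := Arg (Q / P).
have sk : slit (Q / P).
  apply: slit_of_segment => t t01; have := PQ t t01.
  by rewrite (_ : _ + _ = P * ((1 - t)%:C + t%:C * (Q / P))) ?mulf_eq0 ?(negPf P0)//; field.
have nP : 0 < normc P by rewrite normc_gt0.
have nQ : 0 < normc Q by rewrite normc_gt0.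
have QE : Q = (normc Q)%:C * expi (phi + th).
  have qp0 : Q / P != 0 by rewrite mulf_neq0 ?invr_eq0.
  rewrite -[LHS](divfK P0) (ArgE qp0) -/th {2}PE expiD Normc.normcM Normc.normcV.
  rewrite rmorphM /= fmorphV /=; field.
  by rewrite -normc_gt0 normc_real normr_gt0 gt_eqF.
pose u (r t : R) : C := (1 - r)%:C * ((1 - t)%:C * P + t%:C * Q) +
  r%:C * (((1 - t) * normc P + t * normc Q)%:C * expi ((1 - t) * phi + t * (phi + th))).
have u0 r t : 0 <= r <= 1 -> 0 <= t <= 1 -> u r t != 0.
  move=> r01 t01; have := arc_neq0 sk r01 t01; rewrite -/th => h.
  rewrite (_ : u r t = P * ((1 - r)%:C * ((1 - t)%:C + t%:C * (Q / P)) + r%:C * ((1 - t + t * normc (Q / P))%:C * expi (t * th)))).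
    by rewrite mulf_neq0.
  rewrite mulrDr /u; congr (_ + _); first by field.
  rewrite [RHS]mulrCA; congr (_ * _).
  have -> : (1 - t) * phi + t * (phi + th) = phi + t * th by ring.
  have -> : (1 - t) * normc P + t * normc Q = normc P * (1 - t + t * normc (Q / P)).
    by rewrite Normc.normcM Normc.normcV; field; rewrite gt_eqF.
  by rewrite expiD rmorphM /= [X in _ = X * _]PE; ring.
have uM r t : 0 <= r <= 1 -> 0 <= t <= 1 -> normc (u r t) <= M.
  move=> r01 t01; apply: le_trans PQM; apply: le_trans (ler_normcD _ _) _.
  have b1 : normc ((1 - t)%:C * P + t%:C * Q) <= normc P + normc Q.
    apply: le_trans (ler_normcD _ _) _; rewrite !Normc.normcM !normc_real !ger0_norm; nra.
  have b2 : 0 <= (1 - t) * normc P + t * normc Q <= normc P + normc Q by apply/andP; split; nra.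
  rewrite !(Normc.normcM (_%:C)) !normc_real normc_expi mulr1 !ger0_norm; try lra.
  by have := normc_ge0 ((1 - t)%:C * P + t%:C * Q); nra.
have uc : forall (T : topologicalType) (f g : T -> R) y, {for y, continuous f} -> {for y, continuous g} ->
    {for y, continuous (fun s => u (f s) (g s))}.
  move=> T f g y fy gy.
  have c1 (f' : T -> R) : {for y, continuous f'} -> {for y, continuous (fun s => 1 - f' s)}.
    by move=> f'y; exact: (ctsRD (@cts_cst _ _ (1 : R) y) (ctsRN f'y)).
  apply: ctsD; apply: ctsM.
  - exact: ctsC (c1 _ fy).
  - exact: (ctsD (ctsM (ctsC (c1 _ gy)) (@cts_cst _ _ P y)) (ctsM (ctsC gy) (@cts_cst _ _ Q y))).
  - exact: ctsC fy.
  - apply: ctsM.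
      exact: (ctsC (ctsRD (ctsRM (c1 _ gy) (@cts_cst _ _ (normc P) y)) (ctsRM gy (@cts_cst _ _ (normc Q) y)))).
    exact: (expi_cts (ctsRD (ctsRM (c1 _ gy) (@cts_cst _ _ phi y)) (ctsRM gy (@cts_cst _ _ (phi + th) y)))).
have u_0 r : u r 0 = P.
  by rewrite /u subr0 !mul1r !mul0r !addr0 -PE -mulrDl -rmorphD /= subrK mul1r.
have u_1 r : u r 1 = Q.
  by rewrite /u subrr !mul1r !mul0r !add0r -QE -mulrDl -rmorphD /= subrK mul1r.
pose H r t : V := x + (sg%:C * (u r t / a)) *: w.
have Hc : cts2 H.
  move=> T f g y f01 g01 fy gy.
  exact: (cts_addv (@cts_cst _ _ x y) (cts_scalev (ctsM (@cts_cst _ _ sg%:C y) (ctsM (uc _ _ _ _ fy gy) (@cts_cst _ _ a^-1 y))) (@cts_cst _ _ w y))).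
have Ha r t : 0 <= r <= 1 -> 0 <= t <= 1 -> avoid A (H r t).
  by move=> r01 t01; apply: cpol_avoid; [exact: u0|exact: uM].
have i0 : 0 <= (0 : R) <= 1 by rewrite lexx ler01.
have i1 : 0 <= (1 : R) <= 1 by rewrite lexx ler01.
pose gP : R -> V := fun=> H 0 0; pose gQ : R -> V := fun=> H 0 1.
have cP : bounds A << path gP >> := bounds_const A0 (Ha 0 0 i0 i0).
have cQ : bounds A << path gQ >> := bounds_const A0 (Ha 0 1 i0 i1).
pose gE (t : R) : V := x + (sg%:C * (((1 - t)%:C * P + t%:C * Q) / a)) *: w.
pose gF := polseg (normc P) phi (normc Q) (phi + th).
change (bounds A (<< path gE >> - << path gF >>)).
have hs : bounds A (<< path gP >> + << path gF >> - << path gE >> - << path gQ >>).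
  apply: (@bounds_square_ext _ A A0 H gP gF gE gQ Hc Ha) => s _.
  - by rewrite /gP /H !u_0.
  - by rewrite /gF /H /polseg /pol /u subrr mul0r add0r mul1r.
  - by rewrite /gE /H /u subr0 mul1r mul0r addr0.
  - by rewrite /gQ /H !u_1.
by apply: (bounds_eq (boundsB (boundsB cP cQ) hs)); path_ring.
Qed.

(** The loop is a meridian circle for k = 1, constant for k = 0, and the circle run backwards for k
    = -1; the boundary of a triangle produces no other turning. *)
Lemma polar_loop r phi k : L \in A -> L != L0 -> 0 < r -> r <= M -> (k = -1 \/ k = 0 \/ k = 1) ->
  generated << path (polseg r phi r (phi + 2 * pi * k)) >>.
Proof.
move=> LA LL0 r0 rM kk.
pose w' := (r%:C * expi phi / a) *: w.
have z0 : r%:C * expi phi != 0.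
  by rewrite -normc_gt0 Normc.normcM normc_expi mulr1 normc_real gtr0_norm.
have d : disc A L x w' sg.
  split; [exact: Lx|by rewrite pairingZr Lw divfK|exact: sg0|].
  move=> L' L'A LL'; apply: le_lt_trans (far L'A LL').
  rewrite mulrC ler_pM2l// pairingZr !Normc.normcM normc_expi Normc.normcV mulr1 normc_real gtr0_norm// -mulrA.
  by rewrite [_^-1 * _]mulrC ler_wpM2r// divr_ge0// normc_ge0.
have pE t : polseg r phi r (phi + 2 * pi * k) t = circ x w' sg (k * t).
  rewrite /polseg /circ /pol /w' scalerA; congr (_ + _ *: _).
  have -> : (1 - t) * r + t * r = r by ring.
  have -> : (1 - t) * phi + t * (phi + 2 * pi * k) = phi + 2 * pi * (k * t) by ring.
  by rewrite expiD; ring.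
have gc := generated_circ A0 mchP Auniq LA LL0 d.
case: kk => [k1|[k1|k1]].
- apply: generated_eq (generatedN gc) _.
  pose g0 : R -> V := fun=> circ x w' sg 0.
  have i0 : 0 <= (0 : R) <= 1 by rewrite lexx ler01.
  have i1 : 0 <= (1 : R) <= 1 by rewrite lexx ler01.
  have h1 : bounds A (<< path (circ x w' sg) >> + << path (polseg r phi r (phi + 2 * pi * k)) >> - << path g0 >>).
    apply: (bounds_split_ext A0 i0 i1 i0 (disc_admissible d)) => t t01.
    + by congr circ; ring.
    + rewrite pE k1 /circ; congr (_ + (_ * _) *: _).
      have -> : 2 * pi * (1 + t * (0 - 1)) = 2 * pi * (-1 * t) + 2 * pi by ring.
      by rewrite expiD expi2pi mulr1.
    + by rewrite /g0; congr circ; ring.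
  have h2 : bounds A << path g0 >> := bounds_const A0 ((disc_admissible d).2 0 i0).
  by apply: (bounds_eq (boundsN (boundsD h1 h2))); path_ring.
- apply: generated_bounds.
  have -> : path (polseg r phi r (phi + 2 * pi * k)) = path (fun=> circ x w' sg 0).
    by apply: path_proj_ext => t t01; rewrite pE k1 mul0r.
  apply: (bounds_const A0); apply: (disc_admissible d).2; rewrite lexx ler01//.
- have -> // : path (polseg r phi r (phi + 2 * pi * k)) = path (circ x w' sg).
  by apply: path_proj_ext => t t01; rewrite pE k1 mul1r.
Qed.

End Polar.

End TriangleBase.
Lemma small_int (k : int) : (- 2 < k)%R -> (k < 2)%R -> k = -1 \/ k = 0 \/ k = 1.
Proof. by case: k => [[|[|n]]|[|n]] // _ _; [right; left|right; right|left]. Qed.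

(** * The boundary of a triangle met by a single line *)

Section TriangleBase2.
Variable R : realType.
Local Notation C := R[i].
Local Notation V := 'rV[C]_3.
Local Notation normc := Normc.normc.
Local Notation chain1 := (chain R (CP2 R) 1).
Variable A : seq (line R).
Hypothesis A0 : A != [::].
Variable L0 : line R.
Variable mch : line R -> chain1.
Hypothesis mchP : forall L, L \in A -> L != L0 ->
  exists v w rho, disc A L v w rho /\ mch L = << path (circ v w rho) >>.
Hypothesis Auniq : uniq A.
Local Notation generated := (generated A L0 mch).
Local Notation ev L v := (pairing (coords L) v).

Lemma ev_comb (L : line R) (a b c : V) (x y z : R) :
  ev L (x%:C *: a + y%:C *: b + z%:C *: c) = x%:C * ev L a + y%:C * ev L b + z%:C * ev L c.
Proof. by rewrite !pairingE. Qed.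

Lemma comb_sub (a b c d : V) (x y z : R) : x + y + z = 1 ->
  x%:C *: a + y%:C *: b + z%:C *: c - d = x%:C *: (a - d) + y%:C *: (b - d) + z%:C *: (c - d).
Proof.
move=> s1; have -> : x = 1 - y - z by lra.
by apply/rowP => j; rewrite !mxE !rmorphB rmorph1; ring.
Qed.

Lemma seg_expand (e v : V) (r : R) : v + (1 - r)%:C *: (e - v) = seg e v r.
Proof. by apply/rowP => j; rewrite /seg !mxE !rmorphB rmorph1; ring. Qed.

Lemma polar_quotient (P Q : C) (f : R) : P != 0 -> Q != 0 -> P = (normc P)%:C * expi f ->
  Q = (normc Q)%:C * expi (f + Arg (Q / P)).
Proof.
move=> P0 Q0 PE; have q0 : Q / P != 0 by rewrite mulf_neq0 ?invr_eq0.
have H := ArgE q0; move: H; set th := Arg (Q / P) => H.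
have n0 : (normc P)%:C != 0 :> C by rewrite -normc_gt0 normc_real normr_gt0 normc_eq0.
rewrite -[LHS](divfK P0) {1}H {2}PE expiD Normc.normcM Normc.normcV rmorphM /= fmorphV /=.
by field.
Qed.

Lemma slit_quotient (P Q : C) : P != 0 ->
  (forall t : R, 0 <= t <= 1 -> (1 - t)%:C * P + t%:C * Q != 0) -> slit (Q / P).
Proof.
move=> P0 PQ; apply: slit_of_segment => t t01; have := PQ t t01.
have -> : (1 - t)%:C * P + t%:C * Q = P * ((1 - t)%:C + t%:C * (Q / P)) by field.
by rewrite mulf_eq0 (negPf P0).
Qed.

Lemma onem_itv (s : R) : 0 <= s <= 1 -> 0 <= 1 - s /\ 1 - s <= 1.
Proof. by move=> s01; split; lra. Qed.

Lemma le_sum3 (u v w : R) : 0 < u -> 0 < v -> 0 < w ->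
  [/\ v + w <= u + v + w, u + w <= u + v + w & u + v <= u + v + w] /\
  [/\ u <= u + v + w, v <= u + v + w & w <= u + v + w].
Proof. by move=> u0 v0 w0; split; split; lra. Qed.

Lemma small_multiple (k : int) (t1 t2 t3 : R) : - pi < t1 -> t1 < pi -> - pi < t2 -> t2 < pi ->
  - pi < t3 -> t3 < pi -> t1 + t2 - t3 = 2 * pi * k%:~R ->
  (k%:~R = -1 :> R) \/ (k%:~R = 0 :> R) \/ (k%:~R = 1 :> R).
Proof.
have p0 := @pi_gt0 R; move=> a1 b1 a2 b2 a3 b3 kE.
have l1 : - (3 * pi) < t1 + t2 - t3 by lra.
have l2 : t1 + t2 - t3 < 3 * pi by lra.
rewrite kE in l1 l2.
have k1 : - (2 : R) < k%:~R by nra.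
have k2 : k%:~R < (2 : R) by nra.
have k1' : (- 2 < k)%R by rewrite -(ltr_int R) rmorphN.
have k2' : (k < 2)%R by rewrite -(ltr_int R).
by case: (small_int k1' k2') => [->|[->|->]]; [left|right; left|right; right].
Qed.

Lemma shrink_coeff (s g : R) : 0 <= s <= 1 -> 0 < g -> g <= 1 ->
  0 < 1 - s * (1 - g) /\ 0 <= s * (1 - g) <= 1.
Proof. by move=> s01 g0 g1; split; [nra|apply/andP; split; nra]. Qed.

Lemma normc_comb (x y z : R) (u v w : C) : 0 <= x -> 0 <= y -> 0 <= z -> x + y + z = 1 ->
  normc (x%:C * u + y%:C * v + z%:C * w) <= normc u + normc v + normc w.
Proof.
move=> x0 y0 z0 s1; apply: le_trans (ler_normcD _ _) _; apply: lerD.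
  apply: le_trans (ler_normcD _ _) _; apply: lerD.
    by rewrite Normc.normcM normc_real ger0_norm; [have := normc_ge0 u; nra|lra].
  by rewrite Normc.normcM normc_real ger0_norm; [have := normc_ge0 v; nra|lra].
by rewrite Normc.normcM normc_real ger0_norm; [have := normc_ge0 w; nra|lra].
Qed.

Lemma seg_in_tri (a b c p q : V) t : (p, q) \in [:: (b, c); (a, c); (a, b)] -> 0 <= t <= 1 ->
  in_tri a b c (seg p q t).
Proof.
move=> pq t01; rewrite !inE in pq; case/or3P: pq => /eqP[-> ->].
- by exists 0, (1 - t), t; split; [lra|lra|lra|lra|rewrite scale0r add0r].
- by exists (1 - t), 0, t; split; [lra|lra|lra|lra|rewrite scale0r addr0].
- by exists (1 - t), t, 0; split; [lra|lra|lra|lra|rewrite scale0r addr0].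
Qed.

Lemma in_tri_convex (a b c p q : V) t : in_tri a b c p -> in_tri a b c q -> 0 <= t <= 1 ->
  in_tri a b c (seg p q t).
Proof.
move=> [x [y [z [x0 y0 z0 s1 ->]]]] [x' [y' [z' [x'0 y'0 z'0 s'1 ->]]]] t01.
exists ((1 - t) * x + t * x'), ((1 - t) * y + t * y'), ((1 - t) * z + t * z').
split; [nra|nra|nra|nra|].
rewrite /seg; move: (1 - t) => u; rewrite !rmorphD !rmorphM /= !scalerDl !scalerDr !scalerA.
rewrite [LHS]addrACA; congr (_ + _); exact: addrACA.
Qed.

(** The boundary is shrunk towards the hit x ([h1]) and then flattened onto the complex line x + C w
    while the values of L are kept ([h2]). There the edges become polar segments, and the boundary
    becomes a loop around L. *)
Lemma tri_base L (a b c : V) (al be ga : R) : L \in A -> L != L0 ->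
  visible A a b -> visible A a c -> visible A b c -> 0 < al -> 0 < be -> 0 < ga -> al + be + ga = 1 ->
  ev L (al%:C *: a + be%:C *: b + ga%:C *: c) = 0 ->
  (forall L', L' \in A -> L' != L -> forall p, in_tri a b c p -> ev L' p != 0) ->
  generated (tri a b c).
Proof.
move=> LA LL0 ab ac bc al0 be0 ga0 s1.
set x := (_ + _ + _ : V) => Lx hL'.
have i0 : 0 <= (0 : R) <= 1 by rewrite lexx ler01.
have i1 : 0 <= (1 : R) <= 1 by rewrite lexx ler01.
have xin : in_tri a b c x by exists al, be, ga; split => //; exact: ltW.
have [la la_def] : exists la, la = ev L a by eexists.
have [lb lb_def] : exists lb, lb = ev L b by eexists.
have [lc lc_def] : exists lc, lc = ev L c by eexists.
have la0 : la != 0 by rewrite la_def -(seg0 a b); exact: ab.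
have lb0 : lb != 0 by rewrite lb_def -(seg0 b c); exact: bc.
have lc0 : lc != 0 by rewrite lc_def -(seg1 b c); exact: bc.
have vis p q : (p, q) \in [:: (b, c); (a, c); (a, b)] -> visible A p q.
  by rewrite !inE => /or3P[] /eqP[-> ->].
have [w w_def] : exists w, w = a - x by eexists.
have Lw : ev L w = la by rewrite w_def pairingB Lx subr0.
pose M := normc la + normc lb + normc lc.
have [na nb nc] : [/\ 0 < normc la, 0 < normc lb & 0 < normc lc] by rewrite !normc_gt0.
have [[bcM acM abM] [laM lbM lcM]] := le_sum3 na nb nc.
rewrite -/M in bcM acM abM laM lbM lcM.
have m_bc : (b, c) \in [:: (b, c); (a, c); (a, b)] by rewrite mem_head.
have m_ac : (a, c) \in [:: (b, c); (a, c); (a, b)] by rewrite in_cons mem_head orbT.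
have m_ab : (a, b) \in [:: (b, c); (a, c); (a, b)] by rewrite 2!in_cons mem_head !orbT.
pose K1 L' := M * (normc (ev L' w) / normc la).
pose K2 L' := normc (ev L' (a - x)) + normc (ev L' (b - x)) + normc (ev L' (c - x)).
have K10 L' : 0 <= K1 L' by rewrite mulr_ge0 ?divr_ge0 ?addr_ge0 ?normc_ge0.
have K20 L' : 0 <= K2 L' by rewrite !addr_ge0 ?normc_ge0.
(* [K1] bounds L' on the flattened triangle and [K2] on the original one, both measured from x;
   scaled by sg, their sum is too small to cancel L'(x) at any stage of [h2]. *)
have [sg [sg0 sg1 sgP]] : exists sg, [/\ 0 < sg, sg <= 1 & forall L', L' \in A -> L' != L ->
    sg * (K1 L' + K2 L') < normc (ev L' x)].
  have [|m [m0 mP]] := @seq_minimum R _ A (fun L' r => L' != L -> r * (K1 L' + K2 L') < normc (ev L' x)).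
    move=> L' L'A; have [->|LL'] := eqVneq L' L; first by exists 1; split.
    have n0 : 0 < normc (ev L' x) by rewrite normc_gt0; exact: hL'.
    have k0 : 0 < K1 L' + K2 L' + 1 by have := K10 L'; have := K20 L'; lra.
    exists (normc (ev L' x) / (K1 L' + K2 L' + 1)); split; first by rewrite divr_gt0.
    by move=> r r0; rewrite ler_pdivlMr// => hr _; apply: lt_le_trans hr; rewrite ltr_pM2l// ltrDl.
  exists (Num.min m 1); split; [by rewrite lt_min m0 ltr01|by rewrite ge_min lexx orbT|].
  by move=> L' L'A; apply: mP => //; rewrite ?lt_min ?m0 ?ltr01// ge_min lexx.
have sgC : sg%:C != 0 :> C by rewrite eq_complex /= gt_eqF.
have far L' : L' \in A -> L' != L -> sg * (M * (normc (ev L' w) / normc la)) < normc (ev L' x).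
  move=> L'A LL'; apply: le_lt_trans (sgP L' L'A LL'); rewrite ler_pM2l// -/(K1 L') lerDl//.
have evM e : in_tri a b c e -> normc (ev L e) <= M.
  move=> [u [v [z [u0 v0 z0 uvz ->]]]]; rewrite ev_comb; by rewrite /M la_def lb_def lc_def; exact: normc_comb.
have evK L' e : in_tri a b c e -> normc (ev L' (e - x)) <= K2 L'.
  move=> [u [v [z [u0 v0 z0 uvz ->]]]].
  have -> : u%:C *: a + v%:C *: b + z%:C *: c - x = u%:C *: (a - x) + v%:C *: (b - x) + z%:C *: (c - x).
    exact: comb_sub.
  by rewrite ev_comb; exact: normc_comb.
pose h1 (s : R) (p : V) := x + (1 - s * (1 - sg))%:C *: (p - x).
pose h2 (s : R) (p : V) := x + sg%:C *: (s%:C *: ((ev L p / la) *: w) + (1 - s)%:C *: (p - x)).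
have c1 (T : topologicalType) (f : T -> R) y : {for y, continuous f} -> {for y, continuous (fun s => 1 - f s)}.
  by move=> fy; exact: (ctsRD (@cts_cst _ _ (1 : R) y) (ctsRN fy)).
have sc p q (T : topologicalType) (g : T -> R) y : {for y, continuous g} ->
    {for y, continuous (fun t => seg p q (g t))}.
  by move=> gy; exact: (cts_addv (cts_scalev (ctsC (c1 _ _ _ gy)) (@cts_cst _ _ p y)) (cts_scalev (ctsC gy) (@cts_cst _ _ q y))).
have scx p q (T : topologicalType) (g : T -> R) y : {for y, continuous g} ->
    {for y, continuous (fun t => seg p q (g t) - x)}.
  by move=> gy; exact: (cts_addv (sc p q _ _ _ gy) (@cts_cst _ _ (- x) y)).
have b1 : bounds A (trimap (h1 0) a b c - trimap (h1 1) a b c).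
  apply: (tri_homotopy A0).
    move=> p q T f g y f01 g01 fy gy.
    exact: (cts_addv (@cts_cst _ _ x y) (cts_scalev (ctsC (c1 _ _ _ (ctsRM fy (@cts_cst _ _ (1 - sg) y)))) (scx p q _ _ _ gy))).
  move=> p q s t pq s01 t01 L' L'A; have e_in := seg_in_tri pq t01.
  have [->|LL'] := eqVneq L' L.
    rewrite /h1 pairingD pairingZr pairingB Lx add0r subr0 mulf_neq0//.
      by rewrite eq_complex /= gt_eqF// (shrink_coeff s01 sg0 sg1).1.
    exact: (vis p q pq t t01).
  apply: hL' => //; have r01 := (shrink_coeff s01 sg0 sg1).2.
  rewrite (_ : h1 s (seg p q t) = seg (seg p q t) x (s * (1 - sg))); first exact: in_tri_convex.
  exact: seg_expand.
have b2 : bounds A (trimap (h2 0) a b c - trimap (h2 1) a b c).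
  apply: (tri_homotopy A0).
    move=> p q T f g y f01 g01 fy gy.
    have cw : {for y, continuous (fun t => (ev L (seg p q (g t)) / la) *: w)}.
      exact: (cts_scalev (ctsM (cts_pairing (sc p q _ _ _ gy)) (@cts_cst _ _ la^-1 y)) (@cts_cst _ _ w y)).
    exact: (cts_addv (@cts_cst _ _ x y) (cts_scalev (@cts_cst _ _ sg%:C y) (cts_addv (cts_scalev (ctsC fy) cw) (cts_scalev (ctsC (c1 _ _ _ fy)) (scx p q _ _ _ gy))))).
  move=> p q s t pq s01 t01; have e_in := seg_in_tri pq t01.
  have eL : ev L (seg p q t) != 0 by exact: (vis p q pq t t01).
  have eM := evM _ e_in.
  apply: (expand_avoid sg0 Lx).
    rewrite pairingD !pairingZr Lw pairingB Lx subr0 divfK// -mulrDl -rmorphD /= addrC subrK mul1r//.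
  move=> L' L'A LL'; apply: le_lt_trans (sgP L' L'A LL'); rewrite ler_pM2l//.
  have eK := evK L' _ e_in.
  rewrite pairingD !pairingZr; apply: le_trans (ler_normcD _ _) _; apply: lerD.
    rewrite !Normc.normcM Normc.normcV normc_real ger0_norm; last by case/andP: s01.
    rewrite /K1; apply: le_trans (_ : _ <= normc (ev L (seg p q t)) / normc la * normc (ev L' w)) _.
      by rewrite ler_piMl ?mulr_ge0 ?invr_ge0 ?normc_ge0//; case/andP: s01.
    by rewrite -mulrA [_^-1 * _]mulrC ler_wpM2r// divr_ge0// normc_ge0.
  have [s1' s1''] : 0 <= 1 - s /\ 1 - s <= 1 by exact: onem_itv.
  by rewrite Normc.normcM normc_real ger0_norm//; apply: le_trans eK; rewrite ler_piMl ?normc_ge0.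
have e1 : trimap (h1 0) a b c = tri a b c.
  have -> // : h1 0 = id by apply/funext => p; rewrite /h1 mul0r subr0 scale1r addrC subrK.
have e2 : h1 1 = h2 0.
  by apply/funext => p; rewrite /h1 /h2 mul1r subKr subr0 scale1r scale0r add0r.
have e3 p q t : h2 1 (seg p q t) = x + (sg%:C * (((1 - t)%:C * ev L p + t%:C * ev L q) / la)) *: w.
  by rewrite /h2 subrr scale0r addr0 scale1r scalerA /seg !pairingE.
(* [f2] is the angle of c reached through b, [f3] the angle reached directly from a. They differ by
   k full turns, which is the winding of the loop. *)
pose f0 := Arg la; pose f1 := f0 + Arg (lb / la); pose f2 := f1 + Arg (lc / lb); pose f3 := f0 + Arg (lc / la).
have la_E : la = (normc la)%:C * expi f0 := ArgE la0.
have lb_E : lb = (normc lb)%:C * expi f1 := polar_quotient la0 lb0 la_E.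
have lc_E : lc = (normc lc)%:C * expi f2 := polar_quotient lb0 lc0 lb_E.
have lc_E' : lc = (normc lc)%:C * expi f3 := polar_quotient la0 lc0 la_E.
pose ps := polseg x w la sg.
have E p q P Q f : (p, q) \in [:: (b, c); (a, c); (a, b)] -> ev L p = P -> ev L q = Q -> P != 0 -> Q != 0 ->
    P = (normc P)%:C * expi f -> normc P + normc Q <= M ->
    bounds A (<< path (fun t => h2 1 (seg p q t)) >> - << path (ps (normc P) f (normc Q) (f + Arg (Q / P))) >>).
  move=> pq pP qQ P0 Q0 PE PQM.
  have := edge_polar A0 la0 sg0 Lx Lw far P0 Q0 _ PQM PE; rewrite -/ps.
  have -> : path (fun t => h2 1 (seg p q t)) = path (fun t => x + (sg%:C * (((1 - t)%:C * P + t%:C * Q) / la)) *: w).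
    by apply: path_proj_ext => t _; rewrite e3 pP qQ.
  apply=> t t01; have := vis p q pq t t01 L LA.
  by rewrite /seg !pairingE pP qQ.
have Ebc := E b c lb lc f1 m_bc (esym lb_def) (esym lc_def) lb0 lc0 lb_E bcM.
have Eac := E a c la lc f0 m_ac (esym la_def) (esym lc_def) la0 lc0 la_E acM.
have Eab := E a b la lb f0 m_ab (esym la_def) (esym lb_def) la0 lb0 la_E abM.
have T1 := @pol_triangle _ A A0 L x w la sg M la0 sg0 Lx Lw far (normc la) f0 (normc lb) f1 (normc lc) f2 na laM nb lbM nc lcM.
have T2 := @pol_triangle _ A A0 L x w la sg M la0 sg0 Lx Lw far (normc la) f0 (normc lc) f3 (normc lc) f2 na laM nc lcM nc lcM.
have [k kE] : exists k : int, f2 - f3 = 2 * pi * k%:~R.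
  apply: expi_eq1; rewrite expiD expiN; apply: (canLR (mulfK (expi_neq0 f3))); rewrite mul1r.
  have n0 : (normc lc)%:C != 0 :> C by rewrite eq_complex /= gt_eqF.
  by apply: (mulfI n0); rewrite -lc_E -lc_E'.
have slitQ (p q : V) (P Q : C) : (p, q) \in [:: (b, c); (a, c); (a, b)] -> ev L p = P -> ev L q = Q -> P != 0 -> slit (Q / P).
  move=> pq pP qQ P0; apply: (slit_quotient P0) => t t01; have := vis p q pq t t01 L LA.
  by rewrite /seg !pairingE pP qQ.
(* Three principal arguments of modulus below pi combine to less than 3 pi, which leaves at most one
   turn. *)
have k3 : (k%:~R = -1 :> R) \/ (k%:~R = 0 :> R) \/ (k%:~R = 1 :> R).
  have /Arg_ltpi u1 := slitQ a b la lb m_ab (esym la_def) (esym lb_def) la0.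
  have /Arg_ltpi u2 := slitQ b c lb lc m_bc (esym lb_def) (esym lc_def) lb0.
  have /Arg_ltpi u3 := slitQ a c la lc m_ac (esym la_def) (esym lc_def) la0.
  apply: (small_multiple (Arg_gtNpi _) u1 (Arg_gtNpi _) u2 (Arg_gtNpi _) u3).
  by rewrite -kE /f2 /f3 /f1 addrAC; ring.
have := polar_loop A0 mchP Auniq la0 sg0 Lx Lw far f3 LA LL0 nc lcM k3.
rewrite -kE addrC subrK -/ps => G.
apply: generated_eq G _; rewrite -e1.
have B := boundsB (boundsD (boundsD b1 b2) (boundsD (boundsB Ebc Eac) Eab)) (boundsB T2 T1).
apply: bounds_eq (boundsN B) _; rewrite -/ps -/f1 -/f2 -/f3 e2 /trimap.
path_ring.
Qed.

End TriangleBase2.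

(** * Cutting a triangle in general position *)

Section TriangleSplit.
Variable R : realType.
Local Notation C := R[i].
Local Notation V := 'rV[C]_3.
Local Notation normc := Normc.normc.
Local Notation chain1 := (chain R (CP2 R) 1).
Variable A : seq (line R).
Hypothesis A0 : A != [::].
Variable L0 : line R.
Variable mch : line R -> chain1.
Hypothesis mchP : forall L, L \in A -> L != L0 ->
  exists v w rho, disc A L v w rho /\ mch L = << path (circ v w rho) >>.
Hypothesis Auniq : uniq A.
Local Notation generated := (generated A L0 mch).
Local Notation ev L v := (pairing (coords L) v).

Definition comb (a b c : V) (x y z : R) : V := x%:C *: a + y%:C *: b + z%:C *: c.

Definition hits (L : line R) (a b c : V) : Prop := exists p, in_tri a b c p /\ ev L p = 0.

Definition nhits (a b c : V) : nat := count (fun L => `[< hits L a b c >]) A.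

(** [gp_multi] keeps multiple points of A off the triangle, so that hits of different lines can be
    separated; [gp_infinity] guarantees that a line hitting it is not L0, whose meridian is not
    among the generators. *)
Record general_position (a b c : V) : Prop := GeneralPosition {
  gp_ab : visible A a b;
  gp_ac : visible A a c;
  gp_bc : visible A b c;
  gp_multi : forall L L' p, L \in A -> L' \in A -> L != L' -> in_tri a b c p -> ev L p = 0 -> ev L' p != 0;
  gp_infinity : forall p, in_tri a b c p -> ev L0 p != 0 }.

Lemma count_lt (T : eqType) (P Q : pred T) (s : seq T) x : (forall y, P y -> Q y) ->
  x \in s -> Q x -> ~~ P x -> (count P s < count Q s)%N.
Proof.
move=> PQ xs Qx Px; elim: s xs => [//|y s IH]; rewrite inE => /orP[/eqP <-|xs] /=.
  by rewrite Qx (negPf Px) add0n add1n ltnS; apply: sub_count => z /PQ.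
rewrite -addnS; apply: leq_add; last exact: IH.
by have := PQ y; case: (P y); case: (Q y) => // /(_ isT).
Qed.

Lemma in_tri_rotate (a b c p : V) : in_tri a b c p -> in_tri b c a p.
Proof.
move=> [x [y [z [x0 y0 z0 s1 ->]]]]; exists y, z, x; split=> //; first lra.
by rewrite -addrA addrC.
Qed.

Lemma cross_sum (u v w : C) (x y z : R) : x%:C * u + y%:C * v + z%:C * w = 0 ->
  y * complex.Im (conjc u * v) + z * complex.Im (conjc u * w) = 0 /\
  x * normc u ^+ 2 + y * complex.Re (conjc u * v) + z * complex.Re (conjc u * w) = 0.
Proof.
move=> h; have : conjc u * (x%:C * u + y%:C * v + z%:C * w) = 0 by rewrite h mulr0.
rewrite normc_sqr; case: u {h} => u1 u2; case: v => v1 v2; case: w => w1 w2.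
move=> /eqP; rewrite eq_complex /= => /andP[/eqP h1 /eqP h2]; split.
  by rewrite -[RHS]h2; ring.
by rewrite -[RHS]h1; ring.
Qed.

Lemma visible_cross (u v : C) : (forall t : R, 0 <= t <= 1 -> (1 - t)%:C * u + t%:C * v != 0) ->
  complex.Im (conjc u * v) = 0 -> 0 < complex.Re (conjc u * v).
Proof.
move=> h im0; have u0 : u != 0.
  by have := h 0; rewrite subr0 mul0r addr0 mul1r lexx ler01; apply.
have := slit_quotient u0 h; have n0 : 0 < normc u ^+ 2 by rewrite exprn_gt0// normc_gt0.
have e : conjc u * v = (normc u ^+ 2)%:C * (v / u).
  by rewrite -sqr_normcE; field.
move: im0; rewrite e; case: (v / u) => a b /=; rewrite !mul0r subr0 addr0 /slit /=.
move=> /eqP; rewrite mulf_eq0 gt_eqF//= => /eqP ->; rewrite eqxx /= => a0.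
by rewrite mulr_gt0.
Qed.

(** If v / u and w / u were both real they would be positive, since the edges miss 0, and no convex
    combination of u, v, w could vanish. *)
Lemma hit_cross (u v w : C) (x y z : R) : 0 <= x -> 0 <= y -> 0 <= z -> x + y + z = 1 ->
  (forall t : R, 0 <= t <= 1 -> (1 - t)%:C * u + t%:C * v != 0) ->
  (forall t : R, 0 <= t <= 1 -> (1 - t)%:C * u + t%:C * w != 0) ->
  x%:C * u + y%:C * v + z%:C * w = 0 ->
  (complex.Im (conjc u * v) != 0) || (complex.Im (conjc u * w) != 0).
Proof.
move=> x0 y0 z0 s1 huv huw h; rewrite -negb_and; apply/negP => /andP[/eqP p0 /eqP q0].
have r1 := visible_cross huv p0; have r2 := visible_cross huw q0.
have [_] := cross_sum h; have n0 : 0 < normc u ^+ 2.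
  rewrite exprn_gt0// normc_gt0.
  by have := huv 0; rewrite subr0 mul0r addr0 mul1r lexx ler01; apply.
move: n0 r1 r2; set n := normc u ^+ 2; set r := complex.Re (conjc u * v); set r' := complex.Re (conjc u * w) => n0 r0 r'0 e.
have hx : 0 <= x * n by rewrite mulr_ge0// ltW.
have hy : 0 <= y * r by rewrite mulr_ge0// ltW.
have hz : 0 <= z * r' by rewrite mulr_ge0// ltW.
have z_ (p q : R) : 0 < q -> p * q = 0 -> p = 0.
  by move=> q_0 /eqP; rewrite mulf_eq0 (gt_eqF q_0) orbF => /eqP.
have ex : x * n = 0 by lra.
have ey : y * r = 0 by lra.
have ez : z * r' = 0 by lra.
have := z_ _ _ n0 ex; have := z_ _ _ r0 ey; have := z_ _ _ r'0 ez; lra.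
Qed.

(** A nonzero linear form in two variables has a kernel of dimension one. Hence all hits of a line
    in the triangle have the same ratio y : z and lie on one ray from a. *)
Lemma cross_det (P Q y z y' z' : R) : (P != 0) || (Q != 0) ->
  y * P + z * Q = 0 -> y' * P + z' * Q = 0 -> y * z' = y' * z.
Proof.
move=> /orP[p|q] e1 e2.
  have e1' : y * P = - (z * Q) by lra.
  have e2' : y' * P = - (z' * Q) by lra.
  by apply: (mulIf p); rewrite ![_ * _ * P]mulrAC e1' e2'; ring.
have e1' : z * Q = - (y * P) by lra.
have e2' : z' * Q = - (y' * P) by lra.
by apply: (mulIf q); rewrite -!mulrA e1' e2'; ring.
Qed.

Lemma seg_ev (L : line R) p q t : ev L (seg p q t) = (1 - t)%:C * ev L p + t%:C * ev L q.
Proof. by rewrite /seg !pairingE. Qed.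

Lemma visible_ev L p q : L \in A -> visible A p q -> forall t : R, 0 <= t <= 1 ->
  (1 - t)%:C * ev L p + t%:C * ev L q != 0.
Proof. by move=> LA pq t t01; rewrite -seg_ev; exact: pq. Qed.

Lemma sub_tri_l (a b c p : V) t : 0 <= t <= 1 -> in_tri a b (seg b c t) p ->
  exists x y d, [/\ 0 <= x, 0 <= y, 0 <= d, x + y + d = 1 &
    p = comb a b c x (y + d * (1 - t)) (d * t)].
Proof.
move=> t01 [x [y [d [x0 y0 d0 s1 ->]]]]; exists x, y, d; split=> //.
rewrite /comb /seg -[in LHS]addrA -[in RHS]addrA; congr (_ + _).
by rewrite scalerDr !scalerA addrA -scalerDl -!rmorphM -rmorphD.
Qed.

Lemma sub_tri_r (a b c p : V) t : 0 <= t <= 1 -> in_tri a (seg b c t) c p ->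
  exists x d z, [/\ 0 <= x, 0 <= d, 0 <= z, x + d + z = 1 &
    p = comb a b c x (d * (1 - t)) (d * t + z)].
Proof.
move=> t01 [x [d [z [x0 d0 z0 s1 ->]]]]; exists x, d, z; split=> //.
rewrite /comb /seg -[in LHS]addrA -[in RHS]addrA; congr (_ + _).
by rewrite scalerDr !scalerA -addrA -scalerDl -!rmorphM -rmorphD.
Qed.

Lemma sub_tri_l_in (a b c p : V) t : 0 <= t <= 1 -> in_tri a b (seg b c t) p -> in_tri a b c p.
Proof.
move=> t01 /(sub_tri_l t01)[x [y [d [x0 y0 d0 s1 ->]]]].
by exists x, (y + d * (1 - t)), (d * t); split=> //; nra.
Qed.

Lemma sub_tri_r_in (a b c p : V) t : 0 <= t <= 1 -> in_tri a (seg b c t) c p -> in_tri a b c p.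
Proof.
move=> t01 /(sub_tri_r t01)[x [d [z [x0 d0 z0 s1 ->]]]].
by exists x, (d * (1 - t)), (d * t + z); split=> //; nra.
Qed.

Lemma seg_seg_l (b c : V) t s : seg b (seg b c t) s = seg b c (s * t).
Proof. by apply/rowP => j; rewrite /seg !mxE !rmorphB rmorph1 rmorphM /=; ring. Qed.

Lemma seg_seg_r (b c : V) t s : seg (seg b c t) c s = seg b c (t + s * (1 - t)).
Proof. by apply/rowP => j; rewrite /seg !mxE !rmorphB !rmorphD !rmorphM rmorphB rmorph1 /=; ring. Qed.

Lemma comb_vertex a b c : comb a b c 1 0 0 = a.
Proof. by rewrite /comb scale1r !scale0r !addr0. Qed.

Lemma split_point_l (t y1 z1 x y d : R) : 0 < t -> t < 1 -> 0 <= y -> 0 <= d -> 0 <= y1 -> 0 <= z1 ->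
  t * y1 < z1 * (1 - t) -> y1 * (d * t) = (y + d * (1 - t)) * z1 -> y = 0 /\ d = 0.
Proof.
move=> t0 t1 y0 d0 y10 z10 h e.
have z1p : 0 < z1 by rewrite lt_neqAle z10 andbT; apply: contraTneq h => <-; rewrite mul0r -leNgt mulr_ge0// ltW.
have hd : 0 <= d * (z1 * (1 - t) - t * y1) by rewrite mulr_ge0// subr_ge0 ltW.
have hy : 0 <= y * z1 by rewrite mulr_ge0.
have e2 : y * z1 + d * (z1 * (1 - t) - t * y1) = 0 by lra.
have ey : y * z1 = 0 by lra.
have ed : d * (z1 * (1 - t) - t * y1) = 0 by lra.
split; first by move/eqP: ey; rewrite mulf_eq0 (gt_eqF z1p) orbF => /eqP.
by move/eqP: ed; rewrite mulf_eq0 subr_eq0 (gt_eqF h) orbF => /eqP.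
Qed.

Lemma split_point_r (t y1 z1 d z : R) : 0 < t -> t < 1 -> 0 <= z -> 0 <= d -> 0 <= y1 -> 0 <= z1 ->
  z1 * (1 - t) < t * y1 -> y1 * (d * t + z) = (d * (1 - t)) * z1 -> z = 0 /\ d = 0.
Proof.
move=> t0 t1 y0 d0 y10 z10 h e.
apply: (@split_point_l (1 - t) z1 y1 0 z d); rewrite ?subKr//; lra.
Qed.

(* [d] is chosen on the edge [b c] so that the chord [a d] avoids [A] and separates the
   points where [L1] and [L2] hit the triangle. *)
Lemma tri_split n a b c L1 L2 (x1 y1 z1 x2 y2 z2 : R) :
  (forall a b c, (nhits a b c < n)%N -> general_position a b c -> generated (tri a b c)) ->
  general_position a b c -> (nhits a b c <= n)%N -> L1 \in A -> L2 \in A ->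
  [/\ 0 <= x1, 0 <= y1, 0 <= z1, x1 + y1 + z1 = 1 & ev L1 (comb a b c x1 y1 z1) = 0] ->
  [/\ 0 <= x2, 0 <= y2, 0 <= z2, x2 + y2 + z2 = 1 & ev L2 (comb a b c x2 y2 z2) = 0] ->
  z1 * y2 < z2 * y1 -> generated (tri a b c).
Proof.
move=> IH gp nle L1A L2A [x10 y10 z10 s1 h1] [x20 y20 z20 s2 h2] lt12.
have [ab ac bc multi inf] := gp.
have ev_a L : L \in A -> ev L a != 0 by move=> LA; rewrite -(seg0 a b); apply: (ab 0); rewrite ?lexx ?ler01.
pose P L := complex.Im (conjc (ev L a) * ev L b).
pose Q L := complex.Im (conjc (ev L a) * ev L c).
have crossP L x y z : L \in A -> ev L (comb a b c x y z) = 0 -> y * P L + z * Q L = 0.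
  by move=> LA; rewrite ev_comb => /cross_sum[].
have PQ L : L \in A -> hits L a b c -> (P L != 0) || (Q L != 0).
  move=> LA [p [[x [y [z [x0 y0 z0 s ->]]]] e]]; rewrite ev_comb in e.
  exact: hit_cross x0 y0 z0 s (visible_ev LA ab) (visible_ev LA ac) e.
have hit1 : hits L1 a b c by exists (comb a b c x1 y1 z1); split=> //; exists x1, y1, z1.
have hit2 : hits L2 a b c by exists (comb a b c x2 y2 z2); split=> //; exists x2, y2, z2.
have sum0 L x y z : L \in A -> 0 <= y -> 0 <= z -> x + y + z = 1 -> ev L (comb a b c x y z) = 0 -> 0 < y + z.
  move=> LA y0 z0 s e; rewrite lt_neqAle addr_ge0// andbT eq_sym; apply/eqP => yz.
  have y0' : y = 0 by lra.
  have z0' : z = 0 by lra.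
  have x1' : x = 1 by lra.
  by have := ev_a L LA; rewrite -{1}(comb_vertex a b c) -x1' -{1}y0' -z0' e eqxx.
have d1 := sum0 L1 _ _ _ L1A y10 z10 s1 h1; have d2 := sum0 L2 _ _ _ L2A y20 z20 s2 h2.
(* The rays from a through the two hits reach the edge b c at these parameters. *)
pose t1 := z1 / (y1 + z1); pose t2 := z2 / (y2 + z2).
have t10 : 0 <= t1 by rewrite divr_ge0// addr_ge0.
have t21 : t2 <= 1 by rewrite ler_pdivrMr// mul1r lerDr.
have t12 : t1 < t2.
  by rewrite /t1 /t2 ltr_pdivrMr// mulrAC ltr_pdivlMr//; nra.
(* Its value at u is the cross product that must not vanish for the chord to the parameter t1 + u to
   miss L; lines that do not hit the triangle impose no condition. *)
pose pL L : {poly R} := if `[< hits L a b c >] then ((1 - t1) * P L + t1 * Q L)%:P + (Q L - P L) *: 'X else 1.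
have [|u [u0 ut uP]] := @generic_nonroot R [seq pL L | L <- A] (t2 - t1) ltac:(by rewrite subr_gt0).
  move=> p /mapP[L LA ->]; rewrite /pL; case: asboolP => [hL|_]; last exact: oner_neq0.
  apply: contraT => /negPn/eqP/polyP e; have := e 0%N; have := e 1%N.
  rewrite !coefD !coefZ !coefC !coefX /= !mulr1 !mulr0 !addr0 add0r => qp pq.
  have {}qp : Q L = P L by apply/eqP; rewrite -subr_eq0 qp.
  have p0 : P L = 0 by rewrite -pq qp; ring.
  by have := PQ L LA hL; rewrite qp p0 eqxx.
pose t := t1 + u.
have tt1 : t1 < t by rewrite /t ltrDl.
have tt2 : t < t2 by rewrite /t; lra.
have t0 : 0 < t by apply: le_lt_trans tt1.
have tlt1 : t < 1 by apply: lt_le_trans t21.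
have t01 : 0 <= t <= 1 by rewrite !ltW.
have tL L : L \in A -> hits L a b c -> (1 - t) * P L + t * Q L != 0.
  move=> LA hL; have := uP _ (map_f pL LA); rewrite /pL asboolT// !hornerE.
  by congr (_ != _); rewrite /t; ring.
pose d := seg b c t.
have ad : visible A a d.
  move=> s s01 L LA; have e_in : in_tri a b c (seg a d s).
    exists (1 - s), (s * (1 - t)), (s * t); split; [nra|nra|nra|ring|].
    by rewrite /d /seg scalerDr !scalerA addrA -!rmorphM.
  have [hL|hL] := asboolP (hits L a b c); last first.
    by apply/eqP => e; apply: hL; exists (seg a d s).
  apply/eqP => e; have : s * ((1 - t) * P L + t * Q L) = 0.
    have := @crossP L (1 - s) (s * (1 - t)) (s * t) LA.
    rewrite (_ : comb _ _ _ _ _ _ = seg a d s); last by rewrite /comb /d /seg scalerDr !scalerA addrA -!rmorphM.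
    by move=> /(_ e) <-; ring.
  move/eqP; rewrite mulf_eq0 (negPf (tL L LA hL)) orbF => /eqP s0.
  by move: e; rewrite s0 seg0 => /eqP; rewrite (negPf (ev_a L LA)).
have bd : visible A b d by move=> s s01; rewrite /d seg_seg_l; apply: bc; nra.
have dc : visible A d c by move=> s s01; rewrite /d seg_seg_r; apply: bc; nra.
have gp1 : general_position a b d.
  split=> //; first by move=> L L' p LA L'A LL' /(sub_tri_l_in t01) pin; exact: multi.
  by move=> p /(sub_tri_l_in t01) pin; exact: inf.
have gp2 : general_position a d c.
  split=> //; first by move=> L L' p LA L'A LL' /(sub_tri_r_in t01) pin; exact: multi.
  by move=> p /(sub_tri_r_in t01) pin; exact: inf.
(* A hit of L2 in a b d would lie on the ray that reaches b c beyond d, so it could only be the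
   vertex a. L1 and the triangle a d c are treated symmetrically. *)
have nh1 : (nhits a b d < n)%N.
  apply: leq_trans nle; apply: (@count_lt _ _ _ _ L2) => //; last apply/asboolPn.
  - by move=> L /asboolP[p [/(sub_tri_l_in t01) pin e]]; apply/asboolP; exists p.
  - exact/asboolP.
  - move=> [p [/(sub_tri_l t01)[x [y [dd [x0 y0 dd0 s ->]]]] e]].
    have e1 := crossP _ _ _ _ L2A e; have e2 := crossP _ _ _ _ L2A h2.
    have det := cross_det (PQ L2 L2A hit2) e2 e1.
    have lt : t * y2 < z2 * (1 - t) by move: tt2; rewrite /t2 ltr_pdivlMr//; nra.
    have [yy dd'] := split_point_l x t0 tlt1 y0 dd0 y20 z20 lt det.
    have x1' : x = 1 by lra.
    by move: e; rewrite yy dd' !mul0r addr0 x1' comb_vertex => /eqP; rewrite (negPf (ev_a _ L2A)).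
have nh2 : (nhits a d c < n)%N.
  apply: leq_trans nle; apply: (@count_lt _ _ _ _ L1) => //; last apply/asboolPn.
  - by move=> L /asboolP[p [/(sub_tri_r_in t01) pin e]]; apply/asboolP; exists p.
  - exact/asboolP.
  - move=> [p [/(sub_tri_r t01)[x [dd [z [x0 dd0 z0 s ->]]]] e]].
    have e1 := crossP _ _ _ _ L1A e; have e2 := crossP _ _ _ _ L1A h1.
    have det := cross_det (PQ L1 L1A hit1) e2 e1.
    have lt : z1 * (1 - t) < t * y1 by move: tt1; rewrite /t1 ltr_pdivrMr//; nra.
    have [zz dd'] := split_point_r t0 tlt1 z0 dd0 y10 z10 lt det.
    have x1' : x = 1 by lra.
    by move: e; rewrite zz dd' !mul0r addr0 x1' comb_vertex => /eqP; rewrite (negPf (ev_a _ L1A)).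
have g1 := IH _ _ _ nh1 gp1; have g2 := IH _ _ _ nh2 gp2.
apply: generated_eq (generatedD g1 g2) _.
by apply: (bounds_eq (edge_split A0 t01 bc)); rewrite /tri /edge -/d; path_ring.
Qed.

Lemma general_position_rotate a b c : general_position a b c -> general_position b c a.
Proof.
move=> [ab ac bc multi inf]; split=> //.
- exact: visible_sym.
- exact: visible_sym.
- move=> L L' p LA L'A LL' pin; apply: multi => //.
  exact: in_tri_rotate (in_tri_rotate pin).
- by move=> p pin; apply: inf; exact: in_tri_rotate (in_tri_rotate pin).
Qed.

Lemma nhits_rotate a b c : nhits b c a = nhits a b c.
Proof.
apply: eq_count => L; apply/asboolP/asboolP => -[p [pin e]]; exists p; split=> //.
  exact: in_tri_rotate (in_tri_rotate pin).
exact: in_tri_rotate.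
Qed.

Lemma hit_positive L a b c (x y z : R) : L \in A -> visible A a b -> visible A a c -> visible A b c ->
  0 <= x -> 0 <= y -> 0 <= z -> x + y + z = 1 -> ev L (comb a b c x y z) = 0 ->
  [/\ 0 < x, 0 < y & 0 < z].
Proof.
move=> LA ab ac bc x0 y0 z0 s e; have [h1 h2 h3] : [/\ x <> 0, y <> 0 & z <> 0].
  split=> w0; move: e; rewrite /comb w0 scale0r ?add0r ?addr0.
  - have -> : y%:C *: b + z%:C *: c = seg b c z by rewrite /seg (_ : 1 - z = y)//; lra.
    by move/eqP; apply/negP; apply: bc => //; lra.
  - have -> : x%:C *: a + z%:C *: c = seg a c z by rewrite /seg (_ : 1 - z = x)//; lra.
    by move/eqP; apply/negP; apply: ac => //; lra.
  - have -> : x%:C *: a + y%:C *: b = seg a b y by rewrite /seg (_ : 1 - y = x)//; lra.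
    by move/eqP; apply/negP; apply: ab => //; lra.
by split; rewrite lt_neqAle eq_sym; apply/andP; split=> //; apply/eqP.
Qed.

Lemma equal_ratios (x1 y1 z1 x2 y2 z2 : R) : 0 < x1 -> 0 < z1 -> 0 < z2 ->
  x1 + y1 + z1 = 1 -> x2 + y2 + z2 = 1 -> z1 * y2 = z2 * y1 -> z1 * x2 = z2 * x1 ->
  [/\ x1 = x2, y1 = y2 & z1 = z2].
Proof.
move=> x10 z10 z20 s1 s2 e1 e2.
have e3 : z1 * (x2 + y2 + z2) = z2 * (x1 + y1 + z1) by lra.
have z12 : z1 = z2 by rewrite s1 s2 !mulr1 in e3.
by split=> //; apply: (mulfI (lt0r_neq0 z20)); rewrite -?e1 -?e2 z12.
Qed.

(** Induction on the number of lines that hit. By [gp_multi] the hits of two lines are distinct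
    points, so they lie on different rays from a or on different rays from b, and [tri_split]
    applies after at most one rotation. *)
Lemma tri_general_position a b c : general_position a b c -> generated (tri a b c).
Proof.
have [n] := ubnP (nhits a b c); elim: n a b c => // n IH a b c.
rewrite ltnS => nle gp; have [ab ac bc multi inf] := gp.
have [[L1 [L1A hit1]]|no] := pselect (exists L, L \in A /\ hits L a b c); last first.
  apply: generated_bounds; apply: (tri_bounds A0) => p pin L LA; apply/eqP => e.
  by apply: no; exists L; split=> //; exists p.
have [p1 [p1in e1]] := hit1.
have L1L0 : L1 != L0.
  by apply/eqP => E; have := inf p1 p1in; rewrite -E e1 eqxx.
have [x1 [y1 [z1 [x10 y10 z10 s1 p1E]]]] := p1in.
rewrite p1E -/(comb a b c x1 y1 z1) in e1.
have [x1p y1p z1p] := hit_positive L1A ab ac bc x10 y10 z10 s1 e1.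
have [[L2 [L2A L12 hit2]]|no2] := pselect (exists L, [/\ L \in A, L != L1 & hits L a b c]); last first.
  apply: (tri_base A0 mchP Auniq L1A L1L0 ab ac bc x1p y1p z1p s1 e1).
  move=> L' L'A L'1 p pin; apply/eqP => e; apply: no2; exists L'; split=> //.
  by exists p.
have [p2 [p2in e2]] := hit2.
have [x2 [y2 [z2 [x20 y20 z20 s2 p2E]]]] := p2in.
rewrite p2E -/(comb a b c x2 y2 z2) in e2.
have [x2p y2p z2p] := hit_positive L2A ab ac bc x20 y20 z20 s2 e2.
have IH' a' b' c' : (nhits a' b' c' < n)%N -> general_position a' b' c' -> generated (tri a' b' c').
  exact: IH.
have h1 : [/\ 0 <= x1, 0 <= y1, 0 <= z1, x1 + y1 + z1 = 1 & ev L1 (comb a b c x1 y1 z1) = 0] by split; assumption.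
have h2 : [/\ 0 <= x2, 0 <= y2, 0 <= z2, x2 + y2 + z2 = 1 & ev L2 (comb a b c x2 y2 z2) = 0] by split; assumption.
have combR x y z : comb b c a y z x = comb a b c x y z by rewrite /comb addrC addrA.
have [lt|gt|eq1] := ltgtP (z1 * y2) (z2 * y1).
- exact: tri_split IH' gp nle L1A L2A h1 h2 lt.
- exact: tri_split IH' gp nle L2A L1A h2 h1 gt.
apply: tri_rotate => //.
have gp' := general_position_rotate gp.
have nle' : (nhits b c a <= n)%N by rewrite nhits_rotate.
have h1' : [/\ 0 <= y1, 0 <= z1, 0 <= x1, y1 + z1 + x1 = 1 & ev L1 (comb b c a y1 z1 x1) = 0].
  by split=> //; [rewrite -s1; ring|rewrite combR].
have h2' : [/\ 0 <= y2, 0 <= z2, 0 <= x2, y2 + z2 + x2 = 1 & ev L2 (comb b c a y2 z2 x2) = 0].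
  by split=> //; [rewrite -s2; ring|rewrite combR].
have [lt|gt|eq2] := ltgtP (x1 * z2) (x2 * z1).
- exact: tri_split IH' gp' nle' L1A L2A h1' h2' lt.
- exact: tri_split IH' gp' nle' L2A L1A h2' h1' gt.
have [ex ey ez] : [/\ x1 = x2, y1 = y2 & z1 = z2].
  by apply: equal_ratios => //; rewrite [RHS]mulrC eq2 mulrC.
have L12' : L1 != L2 by rewrite eq_sym.
have := multi L1 L2 p1 L1A L2A L12' p1in; rewrite p1E -/(comb a b c x1 y1 z1) => /(_ e1).
by rewrite ex ey ez e2 eqxx.
Qed.

End TriangleSplit.

(** * Linear algebra of projective lines *)

Section LineAlgebra.
Variable R : realType.
Local Notation C := R[i].
Local Notation V := 'rV[C]_3.
Local Notation ev L v := (pairing (coords L) v).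

Lemma line_eq (L L' : line R) (c : C) : coords L = c *: coords L' -> L = L'.
Proof.
move=> e; have c0 : c != 0.
  by apply/eqP => c0; have := coords_neq0 L; rewrite e c0 scale0r eqxx.
by rewrite -(proj_coords L) e projZ ?coords_neq0// proj_coords.
Qed.

Lemma pairing_mx (a v : V) : pairing a v = (v *m a^T) 0 0.
Proof. by rewrite mxE /pairing; apply: eq_bigr => i _; rewrite mxE mulrC. Qed.

Lemma two_lines_rank (L L' : line R) : L != L' -> \rank (col_mx (coords L) (coords L')) = 2%N.
Proof.
move=> LL'; apply/eqP; rewrite eqn_leq rank_leq_row/= ltnNge; apply/negP => r1.
have s2 : (coords L' <= col_mx (coords L) (coords L'))%MS by rewrite -addsmxE addsmxSr.
have s1 : (coords L <= col_mx (coords L) (coords L'))%MS by rewrite -addsmxE addsmxSl.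
have rL' : \rank (coords L') = 1%N by rewrite rank_rV coords_neq0.
have : (col_mx (coords L) (coords L') <= coords L')%MS.
  by rewrite -(geq_leqif (mxrank_leqif_sup s2)) rL'.
move=> /(submx_trans s1) /sub_rVP[c e].
by have := line_eq e; apply/eqP.
Qed.

Lemma meet_unique (L L' : line R) (x y : V) : L != L' -> ev L x = 0 -> ev L' x = 0 ->
  ev L y = 0 -> ev L' y = 0 -> y != 0 -> exists c, x = c *: y.
Proof.
move=> LL' Lx L'x Ly L'y y0; have r2 := two_lines_rank LL'.
set M := col_mx _ _ in r2; pose K := kermx M^T.
have rK : \rank K = 1%N by rewrite mxrank_ker mxrank_tr r2.
have inK v : ev L v = 0 -> ev L' v = 0 -> (v <= K)%MS.
  move=> Lv L'v; apply/sub_kermxP; rewrite /M tr_col_mx mul_mx_row.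
  apply/rowP => j; rewrite !mxE; case: splitP => k _; rewrite ord1 -pairing_mx ?Lv ?L'v//.
have : (K <= y)%MS by rewrite -(geq_leqif (mxrank_leqif_sup (inK y Ly L'y))) rK rank_rV y0.
move=> /(submx_trans (inK x Lx L'x)) /sub_rVP[c ->]; by exists c.
Qed.

(** The vector L'(v) w - L'(w) v lies on L and on L', hence is a multiple of their common point x,
    hence lies on L''. So L' and L'' are proportional on L. *)
Lemma third_line (L L' L'' : line R) (x v w : V) : L != L' -> x != 0 -> ev L x = 0 -> ev L' x = 0 -> ev L'' x = 0 ->
  ev L v = 0 -> ev L w = 0 -> ev L' v * ev L'' w = ev L' w * ev L'' v.
Proof.
move=> LL' x0 Lx L'x L''x Lv Lw.
pose u := ev L' v *: w - ev L' w *: v.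
have Lu : ev L u = 0 by rewrite /u pairingB !pairingZr Lv Lw !mulr0 subrr.
have L'u : ev L' u = 0 by rewrite /u pairingB !pairingZr mulrC subrr.
have [c uE] := meet_unique LL' Lu L'u Lx L'x x0.
have : ev L'' u = 0 by rewrite uE pairingZr L''x mulr0.
by rewrite /u pairingB !pairingZr => /eqP; rewrite subr_eq0 => /eqP.
Qed.

(** With a nonzero coefficient at index k, the other two coordinate vectors are corrected along the
    k-th one; [k + 1] and [k + 2] are taken cyclically in ['I_3]. *)
Lemma kernel_basis (L0 : line R) : exists q e f : V,
  [/\ ev L0 q = 1, ev L0 e = 0, ev L0 f = 0,
   (forall c d : C, c *: e + d *: f = 0 -> c = 0 /\ d = 0) &
   (forall L, ev L e = 0 -> ev L f = 0 -> L = L0)].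
Proof.
have [k lk] : exists k, coords L0 0 k != 0 by apply/rV0Pn; exact: coords_neq0.
set l := coords L0 in lk *.
pose del (i : 'I_3) : V := delta_mx 0 i.
have evd (a : V) i : pairing a (del i) = a 0 i.
  rewrite /pairing (bigD1 i)//= big1 ?addr0; first by rewrite !mxE !eqxx mulr1.
  by move=> j ji; rewrite !mxE (negPf ji) andbF mulr0.
pose vec i : V := del i - (l 0 i / l 0 k) *: del k.
have evv (a : V) i : pairing a (vec i) = a 0 i - l 0 i / l 0 k * a 0 k.
  by rewrite pairingB pairingZr !evd.
have [n1 n2 n3] : [/\ k + 1 != k, k + 2 != k & k + 1 != k + 2] by case: k {lk vec evv} => -[|[|[|]]].
exists ((l 0 k)^-1 *: del k), (vec (k + 1)), (vec (k + 2)); split.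
- by rewrite pairingZr evd mulVf.
- by rewrite evv divfK// subrr.
- by rewrite evv divfK// subrr.
- have vE i j : vec i 0 j = (j == i)%:R - l 0 i / l 0 k * (j == k)%:R.
    by rewrite /vec /del !mxE !eqxx.
  move=> c d /rowP h; have := h (k + 1); have := h (k + 2).
  have cE i : (c *: vec (k + 1) + d *: vec (k + 2)) 0 i = c * vec (k + 1) 0 i + d * vec (k + 2) 0 i.
    by rewrite [LHS]mxE [X in X + _]mxE [X in _ + X]mxE.
  rewrite !cE !vE.
  have n3' : k + 2 != k + 1 by rewrite eq_sym.
  rewrite !eqxx (negPf n1) (negPf n2) (negPf n3) (negPf n3') !mulr0 !subr0 !mulr0 !mulr1 !mxE.
  by rewrite add0r addr0.
move=> L; rewrite !evv => h1 h2; apply: (@line_eq _ _ (coords L 0 k / l 0 k)).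
have tri i : i = k \/ i = k + 1 \/ i = k + 2.
  by case: k i {lk vec evv n1 n2 n3 h1 h2} => -[|[|[|]]] // p [[|[|[|]]]] // q; 
    solve [left; exact: val_inj|right; left; exact: val_inj|right; right; exact: val_inj].
apply/rowP => i; rewrite mxE -/l; have [->|[->|->]] := tri i.
- by rewrite divfK.
- by move/eqP: h1; rewrite subr_eq0 => /eqP ->; rewrite -mulrA [RHS]mulrC; congr (_ * _); rewrite mulrC.
- by move/eqP: h2; rewrite subr_eq0 => /eqP ->; rewrite -mulrA [RHS]mulrC; congr (_ * _); rewrite mulrC.
Qed.

End LineAlgebra.

(** * Moving a triangle into general position *)

Section Translation.
Variable R : realType.
Local Notation C := R[i].
Local Notation V := 'rV[C]_3.
Local Notation normc := Normc.normc.
Local Notation chain1 := (chain R (CP2 R) 1).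
Variable A : seq (line R).
Hypothesis A0 : A != [::].
Variable L0 : line R.
Variable mch : line R -> chain1.
Hypothesis mchP : forall L, L \in A -> L != L0 ->
  exists v w rho, disc A L v w rho /\ mch L = << path (circ v w rho) >>.
Hypothesis Auniq : uniq A.
Local Notation generated := (generated A L0 mch).
Local Notation ev L v := (pairing (coords L) v).

Lemma real_imag_span (u : V) (r : R) : u != 0 -> ('i%C - r%:C) *: u != 0.
Proof.
move=> u0; rewrite scaler_eq0 negb_or u0 andbT eq_complex /= negb_and; apply/orP; right.
by rewrite subr0 oner_eq0.
Qed.

(** The kernel of L0 has real dimension four, and u, v span at most two. If u and v lie on one
    complex line, a vector off it works; otherwise i u does, because i u = r u + s v would put both
    on one complex line. *)
Lemma transverse_direction (u v : V) : ev L0 u = 0 -> ev L0 v = 0 ->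
  exists d, ev L0 d = 0 /\ forall r s : R, d != r%:C *: u + s%:C *: v.
Proof.
move=> Lu Lv; have [q [e [f [_ Le Lf ef _]]]] := kernel_basis L0.
have [e0 f0] : e != 0 /\ f != 0.
  split; apply/eqP => z.
    have [h _] := ef 1 0 ltac:(by rewrite z scaler0 scale0r addr0).
    by move/eqP: h; rewrite oner_eq0.
  have [_ h] := ef 0 1 ltac:(by rewrite z scaler0 scale0r addr0).
  by move/eqP: h; rewrite oner_eq0.
(* a line over the complex numbers misses [e] or [f] *)
have out (g : V) : exists d, ev L0 d = 0 /\ forall c : C, d != c *: g.
  have [[c eg]|ne] := pselect (exists c, e = c *: g); last first.
    by exists e; split=> // c; apply/eqP => eg; apply: ne; exists c.
  have [[c' fg]|nf] := pselect (exists c, f = c *: g); last first.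
    by exists f; split=> // c0; apply/eqP => fg; apply: nf; exists c0.
  have [h _] := ef c' (- c) ltac:(by rewrite eg fg !scalerA mulNr mulrC scaleNr subrr).
  by move: f0; rewrite fg h scale0r eqxx.
have [[g [a [b [-> ->]]]]|indep] := pselect (exists g (a b : C), u = a *: g /\ v = b *: g).
  have [d [Ld dg]] := out g; exists d; split=> // r s.
  by rewrite !scalerA -scalerDl; exact: dg.
exists ('i%C *: u); split; first by rewrite pairingZr Lu mulr0.
move=> r s; apply/eqP => E.
have u0 : u != 0 by apply/eqP => u0; apply: indep; exists v, 0, 1; rewrite scale0r scale1r.
have E2 : ('i%C - r%:C) *: u = s%:C *: v by rewrite scalerBl E addrAC subrr add0r.
have [s0|s0] := eqVneq s 0.
  by have := real_imag_span r u0; rewrite E2 s0 scale0r eqxx.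
apply: indep; exists u, 1, (s%:C^-1 * ('i%C - r%:C)); rewrite scale1r; split=> //.
by rewrite -scalerA E2 scalerA mulVf ?scale1r// eq_complex /= negb_and s0.
Qed.

(** On the compact edge each |L| has a positive minimum, which bounds the admissible
    displacement. *)
Lemma edge_margin p q d : visible A p q -> exists e, 0 < e /\
  forall s, 0 <= s -> s <= e -> forall t, 0 <= t <= 1 -> avoid A (seg p q t + s%:C *: d).
Proof.
move=> pq.
have [|m [m0 mP]] := @seq_minimum R _ A (fun L r => forall t, 0 <= t <= 1 ->
    r * normc (ev L d) < normc (ev L (seg p q t))).
  move=> L LA.
  have [k [k0 kP]] := normc_minimum (@cts01_pairing _ _ (coords L) (@seg_cts R p q)) (fun t t01 => pq t t01 L LA).
  have n0 : 0 < normc (ev L d) + 1 by rewrite ltr_wpDl// normc_ge0.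
  exists (k / (normc (ev L d) + 1)); split; first by rewrite divr_gt0.
  move=> r r0; rewrite ler_pdivlMr// => hr t t01; apply: lt_le_trans (kP t t01).
  by apply: lt_le_trans hr; rewrite ltr_pM2l// ltrDl.
exists m; split=> // s s0 sm t t01 L LA.
have pqL := pq t t01 L LA.
rewrite pairingD pairingZr; have [->|sn] := eqVneq s 0; first by rewrite mul0r addr0.
have sp : 0 < s by rewrite lt_def sn.
rewrite -normc_gt0; apply: lt_le_trans (ler_normcB _ _).
by rewrite subr_gt0 Normc.normcM normc_real gtr0_norm//; exact: mP.
Qed.

Lemma in_tri_affine (a b c p : V) : in_tri a b c p -> exists y z : R, p = a + (y%:C *: (b - a) + z%:C *: (c - a)).
Proof.
move=> [x [y [z [_ _ _ s ->]]]]; exists y, z; have -> : x = 1 - y - z by lra.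
by apply/rowP => j; rewrite !mxE !rmorphB rmorph1; ring.
Qed.

Lemma in_tri_translate (a b c p d : V) : in_tri (a + d) (b + d) (c + d) p -> in_tri a b c (p - d).
Proof.
move=> [x [y [z [x0 y0 z0 s ->]]]]; exists x, y, z; split=> //.
have -> : x = 1 - y - z by lra.
by apply/rowP => j; rewrite !mxE !rmorphB rmorph1; ring.
Qed.

Lemma seg_translate (p q d : V) t : seg (p + d) (q + d) t = seg p q t + d.
Proof. by apply/rowP => j; rewrite /seg !mxE !rmorphB rmorph1; ring. Qed.

Lemma tri_translate (a b c d : V) : tri (a + d) (b + d) (c + d) = trimap (fun p => p + d) a b c.
Proof.
have e p q : path (seg (p + d) (q + d)) = path (fun t => seg p q t + d).
  by apply: path_proj_ext => t _; rewrite seg_translate.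
by rewrite /tri /trimap /edge (e b c) (e a c) (e a b).
Qed.

Lemma ev0_in_tri a b c p : ev L0 a = 1 -> ev L0 b = 1 -> ev L0 c = 1 -> in_tri a b c p -> ev L0 p = 1.
Proof.
move=> ha hb hc [x [y [z [_ _ _ s ->]]]]; rewrite ev_comb ha hb hc !mulr1 -!rmorphD /=.
by rewrite s.
Qed.

(* A generic translation moves the triangle off the multiple points of [A]. *)
Lemma tri_generated a b c : ev L0 a = 1 -> ev L0 b = 1 -> ev L0 c = 1 ->
  visible A a b -> visible A a c -> visible A b c -> generated (tri a b c).
Proof.
move=> ha hb hc ab ac bc.
have [d [Ld dT]] : exists d, ev L0 d = 0 /\ forall r s : R, d != r%:C *: (b - a) + s%:C *: (c - a).
  by apply: transverse_direction; rewrite pairingB ?ha ?hb ?hc subrr.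
have [e1 [e10 h1]] := edge_margin d ab; have [e2 [e20 h2]] := edge_margin d ac.
have [e3 [e30 h3]] := edge_margin d bc.
pose e := Num.min e1 (Num.min e2 e3).
have e0 : 0 < e by rewrite !lt_min e10 e20.
pose bad (LL : line R * line R) (s : R) := exists p, [/\ in_tri a b c p,
  ev LL.1 (p + s%:C *: d) = 0 & ev LL.2 (p + s%:C *: d) = 0].
(* Each pair of lines has at most one bad s: the normalisation L0 = 1 fixes their common vector, so
   two bad values would express d as a real combination of b - a and c - a. *)
pose sbad LL := xget 0 [set s | bad LL s].
have bad_unique LL s : LL.1 != LL.2 -> bad LL s -> s = sbad LL.
  move=> LL12 bs; have : bad LL (sbad LL) by apply: (@xgetPex _ 0 [set s | bad LL s]); exists s.
  move: (sbad LL) => s' [p' [p'in p'1 p'2]]; case: bs => p [pin p1 p2].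
  have n0 : ev L0 (p + s%:C *: d) = 1.
    by rewrite pairingD pairingZr Ld mulr0 addr0; exact: ev0_in_tri pin.
  have n0' : ev L0 (p' + s'%:C *: d) = 1.
    by rewrite pairingD pairingZr Ld mulr0 addr0; exact: ev0_in_tri p'in.
  have nz : p' + s'%:C *: d != 0 by apply: (@pairing_neq0 _ (coords L0)); rewrite n0' oner_eq0.
  have [k E] := meet_unique LL12 p1 p2 p'1 p'2 nz.
  have k1 : k = 1 by move: n0; rewrite E pairingZr n0' mulr1.
  have [y [z pE]] := in_tri_affine pin; have [y' [z' p'E]] := in_tri_affine p'in.
  apply/eqP; rewrite -subr_eq0; apply/negPn/negP => ss.
  have := dT ((y' - y) / (s - s')) ((z' - z) / (s - s')); move/eqP; apply.
  have ssC : (s - s')%:C != 0 :> C by rewrite eq_complex /= negb_and ss.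
  apply: (scalerI ssC); rewrite scalerDr !scalerA -!rmorphM /= ![(s - s') * _]mulrC !divfK//.
  move: E; rewrite k1 scale1r pE p'E.
  move: (b - a) (c - a) => u v E; rewrite !rmorphB !scalerBl.
  have -> : s%:C *: d = (a + (y'%:C *: u + z'%:C *: v) + s'%:C *: d) - (a + (y%:C *: u + z%:C *: v)).
    by rewrite -E addrAC subrr add0r.
  by apply/rowP => j; rewrite !mxE; ring.
(* Linear polynomials turn the avoidance of the finitely many bad values into an avoidance of
   roots. *)
have [|s [s0 se sP]] := @generic_nonroot R [seq 'X - (sbad LL)%:P | LL <- [seq (L, L') | L <- A, L' <- A]] e e0.
  by move=> p /mapP[LL _ ->]; rewrite polyXsubC_eq0.
have sb L L' : L \in A -> L' \in A -> L != L' -> ~ bad (L, L') s.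
  move=> LA L'A LL' bs; have sE := bad_unique (L, L') s LL' bs.
  have LLin : (L, L') \in [seq (L, L') | L <- A, L' <- A] by apply/allpairsP; exists (L, L').
  have := sP _ (map_f (fun LL => 'X - (sbad LL)%:P) LLin).
  by rewrite !hornerE -sE subrr eqxx.
have mv p q (ee : R) : 0 < ee -> e <= ee -> (forall s, 0 <= s -> s <= ee -> forall t, 0 <= t <= 1 -> avoid A (seg p q t + s%:C *: d)) ->
    visible A (p + s%:C *: d) (q + s%:C *: d).
  move=> ee0 lee h t t01; rewrite seg_translate; apply: h => //; first exact: ltW.
  by apply: le_trans lee; exact: ltW.
have le1 : e <= e1 by rewrite ge_min lexx.
have le2 : e <= e2 by rewrite !ge_min lexx orbT.
have le3 : e <= e3 by rewrite !ge_min lexx !orbT.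
have gp : general_position A L0 (a + s%:C *: d) (b + s%:C *: d) (c + s%:C *: d).
  split.
  - exact: mv e10 le1 h1.
  - exact: mv e20 le2 h2.
  - exact: mv e30 le3 h3.
  - move=> L L' p LA L'A LL' /in_tri_translate pin e_ ; apply/eqP => e'.
    by apply: (sb L L' LA L'A LL'); exists (p - s%:C *: d); rewrite subrK.
  - move=> p /in_tri_translate pin; have := ev0_in_tri ha hb hc pin.
    by rewrite pairingB pairingZr Ld mulr0 subr0 => ->; exact: oner_neq0.
have g := tri_general_position A0 mchP Auniq gp.
apply: generated_eq g _; rewrite tri_translate.
pose h (r : R) (p : V) := p + (r * s)%:C *: d.
have B : bounds A (trimap (h 0) a b c - trimap (h 1) a b c).
  apply: (tri_homotopy A0).
    move=> p q T f g y f01 g01 fy gy.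
    have c1 : {for y, continuous (fun t => (f t * s)%:C)} by apply: ctsC; exact: (ctsRM fy (@cts_cst _ _ s y)).
    have c2 : {for y, continuous (fun t => seg p q (g t))} by exact: (@seg_cts R p q T g y g01 gy).
    have c3 := cts_scalev c1 (@cts_cst _ _ d y).
    exact: (cts_addv c2 c3).
  move=> p q r t pq r01 t01.
  have [r0 r1] := andP r01.
  have rs0 : 0 <= r * s := mulr_ge0 r0 (ltW s0).
  have rse : r * s <= e by apply: le_trans (ltW se); rewrite ler_piMl// (ltW s0).
  move: pq; rewrite !inE => /or3P[]/eqP[-> ->].
  - by apply: h3 => //; exact: le_trans rse le3.
  - by apply: h2 => //; exact: le_trans rse le2.
  - by apply: h1 => //; exact: le_trans rse le1.
have E0 : h 0 = id by apply/funext => p; rewrite /h mul0r scale0r addr0.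
have E1 : h 1 = (fun p => p + s%:C *: d) by apply/funext => p; rewrite /h mul1r.
move: B; rewrite E0 E1 => B.
by apply: (bounds_eq (boundsN B)); rewrite opprB.
Qed.

End Translation.

(** * Generic points on lines and generic viewpoints *)

Section Generation.
Variable R : realType.
Local Notation C := R[i].
Local Notation V := 'rV[C]_3.
Local Notation normc := Normc.normc.
Variable A : seq (line R).
Local Notation ev L v := (pairing (coords L) v).

(** On the real line e + t f inside L, the value of L' has real or imaginary part a nonzero
    polynomial in t, for otherwise L' would contain e and f and equal L. *)
Lemma generic_on_line (L : line R) :
  exists d, ev L d = 0 /\ forall L', L' \in A -> L' != L -> ev L' d != 0.
Proof.
have [q [e [f [_ Le Lf _ LL]]]] := kernel_basis L.
pose lin (a b : R) : {poly R} := a%:P + b *: 'X.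
have lin0 a b : (a != 0) || (b != 0) -> lin a b != 0.
  move=> h; apply: contraL h => /eqP/polyP h.
  have := h 0%N; have := h 1%N; rewrite !coefD !coefZ !coefC !coefX /= !mulr1 !mulr0 !addr0 add0r.
  by move=> -> ->; rewrite eqxx.
have linE a b t : (lin a b).[t] = a + b * t by rewrite !hornerE.
pose re L' := lin (complex.Re (ev L' e)) (complex.Re (ev L' f)).
pose im L' := lin (complex.Im (ev L' e)) (complex.Im (ev L' f)).
have [|t [_ _ tP]] := @generic_nonroot R [seq (if re L' != 0 then re L' else im L') | L' <- A & L' != L] 1 ltr01.
  move=> p /mapP[L']; rewrite mem_filter => /andP[L'L _] ->.
  case: ifPn => // /negPn/eqP re0; apply: (lin0); rewrite -negb_and.
  apply: contra L'L => /andP[ime imf]; apply/eqP; apply: LL; apply/eqP;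
    rewrite eq_complex /= ?ime ?imf andbT.
    apply/negPn/negP => n; have : re L' != 0 by apply: (lin0); rewrite n.
    by rewrite re0 eqxx.
  apply/negPn/negP => n; have : re L' != 0 by apply: (lin0); rewrite n orbT.
  by rewrite re0 eqxx.
exists (e + t%:C *: f); split; first by rewrite pairingD pairingZr Le Lf mulr0 addr0.
move=> L' L'A L'L; have h : L' \in [seq L' <- A | L' != L] by rewrite mem_filter L'L.
have := tP _ (map_f (fun L' => if re L' != 0 then re L' else im L') h).
rewrite pairingD pairingZr eq_complex negb_and /re /im.
case: (ev L' e) (ev L' f) => a b [c d] /=; rewrite !mul0r !subr0 addr0 ![t * _]mulrC.
by case: ifP => _; rewrite linE => ->; rewrite ?orbT.
Qed.

Lemma disc_exists (L : line R) : exists v w rho, disc A L v w rho.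
Proof.
have [d [Ld dP]] := generic_on_line L; have [q [_ [_ [Lq _ _ _ _]]]] := kernel_basis L.
have Lq0 : ev L q != 0 by rewrite Lq oner_eq0.
by have [rho h] := disc_radius Ld Lq0 dP; exists d, q, rho.
Qed.

(** The segment can hit L only if the values of L at its ends have a real ratio. The alternative of
    equal values covers L0, which is 1 at both ends. *)
Lemma visible_Im (p q : V) : avoid A p -> (forall L, L \in A -> ev L q != 0 /\
    (complex.Im (conjc (ev L p) * ev L q) != 0 \/ ev L p = ev L q)) -> visible A q p.
Proof.
move=> pA h t t01 L LA; have p0 := pA L LA; have [q0 [im|e]] := h L LA; last first.
  by rewrite seg_ev e -mulrDl -rmorphD subrK mul1r.
apply/eqP => z; move: im; have : conjc (ev L p) * ev L (seg q p t) = 0 by rewrite z mulr0.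
rewrite seg_ev mulrDr mulrCA [X in _ + X]mulrCA [conjc _ * ev L p]mulrC sqr_normcE.
move/(congr1 (@complex.Im R)); rewrite -rmorphM.
case: (conjc _ * _) => a b /=; rewrite mul0r !addr0 => /eqP.
rewrite mulf_eq0 => /orP[/eqP s|->//].
have t1 : t = 1 by lra.
by move: z p0; rewrite t1 seg1 => ->; rewrite eqxx.
Qed.

Variable L0 : line R.

(** The point d at infinity misses the other lines, and the factor 1 + i t makes L(kd) / L(p)
    nonreal for all L and p. Then Im of conj L(p) times L(q0 + r kd) is a nonconstant polynomial in
    r, and a generic r gives the viewpoint. *)
Lemma generic_viewpoint (ps : seq V) : (forall p, p \in ps -> avoid A p /\ ev L0 p = 1) ->
  exists q, ev L0 q = 1 /\ forall p, p \in ps -> visible A q p.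
Proof.
move=> psP; have [d [L0d dP]] := generic_on_line L0.
have [q0 [_ [_ [Lq0 _ _ _ _]]]] := kernel_basis L0.
have pd L p : L \in A -> L != L0 -> p \in ps -> conjc (ev L p) * ev L d != 0.
  by move=> LA LL0 pps; rewrite mulf_neq0 ?conjc_eq0 ?dP//; apply: (psP p pps).1.
have [|t [_ _ tP]] := @generic_complex R [seq conjc (ev L p) * ev L d | L <- [seq L <- A | L != L0], p <- ps] 1 ltr01.
  move=> z /allpairsP[[L p] /= [LA pps ->]]; move: LA; rewrite mem_filter => /andP[LL0 LA].
  exact: pd.
have [kd kdE] : exists kd, kd = (1 +i* t) *: d by eexists.
have Lkd p L : p \in ps -> L \in A -> L != L0 -> complex.Im (conjc (ev L p) * ev L kd) != 0.
  move=> pps LA LL0; rewrite kdE pairingZr mulrCA; apply: tP.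
  by apply/allpairsP; exists (L, p); split; rewrite ?mem_filter ?LL0.
have kd0 L : L \in A -> L != L0 -> ev L kd != 0.
  move=> LA LL0; rewrite kdE pairingZr mulf_neq0 ?dP//.
  by rewrite eq_complex /= oner_eq0.
pose lin (a b : R) : {poly R} := a%:P + b *: 'X.
have lin0 a b : b != 0 -> lin a b != 0.
  move=> h; apply: contra h => /eqP/polyP h.
  by have := h 1%N; rewrite !coefD !coefZ !coefC !coefX /= !mulr1 add0r => ->.
have linE a b r : (lin a b).[r] = a + b * r by rewrite !hornerE.
pose P1 Lp := lin (complex.Im (conjc (ev Lp.1 Lp.2) * ev Lp.1 q0)) (complex.Im (conjc (ev Lp.1 Lp.2) * ev Lp.1 kd)).
pose P2 L := if complex.Re (ev L kd) != 0 then lin (complex.Re (ev L q0)) (complex.Re (ev L kd))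
  else lin (complex.Im (ev L q0)) (complex.Im (ev L kd)).
pose AL := [seq L <- A | L != L0].
have [|r [_ _ rP]] := @generic_nonroot R ([seq P1 Lp | Lp <- [seq (L, p) | L <- AL, p <- ps]] ++ map P2 AL) 1 ltr01.
  move=> p; rewrite mem_cat => /orP[/mapP[Lp /allpairsP[[L x] /= [LA xps ->]] ->]|/mapP[L LA ->]].
    by move: LA; rewrite mem_filter => /andP[LL0 LA]; apply: (lin0); exact: Lkd.
  move: LA; rewrite mem_filter /P2 => /andP[LL0 LA]; case: ifPn => [h|/negPn h]; apply: (lin0) => //.
  by have := kd0 L LA LL0; rewrite eq_complex h.
exists (q0 + r%:C *: kd); split.
  by rewrite pairingD pairingZr kdE pairingZr L0d Lq0 !mulr0 addr0.
move=> p pps; have [pA p1] := psP p pps; apply: visible_Im => // L LA.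
have [->|LL0] := eqVneq L L0.
  by rewrite pairingD pairingZr kdE pairingZr L0d Lq0 !mulr0 addr0 oner_eq0; split=> //; right.
have LAL : L \in AL by rewrite mem_filter LL0.
rewrite pairingD pairingZr; split.
  have := rP (P2 L); rewrite mem_cat map_f ?orbT// => /(_ isT).
  rewrite eq_complex negb_and /P2; case: (ev L q0) (ev L kd) => a b [c e] /=.
  rewrite !mul0r !subr0 addr0 ![r * _]mulrC.
  by case: ifP => _; rewrite linE => ->; rewrite ?orbT.
left; have := rP (P1 (L, p)); rewrite mem_cat map_f; last by apply/allpairsP; exists (L, p).
move=> /(_ isT); rewrite /P1 linE /= mulrDr mulrCA.
case: (conjc _ * ev L q0) (conjc _ * ev L kd) => a b [c e] /=.
by rewrite mul0r addr0 [e * r]mulrC.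
Qed.

End Generation.

(** * Cones over paths and cycles *)

Section Cone.
Variable R : realType.
Local Notation C := R[i].
Local Notation V := 'rV[C]_3.
Local Notation normc := Normc.normc.
Local Notation simplex := (std_simplex R).
Local Notation chain1 := (chain R (CP2 R) 1).
Variable A : seq (line R).
Hypothesis A0 : A != [::].
Variable L0 : line R.
Hypothesis L0A : L0 \in A.
Variable mch : line R -> chain1.
Hypothesis mchP : forall L, L \in A -> L != L0 ->
  exists v w rho, disc A L v w rho /\ mch L = << path (circ v w rho) >>.
Hypothesis Auniq : uniq A.
Local Notation generated := (generated A L0 mch).
Local Notation ev L v := (pairing (coords L) v).

Lemma convex_lt (s t X Y Z : R) : 0 <= s <= 1 -> 0 <= t <= 1 -> 0 <= Y -> Y < X -> Z < X ->
  (1 - s) * Z + s * t * Y < X.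
Proof.
move=> /andP[s0 s1] /andP[t0 t1] Y0 YX ZX.
have h1 : s * t * Y <= s * Y by rewrite -mulrA ler_wpM2l// ler_piMl.
have h2 : s * Y <= s * X by rewrite ler_wpM2l// ltW.
have [s_|s_] := ltP s 1.
  have : (1 - s) * Z < (1 - s) * X by rewrite ltr_pM2l// subr_gt0.
  by lra.
have -> : s = 1 by lra.
by rewrite subrr mul0r add0r mul1r; apply: le_lt_trans YX; rewrite ler_piMl.
Qed.

(** Each L stays within |L(g a)| of its value at g a, on the path and on the chord alike, so the
    straight homotopy between them avoids A. *)
Lemma short_path g a b : admissible A g -> 0 <= a <= 1 -> 0 <= b <= 1 ->
  (forall t L, 0 <= t <= 1 -> L \in A ->
    normc (ev L (sub_path g a b t) - ev L (g a)) < normc (ev L (g a))) ->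
  visible A (g a) (g b) /\ bounds A (<< path (sub_path g a b) >> - edge (g a) (g b)).
Proof.
move=> ga a01 b01 h.
have gs := admissible_sub a01 b01 ga.
have e0 : sub_path g a b 0 = g a by rewrite /sub_path mul0r addr0.
have e1 : sub_path g a b 1 = g b by rewrite /sub_path mul1r addrC subrK.
have i1 : 0 <= (1 : R) <= 1 by rewrite lexx ler01.
have av (s t : R) : 0 <= s <= 1 -> 0 <= t <= 1 ->
    avoid A ((1 - s)%:C *: sub_path g a b t + s%:C *: seg (g a) (g b) t).
  move=> s01 t01 L LA; have := h t L t01 LA; have := h 1 L i1 LA; rewrite e1.
  rewrite pairingD !pairingZr seg_ev.
  move: (ev L (sub_path g a b t)) (ev L (g a)) (ev L (g b)) => z x y hy hz.
  have -> : (1 - s)%:C * z + s%:C * ((1 - t)%:C * x + t%:C * y) =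
      x + ((1 - s)%:C * (z - x) + (s * t)%:C * (y - x)).
    by rewrite !rmorphB rmorph1 rmorphM /=; ring.
  rewrite -normc_gt0; apply: lt_le_trans (ler_normcB _ _); rewrite subr_gt0.
  apply: le_lt_trans (ler_normcD _ _) _; rewrite !Normc.normcM !normc_real !ger0_norm; try nra.
  exact: convex_lt s01 t01 (normc_ge0 _) hy hz.
split.
  by move=> t t01; have := av 1 t i1 t01; rewrite subrr scale0r add0r scale1r.
have i0 : 0 <= (0 : R) <= 1 by rewrite lexx ler01.
have cst1 : bounds A << path (fun=> g a) >> := bounds_const A0 (ga.2 a a01).
have cst2 : bounds A << path (fun=> g b) >> := bounds_const A0 (ga.2 b b01).
pose H (s t : R) := (1 - s)%:C *: sub_path g a b t + s%:C *: seg (g a) (g b) t.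
have Hc : cts2 H.
  move=> T f f' x f01 f'01 fx f'x.
  have c1 : {for x, continuous (fun t => (1 - f t)%:C)} by exact: (@ctsC01_1sub R T f x f01 fx).
  have c2 : {for x, continuous (fun t => (f t)%:C)} by apply: ctsC.
  have c3 : {for x, continuous (fun t => sub_path g a b (f' t))} by exact: (gs.1 T f' x f'01 f'x).
  have c4 : {for x, continuous (fun t => seg (g a) (g b) (f' t))} by exact: (@seg_cts R (g a) (g b) T f' x f'01 f'x).
  exact: (cts_addv (cts_scalev c1 c3) (cts_scalev c2 c4)).
pose ca : R -> V := fun=> g a; pose cb : R -> V := fun=> g b.
have B : bounds A (<< path ca >> + << path (seg (g a) (g b)) >> - << path (sub_path g a b) >> - << path cb >>).
  apply: (bounds_square_ext A0 Hc av) => s s01; rewrite /H.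
  - by rewrite e0 seg0 -scalerDl -rmorphD subrK scale1r.
  - by rewrite subrr scale0r add0r scale1r.
  - by rewrite subr0 scale1r scale0r addr0.
  - by rewrite e1 seg1 -scalerDl -rmorphD subrK scale1r.
by apply: (bounds_eq (boundsB (boundsB cst1 cst2) B)); rewrite /edge /ca /cb; path_ring.
Qed.

Lemma path_subdivision g n N : (n <= N)%N -> (0 < N)%N -> admissible A g ->
  bounds A (\sum_(i < n) << path (sub_path g (i%:R / N%:R) (i.+1%:R / N%:R)) >>
    - << path (sub_path g 0 (n%:R / N%:R)) >>).
Proof.
move=> nN N0 ga.
have i01 k : (k <= N)%N -> 0 <= (k%:R / N%:R : R) <= 1.
  by move=> kN; rewrite divr_ge0 ?ler0n// ler_pdivrMr ?ltr0n// mul1r ler_nat kN.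
have z01 : 0 <= (0 : R) <= 1 by rewrite lexx ler01.
elim: n nN => [_|n IH nN].
  rewrite big_ord0 sub0r; apply: boundsN; rewrite mul0r.
  have -> : path (sub_path g 0 0) = path (fun=> g 0).
    by apply: path_proj_ext => t _; rewrite /sub_path subrr mulr0 addr0.
  exact: (bounds_const A0 (ga.2 0 z01)).
rewrite big_ord_recr /=.
have B := bounds_split A0 z01 (i01 n (ltnW nN)) (i01 n.+1 nN) ga.
apply: (bounds_eq (boundsD (IH (ltnW nN)) B)).
by move: (\sum_(i < n) _) => S; path_ring.
Qed.

Lemma generated_sum (I : eqType) (s : seq I) (F : I -> chain1) :
  (forall i, i \in s -> generated (F i)) -> generated (\sum_(i <- s) F i).
Proof.
elim: s => [_|i s IH h]; first by rewrite big_nil; exact: generated0.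
rewrite big_cons; apply: generatedD; first by apply: h; exact: mem_head.
by apply: IH => j js; apply: h; rewrite inE js orbT.
Qed.

Lemma generated_mulz c (k : int) : generated c -> generated (c *~ k).
Proof.
move=> h; have hn n : generated (c *+ n).
  by elim: n => [|n IH]; [exact: generated0|rewrite mulrS; exact: generatedD].
by case: k => n; [exact: hn|apply: generatedN; exact: hn].
Qed.

Lemma ratio_step g : admissible A g -> exists e, 0 < e /\
  forall a b L, 0 <= a <= 1 -> 0 <= b <= 1 -> `|b - a| < e -> L \in A ->
    normc (ev L (g b) - ev L (g a)) < normc (ev L (g a)).
Proof.
move=> ga.
have [|e [e0 eP]] := @seq_minimum R _ A (fun L r => forall a b, 0 <= a <= 1 -> 0 <= b <= 1 ->
    `|b - a| < r -> normc (ev L (g b) - ev L (g a)) < normc (ev L (g a))).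
  move=> L LA; have c := @admissible_cts _ _ L _ ga.
  have n0 (x : simplex 1) : ev L (g (edge_param x)) != 0 by apply: ga.2 => //; exact: edge_param01.
  have [e [e0 eP]] := uniform_ratio c n0; exists e; split=> // r r0 re a b a01 b01 ab.
  have := eP (pt1 a) (pt1 b); rewrite !edge_param_pt1 !clampE//; apply.
  have E0 (t : R) : 0 <= t <= 1 -> bary 0 (pt1 t) = 1 - t.
    by move=> t01; rewrite edge_param0 edge_param_pt1 clampE.
  have E1 (t : R) : 0 <= t <= 1 -> bary ord_max (pt1 t) = t.
    by move=> t01; rewrite -edge_paramE edge_param_pt1 clampE.
  move=> i; have [->|->] : i = 0 \/ i = ord_max.
    by case: i => -[|[|//]] p; [left|right]; exact: val_inj.
    rewrite !E0// (_ : 1 - a - (1 - b) = b - a); first exact: lt_le_trans ab re.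
    by ring.
  by rewrite !E1// distrC; exact: lt_le_trans ab re.
by exists e; split=> // a b L a01 b01 ab LA; exact: (eP L LA e e0 (lexx _)).
Qed.

(** A fine subdivision replaces the path by chords, and the triangles from q over the chords are
    generated; their inner edges telescope. The points [ps] precede q because one apex must see the
    subdivisions of all simplices of a cycle. *)
Lemma path_cone g : admissible A g -> (forall t, 0 <= t <= 1 -> ev L0 (g t) = 1) ->
  exists ps : seq V, (forall p, p \in ps -> avoid A p /\ ev L0 p = 1) /\
    forall q, ev L0 q = 1 -> (forall p, p \in ps -> visible A q p) ->
      generated (<< path g >> - (edge q (g 1) - edge q (g 0))).
Proof.
move=> ga g1; have [e [e0 eP]] := ratio_step ga.
have [N NP] : exists N, e^-1 < N.+1%:R.
  by exists (Num.trunc e^-1); exact: truncnS_gt.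
have N0 : 0 < (N.+1%:R : R) by rewrite ltr0n.
have i01 k : (k <= N.+1)%N -> 0 <= (k%:R / N.+1%:R : R) <= 1.
  by move=> kN; rewrite divr_ge0 ?ler0n// ler_pdivrMr ?ltr0n// mul1r ler_nat kN.
pose x k : R := k%:R / N.+1%:R.
exists [seq g (x k) | k <- iota 0 N.+2]; split.
  move=> p /mapP[k]; rewrite mem_iota add0n ltnS => /= kN ->.
  by split; [exact: ga.2 _ (i01 k kN)|exact: g1 (i01 k kN)].
move=> q Lq vis.
have visk k : (k <= N.+1)%N -> visible A q (g (x k)).
  by move=> kN; apply: vis; apply: map_f; rewrite mem_iota add0n ltnS.
have step k : (k < N.+1)%N -> generated (<< path (sub_path g (x k) (x k.+1)) >> -
    (edge q (g (x k.+1)) - edge q (g (x k)))).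
  move=> kN; have kN' := ltnW kN.
  have xx : x k.+1 - x k = N.+1%:R^-1 by rewrite /x -mulrBl -natr1 addrAC subrr add0r mul1r.
  have [|v B] := @short_path g (x k) (x k.+1) ga (i01 k kN') (i01 k.+1 kN).
    move=> t L t01 LA; apply: eP => //; first exact: i01.
      by apply: affine01 => //; exact: i01.
    rewrite addrC addKr xx normrM; have [t0 t1] := andP t01.
    rewrite (ger0_norm t0) gtr0_norm ?invr_gt0//.
    apply: le_lt_trans (_ : N.+1%:R^-1 < e); first by rewrite ler_piMl// invr_ge0 ltW.
    by rewrite invf_plt ?posrE.
  have T := tri_generated A0 mchP Auniq Lq (g1 _ (i01 k kN')) (g1 _ (i01 k.+1 kN)) (visk k kN') (visk k.+1 kN) v.
  apply: generated_eq T _.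
  by apply: (bounds_eq (boundsN B)); rewrite /tri; move: (edge _ _) (edge _ _) (edge _ _) => a b c; path_ring.
have S : generated (\sum_(i < N.+1) (<< path (sub_path g (x i) (x i.+1)) >> -
    (edge q (g (x i.+1)) - edge q (g (x i))))).
  by apply: generated_sum => i _; exact: step.
apply: generated_eq S _.
have B := @path_subdivision g N.+1 N.+1 (leqnn _) isT ga.
have x1 : x N.+1 = 1 by rewrite /x divff// gt_eqF.
have x0 : x 0%N = 0 by rewrite /x mul0r.
have tele n : \sum_(i < n) (edge q (g (x i.+1)) - edge q (g (x i))) = edge q (g (x n)) - edge q (g (x 0%N)).
  elim: n => [|n IH]; first by rewrite big_ord0 subrr.
  by rewrite big_ord_recr IH /=; move: (edge _ _) (edge _ _) (edge _ _) => a b c; path_ring.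
rewrite sumrB tele x1 x0.
apply: (bounds_eq B); rewrite -/(x N.+1) x1.
have -> : path (sub_path g 0 1) = path g by apply: path_proj_ext => t _; rewrite /sub_path subr0 mulr1 add0r.
by rewrite /x; move: (\sum_(i < N.+1) _) (edge _ _) (edge _ _) => S' a b; path_ring.
Qed.

Lemma simplex0_inhabited : exists x : simplex 0, True.
Proof.
have h : (const_mx 1 : 'rV[R]_1) \in simplex 0.
  by apply/mem_set; split; [move=> i; rewrite mxE ler01|rewrite big_ord1 mxE].
by exists (SigSub h).
Qed.

Definition chart_path (s : sing R (CP2 R) 1) (t : R) : V := chart L0 (s (pt1 t)).

Lemma chart_path_admissible (s : sing R (CP2 R) 1) : range s `<=` complement A -> admissible A (chart_path s).
Proof.
move=> sA; have sA' x : complement A (s x) by apply: sA; exists x.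
split; last by move=> t _ L LA; apply: pairing_chart_neq0; exact: sA'.
move=> T f x f01 fx; apply: (@cts_chart R T (fun t => s (pt1 (f t))) L0 x (sA' _ L0 L0A)).
have c1 : {for x, continuous (fun t => pt1 (f t))} by exact: (cts_comp fx (@pt1_cts R (f x))).
have sc : continuous s by exact: cts_fun.
exact: (cts_comp c1 (sc _)).
Qed.

Lemma path_chart_path (s : sing R (CP2 R) 1) : range s `<=` complement A -> path (chart_path s) = s.
Proof.
move=> sA; apply/continuousEP => x; rewrite (pathE A0 x (chart_path_admissible sA)).
rewrite /chart_path pt1_edge_param proj_chart//.
by apply: sA L0A; exists x.
Qed.

(** [Psi] sends a point to the edge from the apex q to it. Then c - Psi (boundary c) is additive in
    c, generated on each simplex of z by [path_cone], and equal to c on cycles. *)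
Lemma chain_generated (z : chain1) : chain_in (complement A) z -> boundary z = 0 -> generated z.
Proof.
move=> zA bz; have [x0 _] := simplex0_inhabited.
have /choice[ps psP] : forall s : sing R (CP2 R) 1, exists ps : seq V, s \in dom z ->
    (forall p, p \in ps -> avoid A p /\ ev L0 p = 1) /\
    forall q, ev L0 q = 1 -> (forall p, p \in ps -> visible A q p) ->
      generated (<< s >> - (edge q (chart_path s 1) - edge q (chart_path s 0))).
  move=> s; have [sz|sz] := boolP (s \in dom z); last by exists [::].
  have sA := zA s sz.
  have n1 t : 0 <= t <= 1 -> ev L0 (chart_path s t) = 1.
    by move=> _; apply: chart1; apply: sA L0A; exists (pt1 t).
  have [ps h] := path_cone (chart_path_admissible sA) n1.
  by exists ps => _; rewrite path_chart_path in h.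
have [|q [Lq vis]] := @generic_viewpoint R A L0 (flatten [seq ps s | s <- dom z]).
  by move=> p /flatten_mapP[s sz pps]; exact: (psP s sz).1.
have [Psi [PsiM PsiU]] : exists Psi : chain R (CP2 R) 0 -> chain1, zmod_morphism Psi /\
    forall s0 : sing R (CP2 R) 0, Psi << s0 >> = edge q (chart L0 (s0 x0)).
  exists (fglift (fun s0 : sing R (CP2 R) 0 => edge q (chart L0 (s0 x0)))).
  by split; [exact: lift_is_additive|move=> s0; rewrite liftU scale1r].
have Psi0 : Psi 0 = 0 by rewrite -(subrr 0) PsiM subrr.
pose F (c : chain1) : chain1 := c - Psi (boundary c).
have FB : zmod_morphism F.
  move=> c d; rewrite /F boundary_is_zmod_morphism PsiM.
  by move: (Psi _) (Psi _) => x y; freeg_ring.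
have fE i : face i x0 = pt1 ((i == 0)%:R : R).
  apply: edge_param_inj; rewrite edge_param_face edge_param_pt1 clampE//.
  by case: (i == 0); rewrite ?lexx ?ler01.
have Fs s : s \in dom z -> generated (F << s >>).
  move=> sz; have [_ h] := psP s sz.
  have -> : F << s >> = << s >> - (edge q (chart_path s 1) - edge q (chart_path s 0)).
    rewrite /F /boundary liftU scale1r big_ord_recl big_ord1 expr0 expr1 scale1r scaleN1r PsiM.
    rewrite !PsiU /chart_path.
    have e1 : sing_face 0 s x0 = s (pt1 1) by rewrite -(fE 0).
    have e0 : sing_face (fintype.lift ord0 ord0) s x0 = s (pt1 0) by rewrite -(fE (fintype.lift ord0 ord0)).
    by rewrite e0 e1.
  by apply: h => // p pps; apply: vis; apply/flatten_mapP; exists s.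
have -> : z = F z by rewrite /F bz Psi0 subr0.
pose F' : {additive chain1 -> chain1} := HB.pack F (GRing.isZmodMorphism.Build _ _ F FB).
rewrite -[F z]/(F' z) -(freeg_sumE z) raddf_sum; apply: generated_sum => s sz.
have -> : << coeff s z *g s >> = << s >> *~ coeff s z :> chain1 by rewrite freegU_mulz intz.
by rewrite raddfMz; apply: generated_mulz; exact: Fs.
Qed.

End Cone.

(** * The coefficients of a homology class as winding numbers *)

Section Structure.
Variable R : realType.
Variable A : seq (line R).
Variable L0 : line R.
Hypothesis L0A : L0 \in A.
Hypothesis Auniq : uniq A.

Lemma winding_mulz L c (k : int) : winding L0 L (c *~ k) = winding L0 L c * k%:~R.
Proof.
pose W : {additive chain R (CP2 R) 1 -> R} :=
  HB.pack (winding L0 L) (GRing.isZmodMorphism.Build _ _ _ (@winding_is_zmod_morphism R L0 L)).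
by rewrite -[winding L0 L (c *~ k)]/(W (c *~ k)) raddfMz mulrzr.
Qed.

Lemma winding_sum (I : Type) (s : seq I) (P : pred I) L (F : I -> chain R (CP2 R) 1) :
  winding L0 L (\sum_(i <- s | P i) F i) = \sum_(i <- s | P i) winding L0 L (F i).
Proof.
pose W : {additive chain R (CP2 R) 1 -> R} :=
  HB.pack (winding L0 L) (GRing.isZmodMorphism.Build _ _ _ (@winding_is_zmod_morphism R L0 L)).
exact: (raddf_sum W).
Qed.

(** Integers k exist because the cycle is generated; windings are homology invariants dual to the
    meridians, so they read off these same integers. *)
Theorem homology_structure (z : cycle1 R (complement A)) : exists k : line R -> int,
  homology_class z = \sum_(L <- A | L != L0) meridian A L *~ k L /\
  forall L, L \in A -> L != L0 -> winding L0 L (cycle_val z) = 2 * pi * (k L)%:~R.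
Proof.
have A0 : A != [::] by apply: contraTneq L0A => ->.
have /choice[mc mcP] : forall L, exists m : cycle1 R (complement A), exists v w rho,
    disc A L v w rho /\ cycle_val m = << path (circ v w rho) >>.
  move=> L; have [v [w [rho d]]] := disc_exists A L.
  by exists (Cycle1 (circ_cycle A0 d)), v, w, rho.
have mchP L : L \in A -> L != L0 -> exists v w rho,
    disc A L v w rho /\ cycle_val (mc L) = << path (circ v w rho) >> by move=> _ _; exact: mcP.
have [zA bz] : chain_in (complement A) (cycle_val z) /\ boundary (cycle_val z) = 0.
  by case: z => z zc; have /asboolP := zc.
have [k kP] := chain_generated A0 L0A mchP Auniq zA bz.
exists k; split.
  pose zs := \sum_(L <- A | L != L0) mc L *~ k L.
  have -> : homology_class z = homology_class zs.
    apply: homology_class_eq; apply: (bounds_eq kP); congr (_ - _).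
    pose cv : {additive cycle1 R (complement A) -> chain R (CP2 R) 1} := \val.
    rewrite /meridian_sum -[cycle_val zs]/(cv zs) (raddf_sum cv).
    by apply: eq_bigr => L _; rewrite -[cycle_val _]/(cv _) -(raddfMz cv).
  rewrite /zs /homology_class (raddf_sum \pi_(H1 R (complement A))) big_seq_cond [RHS]big_seq_cond.
  apply: eq_bigr => L /andP[LA LL0]; rewrite (raddfMz \pi_(H1 R (complement A))); congr (_ *~ _).
  have [v [w [rho [d e]]]] := mcP L.
  have v0 : v != 0 by apply: (@pairing_neq0 _ (coords L0)); apply: disc_neq0 d L0A _; rewrite eq_sym.
  by rewrite (meridianE A0 LA v0 d e).
move=> L LA LL0; rewrite (winding_bounds L0A LA kP) /meridian_sum winding_sum.
rewrite big_mkcond (bigD1_seq L)//= LL0 big1 ?addr0.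
  have [v [w [rho [d ->]]]] := mcP L.
  by rewrite winding_mulz (winding_circ A0 L0A d LA LL0 LL0) eqxx.
move=> L' L'L; case: ifP => // L'L0; have [v [w [rho [d ->]]]] := mcP L'.
by rewrite winding_mulz (winding_circ A0 L0A d LA L'L0 LL0) eq_sym (negPf L'L) mul0r.
Qed.

End Structure.
(** * Half planes in a regular neighbourhood *)

Section Hermitian.
Variable R : realType.
Local Notation C := R[i].
Local Notation V := 'rV[C]_3.
Local Notation normc := Normc.normc.
Local Notation ev L v := (pairing (coords L) v).

Definition herm (v w : V) : C := pairing v (map_mx conjc w).

Definition hsq (v : V) : R := \sum_i normc (v 0 i) ^+ 2.

Lemma hermE v : herm v v = (hsq v)%:C.
Proof.
by rewrite /herm /pairing /hsq rmorph_sum; apply: eq_bigr => i _; rewrite mxE sqr_normcE.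
Qed.

Lemma hermDl u v w : herm (u + v) w = herm u w + herm v w.
Proof. by rewrite /herm /pairing -big_split; apply: eq_bigr => i _; rewrite mxE mulrDl. Qed.

Lemma hermZl c v w : herm (c *: v) w = c * herm v w.
Proof. by rewrite /herm /pairing mulr_sumr; apply: eq_bigr => i _; rewrite mxE mulrA. Qed.

Lemma hermNl v w : herm (- v) w = - herm v w.
Proof. by rewrite -scaleN1r hermZl mulN1r. Qed.

Lemma hermC v w : herm w v = conjc (herm v w).
Proof.
rewrite /herm /pairing rmorph_sum; apply: eq_bigr => i _.
by rewrite !mxE rmorphM /= conjcK mulrC.
Qed.

Lemma herm_orthC v w : herm v w = 0 -> herm w v = 0.
Proof. by move=> h; rewrite hermC h conjc0. Qed.

Lemma hsq_ge0 v : 0 <= hsq v.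
Proof. by apply: sumr_ge0 => i _; exact: sqr_ge0. Qed.

Lemma hsq_gt0 v : v != 0 -> 0 < hsq v.
Proof.
move=> /rV0Pn[i vi]; rewrite /hsq (bigD1 i)//= ltr_wpDr//.
  by apply: sumr_ge0 => j _; exact: sqr_ge0.
by rewrite exprn_gt0// normc_gt0.
Qed.

Lemma hsqZ c v : hsq (c *: v) = normc c ^+ 2 * hsq v.
Proof. by rewrite /hsq mulr_sumr; apply: eq_bigr => i _; rewrite mxE Normc.normcM exprMn. Qed.

Lemma hsqD v w : herm v w = 0 -> hsq (v + w) = hsq v + hsq w.
Proof.
move=> h; apply: complexI; rewrite [RHS](_ : _ = herm v v + herm w w); last by rewrite !hermE -rmorphD.
have e u : herm u (v + w) = herm u v + herm u w by rewrite hermC hermDl rmorphD /= -!hermC.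
by have := hermE (v + w); rewrite hermDl !e h (herm_orthC h) addr0 add0r => <-.
Qed.

(** Squared cosine of the Fubini-Study angle between the points of v and w, of which [point_dist] is
    the sine. *)
Definition cos2 (v w : V) : R := normc (herm v w) ^+ 2 / (hsq v * hsq w).

Lemma cos2Z c v w : c != 0 -> v != 0 -> w != 0 -> cos2 (c *: v) w = cos2 v w.
Proof.
move=> c0 v0 w0; rewrite /cos2 hermZl hsqZ Normc.normcM exprMn.
have n0 : normc c ^+ 2 != 0 by rewrite expf_neq0// normc_eq0.
have := lt0r_neq0 (hsq_gt0 v0); have := lt0r_neq0 (hsq_gt0 w0).
by move: (hsq v) (hsq w) (normc _ ^+ 2) (normc c ^+ 2) n0 => x y z t t0 y0 x0; field; rewrite x0 y0 t0.
Qed.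

Lemma hnorm_sqr v : hnorm v ^+ 2 = hsq v.
Proof. by rewrite /hnorm sqr_sqrtr// hsq_ge0. Qed.

Lemma point_distE v (P : CP2 R) : v != 0 -> point_dist (proj v) P = Num.sqrt (1 - cos2 v (coords P)).
Proof.
move=> v0; have [c c0 cE] := coords_proj v0.
rewrite /point_dist -/(herm _ _); congr (Num.sqrt (1 - _)).
by rewrite exprMn exprVn exprMn !hnorm_sqr -/(cos2 _ _) cE cos2Z// coords_neq0.
Qed.

Definition sin2 (v : V) (L : line R) : R := normc (ev L v) ^+ 2 / (hsq (coords L) * hsq v).

Lemma sin2Z c v L : c != 0 -> v != 0 -> sin2 (c *: v) L = sin2 v L.
Proof.
move=> c0 v0; rewrite /sin2 pairingZr hsqZ Normc.normcM exprMn.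
have n0 : normc c ^+ 2 != 0 by rewrite expf_neq0// normc_eq0.
have := lt0r_neq0 (hsq_gt0 v0); have := lt0r_neq0 (hsq_gt0 (coords_neq0 L)).
by move: (hsq v) (hsq _) (normc _ ^+ 2) (normc c ^+ 2) n0 => x y z t t0 y0 x0; field; rewrite x0 y0 t0.
Qed.

Lemma line_dist_ge0 (p : CP2 R) L : 0 <= line_dist p L.
Proof. by rewrite /line_dist divr_ge0 ?normc_ge0// mulr_ge0 ?sqrtr_ge0. Qed.

Lemma line_dist_sqr v L : v != 0 -> line_dist (proj v) L ^+ 2 = sin2 v L.
Proof.
move=> v0; have [c c0 cE] := coords_proj v0.
by rewrite /line_dist exprMn exprVn exprMn !hnorm_sqr -/(sin2 _ _) cE sin2Z.
Qed.

Lemma Re_gt0_near1 (x : C) : normc x < 1 -> 0 < complex.Re (1 + x).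
Proof.
move=> h; have := Re_le_normc x; rewrite ler_norml => /andP[h1 _].
by move: h h1; case: x => a b /=; lra.
Qed.

Definition conjv (L : line R) : V := map_mx conjc (coords L).

Lemma herm_conjv v L : herm v (conjv L) = ev L v.
Proof.
rewrite /herm pairingC; congr (pairing _ v).
by apply/rowP => i; rewrite !mxE conjcK.
Qed.

Lemma hsq_conjv L : hsq (conjv L) = hsq (coords L).
Proof. by apply: eq_bigr => i _; rewrite mxE; case: (coords L 0 i) => a b /=; rewrite sqrrN. Qed.

Lemma ev_conjv L : ev L (conjv L) = (hsq (coords L))%:C.
Proof. by rewrite -herm_conjv hermE hsq_conjv. Qed.

(** The orthogonal projection to the plane of L: [conjv L] is a normal vector of that plane for the
    Hermitian form. *)
Definition foot (L : line R) (v : V) : V := v - (ev L v / (hsq (coords L))%:C) *: conjv L.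

Lemma hsq_coords_neq0 (L : line R) : (hsq (coords L))%:C != 0.
Proof. by rewrite eq_complex /= eqxx andbT gt_eqF// hsq_gt0// coords_neq0. Qed.

Lemma ev_foot L v : ev L (foot L v) = 0.
Proof. by rewrite /foot pairingB pairingZr ev_conjv divfK ?subrr// hsq_coords_neq0. Qed.

(** With the same component along P, the vector of smaller norm makes the smaller angle with P. *)
Lemma le_cos2 (v w P : V) : v != 0 -> w != 0 -> herm v P = herm w P -> hsq v <= hsq w ->
  P != 0 -> cos2 w P <= cos2 v P.
Proof.
move=> v0 w0 e vw P0; have hv := hsq_gt0 v0; have hw := hsq_gt0 w0; have hP := hsq_gt0 P0.
rewrite /cos2 e ler_wpM2l ?sqr_ge0// lef_pV2 ?posrE ?mulr_gt0//.
by rewrite ler_pM2r.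
Qed.

Lemma point_dist_le v w (P : CP2 R) : v != 0 -> w != 0 -> cos2 w (coords P) <= cos2 v (coords P) ->
  point_dist (proj v) P <= point_dist (proj w) P.
Proof. by move=> v0 w0 h; rewrite !point_distE//; apply: ler_wsqrtr; rewrite lerD2l lerN2. Qed.

Lemma normc_ratio_le1 (x y : C) : y != 0 -> normc x <= normc y -> normc (- x / y) ^+ 2 <= 1.
Proof.
move=> y0 h; rewrite Normc.normcM Normc.normcV (_ : normc (- x) = normc x); last first.
  by case: x {h} => a b /=; rewrite !sqrrN.
rewrite expr_le1// ?mulr_ge0 ?invr_ge0 ?normc_ge0//.
by rewrite ler_pdivrMr ?normc_gt0// mul1r.
Qed.

Variable A : seq (line R).
Variables eps del : R.
Hypothesis radii : regular_radii A eps del.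

(** Rescale v to w = p + y with y orthogonal to p. If |L(y)| >= |L(p)|, some p + t y with |t| <= 1
    lies on L and no farther from P than v, against the separation of the ball from L. So the
    quotient is 1 plus a number of modulus below 1. *)
Lemma ball_half_plane P L v : Sing A P -> L \in A -> ~~ on_line P L -> v != 0 ->
  point_dist (proj v) P <= eps -> herm v (coords P) != 0 /\
  0 < complex.Re (ev L v / ev L (coords P) * ((hsq (coords P))%:C / herm v (coords P))).
Proof.
case: radii => d0 _ _ sep _ SP LA PL v0 vP; have p0 := coords_neq0 P.
have [p pE] : exists p, p = coords P by eexists.
rewrite -pE in p0 *; have Lp : ev L p != 0 by rewrite pE.
have far q : q != 0 -> ev L q = 0 -> point_dist (proj q) P <= eps -> False.
  move=> q0 Lq qP; have := sep P L (proj q) SP LA PL qP.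
  by rewrite line_dist_on_line ?on_line_proj ?Lq// ltNge (ltW d0).
have h0 : herm v p != 0.
  (* A vector orthogonal to P is at the maximal distance, so the ball would contain every point, in
     particular one of L. *)
  apply/eqP => h; have [Q [QL _]] := lines_meet L L.
  apply: (far (coords Q)); [exact: coords_neq0|exact/eqP|].
  apply: le_trans vP; apply: point_dist_le (coords_neq0 Q) v0 _.
  rewrite -pE {1}/cos2 h Normc.normc0 expr0n mul0r /cos2.
  by rewrite divr_ge0 ?sqr_ge0// mulr_ge0 ?hsq_ge0.
split=> //; have P0 := hsq_gt0 p0.
have PC0 : (hsq p)%:C != 0 by rewrite eq_complex /= eqxx andbT gt_eqF.
have c0 : (hsq p)%:C / herm v p != 0 by rewrite mulf_neq0// invr_eq0.
have [w wE] : exists w, w = ((hsq p)%:C / herm v p) *: v by eexists.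
have w0 : w != 0 by rewrite wE scaler_eq0 negb_or c0.
have wp : herm w p = (hsq p)%:C by rewrite wE hermZl divfK.
have [y yE] : exists y, y = w - p by eexists.
have yp : herm y p = 0 by rewrite yE hermDl hermNl wp hermE subrr.
have wy : w = p + y by rewrite yE addrC subrK.
have -> : ev L v / ev L p * ((hsq p)%:C / herm v p) = 1 + ev L y / ev L p.
  rewrite -[1](divff Lp) -mulrDl -pairingD -wy wE pairingZr mulrC [RHS]mulrC.
  by rewrite mulrCA mulrA mulrC; congr (_ * _); rewrite mulrC.
apply: Re_gt0_near1; rewrite Normc.normcM Normc.normcV ltr_pdivrMr ?normc_gt0// mul1r.
rewrite ltNge; apply/negP => le.
have y1 : ev L y != 0 by rewrite -normc_gt0; apply: lt_le_trans le; rewrite normc_gt0.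
have t1 := normc_ratio_le1 y1 le.
have [t tE] : exists t, t = - ev L p / ev L y by eexists.
rewrite -tE in t1.
have [q qE] : exists q, q = p + t *: y by eexists.
have qp : herm q p = (hsq p)%:C by rewrite qE hermDl hermZl yp mulr0 addr0 hermE.
have q0 : q != 0.
  by apply: contra_neq PC0 => q0; rewrite -qp q0 /herm pairingC pairing0.
apply: (far q q0); first by rewrite qE pairingD pairingZr tE divfK// subrr.
apply: le_trans vP; apply: point_dist_le => //; rewrite -pE.
have <- : cos2 w p = cos2 v p by rewrite wE cos2Z.
apply: le_cos2 => //; first by rewrite qp wp.
have py : herm p (t *: y) = 0 by apply: herm_orthC; rewrite hermZl yp mulr0.
rewrite wy qE hsqD// hsqD ?(herm_orthC yp)// lerD2l hsqZ.
by rewrite ler_piMl// hsq_ge0.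
Qed.

(** Decompose v = a p + y + u with u normal to L and p the common point of L and L'; the foot is a p
    + y. If |L'(u)| were at least |L'(foot)|, a point of L' in the tube of L would lie outside the
    ball around p, against the condition on two tubes. *)
Lemma tube_half_plane L L' v : L \in A -> L' \in A -> L' != L -> v != 0 -> N_line A eps del L (proj v) ->
  ev L' (foot L v) != 0 /\ 0 < complex.Re (ev L' v / ev L' (foot L v)).
Proof.
case: radii => d0 de _ _ close LA L'A L'L v0 [vL vfar].
have [P [PL PL']] := lines_meet L L'.
have SP : Sing A P by exists L, L'; split=> //; rewrite eq_sym.
have vP := vfar P SP PL; have p0 := coords_neq0 P.
have [p pE] : exists p, p = coords P by eexists.
rewrite -pE in p0.
have Lp : ev L p = 0 by rewrite pE; exact/eqP.
have L'p : ev L' p = 0 by rewrite pE; exact/eqP.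
have [c cE] : exists c, c = ev L v / (hsq (coords L))%:C by eexists.
have [u uE] : exists u, u = c *: conjv L by eexists.
have [f fE] : exists f, f = foot L v by eexists.
have vfu : v = f + u by rewrite fE uE cE /foot subrK.
have uo x : ev L x = 0 -> herm u x = 0.
  by move=> Lx; rewrite uE hermZl (herm_orthC (v := x)) ?mulr0// herm_conjv.
have Lf : ev L f = 0 by rewrite fE ev_foot.
have hL := hsq_gt0 (coords_neq0 L).
have hu : hsq u * hsq (coords L) = normc (ev L v) ^+ 2.
  rewrite uE hsqZ hsq_conjv cE Normc.normcM Normc.normcV normc_real ger0_norm ?ltW//.
  by move: (normc _) (hsq _) (lt0r_neq0 hL) => x y y0; field.
have sv : sin2 v L = hsq u / hsq v.
  rewrite /sin2 -hu; move: (hsq_gt0 v0) hL => /lt0r_neq0 + /lt0r_neq0.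
  by move: (hsq v) (hsq _) (hsq u) => x y z x0 y0; field; rewrite x0 y0.
have vdel : sin2 v L = del ^+ 2 by rewrite -line_dist_sqr// vL.
have hp := hsq_gt0 p0.
have hpC : (hsq p)%:C != 0 by rewrite eq_complex /= eqxx andbT gt_eqF.
have [a aE] : exists a, a = herm f p / (hsq p)%:C by eexists.
have [y yE] : exists y, y = f - a *: p by eexists.
have yp : herm y p = 0 by rewrite yE hermDl hermNl hermZl hermE aE divfK// subrr.
have Ly : ev L y = 0 by rewrite yE pairingB pairingZr Lf Lp mulr0 subrr.
have fy : f = a *: p + y by rewrite yE addrC subrK.
have L'f : ev L' f = ev L' y by rewrite fy pairingD pairingZr L'p mulr0 add0r.
have vp : herm v p = a * (hsq p)%:C.
  by rewrite vfu hermDl (uo p Lp) addr0 fy hermDl hermZl yp addr0 hermE.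
have pu : herm (a *: p) u = 0 by rewrite hermZl (herm_orthC (uo p Lp)) mulr0.
have hau : hsq (a *: p + u) = normc a ^+ 2 * hsq p + hsq u by rewrite hsqD// hsqZ.
have oy : herm (a *: p + u) y = 0.
  by rewrite hermDl hermZl (herm_orthC yp) mulr0 add0r; exact: uo.
have vauy : v = (a *: p + u) + y by rewrite vfu fy addrAC.
have hv : hsq v = normc a ^+ 2 * hsq p + hsq u + hsq y by rewrite vauy hsqD// hau.
have cosv : cos2 v p = normc a ^+ 2 * hsq p / hsq v.
  rewrite /cos2 vp Normc.normcM normc_real ger0_norm ?ltW//.
  move: (hsq_gt0 v0) hp => /lt0r_neq0 + /lt0r_neq0.
  by move: (hsq v) (hsq p) (normc a) => x z b x0 z0; field; rewrite x0 z0.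
rewrite -fE.
(* Otherwise y lies on both lines and is orthogonal to p, so y = 0; then v is at distance del < eps
   from P, against its position outside the ball. *)
have f0 : ev L' f != 0.
  apply/eqP => L'f0; rewrite L'f in L'f0.
  have LL' : L != L' by rewrite eq_sym.
  have [k yk] := meet_unique LL' Ly L'f0 Lp L'p p0.
  have k0 : k = 0.
    by move: yp; rewrite yk hermZl hermE => /eqP; rewrite mulf_eq0 (negPf hpC) orbF => /eqP.
  have y0 : hsq y = 0 by rewrite yk k0 hsqZ Normc.normc0 expr0n mul0r.
  have : point_dist (proj v) P = del.
    rewrite point_distE// -pE cosv -[RHS]ger0_norm ?ltW// -sqrtr_sqr -vdel sv; congr Num.sqrt.
    move: (hsq_gt0 v0) => /lt0r_neq0 n0; rewrite -(divff n0) -mulrBl {1}hv y0 addr0.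
    by rewrite addrAC subrr add0r.
  by move=> e; move: vP; rewrite e leNgt de.
split=> //; have L'v : ev L' v = ev L' f + ev L' u by rewrite vfu pairingD.
rewrite L'v mulrDl divff//; apply: Re_gt0_near1.
rewrite Normc.normcM Normc.normcV ltr_pdivrMr ?normc_gt0// mul1r.
rewrite ltNge; apply/negP => le.
have u1 : ev L' u != 0 by rewrite -normc_gt0; apply: lt_le_trans le; rewrite normc_gt0.
have t1 := normc_ratio_le1 u1 le.
have [t tE] : exists t, t = - ev L' f / ev L' u by eexists.
rewrite -tE in t1.
have t0 : t != 0 by rewrite tE mulf_neq0 ?invr_eq0 ?oppr_eq0.
(* Compared with t v, only y has kept its full length. So q has the components of t v along p and
   normal to L but a norm at least as large: it is no farther from L and no closer to P than v, and
   L'(q) = 0. *)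
have [q qE] : exists q, q = t *: (a *: p + u) + y by eexists.
have L'q : ev L' q = 0.
  by rewrite qE pairingD pairingZr pairingD pairingZr L'p mulr0 add0r -L'f tE divfK// addNr.
have Lu : ev L u = ev L v by rewrite vfu pairingD Lf add0r.
have Lq : ev L q = t * ev L v.
  by rewrite qE pairingD pairingZr pairingD pairingZr Lp mulr0 add0r Ly addr0 Lu.
have hq : hsq q = normc t ^+ 2 * (normc a ^+ 2 * hsq p + hsq u) + hsq y.
  by rewrite qE hsqD ?hsqZ ?hau// hermZl oy mulr0.
have qv : normc t ^+ 2 * hsq v <= hsq q.
  by rewrite hq hv [X in X <= _]mulrDr lerD2l ler_piMl// hsq_ge0.
have tp : 0 < normc t ^+ 2 by rewrite exprn_gt0// normc_gt0.
have q0 : q != 0.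
  apply: contraTneq qv => ->; rewrite -ltNge.
  have -> : hsq (0 : V) = 0 by rewrite -(scale0r (0 : V)) hsqZ Normc.normc0 expr0n mul0r.
  by rewrite mulr_gt0// hsq_gt0.
have qp : herm q p = t * (a * (hsq p)%:C).
  by rewrite qE hermDl yp addr0 hermZl hermDl (uo p Lp) addr0 hermZl hermE.
have tv0 : t *: v != 0 by rewrite scaler_eq0 negb_or t0.
have hq0 := hsq_gt0 q0.
have dq : line_dist (proj q) L <= del.
  have le2 : sin2 q L <= sin2 (t *: v) L.
    rewrite /sin2 Lq pairingZr; apply: ler_wpM2l; first exact: sqr_ge0.
    by rewrite lef_pV2 ?posrE ?(mulr_gt0 hL)// ?(hsq_gt0 tv0)// ler_pM2l// hsqZ.
  rewrite sin2Z// vdel -line_dist_sqr// in le2.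
  by rewrite -(ler_pXn2r (n := 2)) ?nnegrE ?line_dist_ge0 ?(ltW d0).
have dq' : line_dist (proj q) L' <= del.
  by rewrite line_dist_on_line ?ltW// on_line_proj// L'q.
have LL' : L != L' by rewrite eq_sym.
have := close L L' P (proj q) LA L'A LL' PL PL' dq dq'.
apply/negP; rewrite -leNgt; apply: le_trans vP _; apply: point_dist_le => //.
rewrite -pE -(cos2Z t0 v0 p0); apply: le_cos2 => //; last by rewrite hsqZ.
by rewrite hermZl vp qp.
Qed.

End Hermitian.
Lemma continuous_div (R : realType) (T : topologicalType) (f g : T -> R[i]) :
  continuous f -> continuous g -> (forall x, g x != 0) -> continuous (fun x => f x / g x).
Proof. by move=> cf cg g0 x; exact: (ctsM (cf x) (ctsV (g0 x) (cg x))). Qed.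

Lemma continuous_scale (R : realType) (T : topologicalType) (f : T -> R[i]) (c : R[i]) :
  continuous f -> continuous (fun x => f x * c).
Proof. by move=> cf x; exact: (ctsM (cf x) (@cts_cst _ _ c x)). Qed.

(** * Comparison of two embeddings *)

Section WeakEmbedding.
Variable R : realType.
Local Notation C := R[i].
Local Notation normc := Normc.normc.
Local Notation ev L v := (pairing (coords L) v).
Variable A : seq (line R).

(* What remains of a coherent embedding of the graph of an arrangement after
   restriction to a subarrangement [A]: injectivity and the crossing conditions
   are dropped. *)
Record weak_embedding (eps del : R) (pt : CP2 R -> CP2 R) (ln : line R -> CP2 R)
    (arc : CP2 R -> line R -> sing R (CP2 R) 1) : Prop := WeakEmbedding {
  we_radii : regular_radii A eps del;
  we_source : forall P L x, incidence_edge A P L -> edge_param x = 0 -> arc P L x = pt P;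
  we_target : forall P L x, incidence_edge A P L -> edge_param x = 1 -> arc P L x = ln L;
  we_point : forall P L, incidence_edge A P L -> N_point A eps del P (pt P);
  we_line : forall P L, incidence_edge A P L -> N_line A eps del L (ln L);
  we_arc : forall P L x, incidence_edge A P L ->
    N_point A eps del P (arc P L x) \/ N_line A eps del L (arc P L x)
}.

(** The factor makes quotients independent of the representative of p: it rescales [coords p] so
    that its component along P is [coords P]. *)
Definition point_factor (P p : CP2 R) : C := (hsq (coords P))%:C / herm (coords p) (coords P).

Definition point_arg (P : CP2 R) (L : line R) (p : CP2 R) : R :=
  Arg (ev L (coords p) / ev L (coords P) * point_factor P p).

(** The angle by which the displacement of p normal to L turns the value that L' has at the foot on
    L. *)
Definition line_arg (L L' : line R) (p : CP2 R) : R :=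
  Arg (ev L' (coords p) / ev L' (foot L (coords p))).

Variables (eps del : R) (pt : CP2 R -> CP2 R) (ln : line R -> CP2 R).
Variable arc : CP2 R -> line R -> sing R (CP2 R) 1.
Hypothesis we : weak_embedding eps del pt ln arc.

Lemma arc_complement P L x : incidence_edge A P L -> complement A (arc P L x).
Proof.
move=> e; have [SP LA _] := e; have [h|h] := we_arc we x e.
  exact: (N_point_complement (we_radii we) SP h).
exact: (N_line_complement (we_radii we) LA h).
Qed.

Lemma arc_ends P L : incidence_edge A P L -> arc P L (pt1 1) = ln L /\ arc P L (pt1 0) = pt P.
Proof.
move=> e; have [e1 e0] := @edge_param_ends R.
by split; [exact: (we_target we e)|exact: (we_source we e)].
Qed.

Lemma point_half_plane P L p : Sing A P -> L \in A -> ~~ on_line P L -> N_point A eps del P p ->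
  point_factor P p != 0 /\ 0 < complex.Re (ev L (coords p) / ev L (coords P) * point_factor P p).
Proof.
move=> SP LA PL [pP _]; have h := ball_half_plane (we_radii we) SP LA PL (coords_neq0 p).
rewrite proj_coords pP lexx in h; have [h1 h2] := h isT; split=> //.
by rewrite /point_factor mulf_neq0 ?invr_eq0// hsq_coords_neq0.
Qed.

Lemma line_half_plane L L' p : L \in A -> L' \in A -> L' != L -> N_line A eps del L p ->
  ev L' (foot L (coords p)) != 0 /\ 0 < complex.Re (ev L' (coords p) / ev L' (foot L (coords p))).
Proof.
move=> LA L'A LL' Np; apply: (tube_half_plane (we_radii we)) => //; first exact: coords_neq0.
by rewrite proj_coords.
Qed.

Variable L0 : line R.
Hypothesis L0A : L0 \in A.

Lemma aff_ratio L L' p : complement A p -> L \in A -> L' \in A ->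
  aff L0 L p / aff L0 L' p = ev L (coords p) / ev L' (coords p).
Proof.
move=> pA LA L'A; rewrite /aff /chart !pairingZr.
have h0 : ev L0 (coords p) != 0 by exact: pA.
have h : ev L' (coords p) != 0 by exact: pA.
by move: (ev L0 _) (ev L' _) (ev L _) h0 h => x y z x0 y0; field; rewrite x0 y0.
Qed.

(* The functions [L'] and [L''] are proportional on [L], with ratio [beta];
   their ratio elsewhere stays in a half plane around [beta]. *)
Lemma winding_group P L L' L'' Q : incidence_edge A P L -> L' \in A -> L'' \in A ->
  ~~ on_line P L' -> ~~ on_line P L'' -> on_line Q L -> on_line Q L' -> on_line Q L'' ->
  winding L0 L' << arc P L >> - line_arg L L' (ln L) + point_arg P L' (pt P) =
  winding L0 L'' << arc P L >> - line_arg L L'' (ln L) + point_arg P L'' (pt P).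
Proof.
move=> e L'A L''A PL' PL'' QL QL' QL''; have [SP LA PL] := e.
have L'L : L' != L by apply: contraNneq PL' => ->.
have L''L : L'' != L by apply: contraNneq PL'' => ->.
have LP : ev L (coords P) = 0 by apply/eqP.
have [beta betaP] : exists beta : C, forall v, ev L v = 0 -> ev L' v = beta * ev L'' v.
  have LL' : L != L' by rewrite eq_sym.
  exists (ev L' (coords P) / ev L'' (coords P)) => v Lv.
  have := third_line LL' (coords_neq0 Q) (eqP QL) (eqP QL') (eqP QL'') Lv LP.
  by move=> h; apply: (mulIf PL''); rewrite h mulrAC divfK.
have P' : ev L' (coords P) != 0 by [].
have P'' : ev L'' (coords P) != 0 by [].
have b0 : beta != 0 by apply: contraNneq PL' => b0; rewrite /on_line (betaP _ LP) b0 mul0r.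
(* The ratio of L' to L'' divided by its constant value on L. In both pieces it is a quotient of two
   numbers with positive real part, so its principal argument is a lift along the whole arc and
   splits into the angles at the two ends. *)
pose g (p : CP2 R) : C := ev L' (coords p) / ev L'' (coords p) * beta^-1.
have gP p : N_point A eps del P p -> slit (g p) /\ Arg (g p) = point_arg P L' p - point_arg P L'' p.
  move=> Np; have [k0 h'] := point_half_plane SP L'A PL' Np.
  have [_ h''] := point_half_plane SP L''A PL'' Np.
  have pn : ev L'' (coords p) != 0 by exact: (N_point_complement (we_radii we) SP Np).
  rewrite /point_arg -Arg_div//.
  have <- : g p = ev L' (coords p) / ev L' (coords P) * point_factor P p / (ev L'' (coords p) / ev L'' (coords P) * point_factor P p).
    rewrite /g (betaP _ LP); move: k0 P'' pn b0.
    move: (point_factor P p) (ev L'' (coords P)) (ev L'' (coords p)) (ev L' (coords p)) => x y z w x0 y0 z0 b0.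
    by field; rewrite x0 y0 z0 b0.
  split=> //; have := slit_Re_div h' h''.
  rewrite /g (betaP _ LP); move: k0 P'' pn b0.
  move: (point_factor P p) (ev L'' (coords P)) (ev L'' (coords p)) (ev L' (coords p)) => x y z w x0 y0 z0 b0.
  congr (is_true (slit _)); by field; rewrite x0 y0 z0 b0.
have gL p : N_line A eps del L p -> slit (g p) /\ Arg (g p) = line_arg L L' p - line_arg L L'' p.
  move=> Np; have [k' h'] := line_half_plane LA L'A L'L Np.
  have [k'' h''] := line_half_plane LA L''A L''L Np.
  have pn : ev L'' (coords p) != 0 by exact: (N_line_complement (we_radii we) LA Np).
  have E : g p = ev L' (coords p) / ev L' (foot L (coords p)) / (ev L'' (coords p) / ev L'' (foot L (coords p))).
    rewrite /g (betaP _ (ev_foot L (coords p))); move: k'' pn b0.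
    move: (ev L'' (foot _ _)) (ev L'' (coords p)) (ev L' (coords p)) => y z w y0 z0 b0.
    by field; rewrite y0 z0 b0.
  by rewrite E; split; [exact: slit_Re_div|exact: Arg_div].
have ac : continuous (arc P L) by exact: cts_fun.
have aA x : complement A (arc P L x) := arc_complement x e.
have c' : continuous (fun x => aff L0 L' (arc P L x)) := aff_cts L0A ac aA.
have c'' : continuous (fun x => aff L0 L'' (arc P L x)) := aff_cts L0A ac aA.
have n' x := aff_neq0 L0A L'A (aA x); have n'' x := aff_neq0 L0A L''A (aA x).
have : winding L0 L' << arc P L >> - winding L0 L'' << arc P L >> = Arg (g (ln L)) - Arg (g (pt P)).
  rewrite (windingU L0 L') (windingU L0 L'') -(wind_div c' c'' n' n'').
  have b0' : beta^-1 != 0 by rewrite invr_eq0.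
  have cg : continuous (fun x => aff L0 L' (arc P L x) / aff L0 L'' (arc P L x)).
    exact: (continuous_div c' c'' n'').
  have ng x : aff L0 L' (arc P L x) / aff L0 L'' (arc P L x) != 0 by rewrite mulf_neq0 ?invr_eq0.
  have gF : (fun x => aff L0 L' (arc P L x) / aff L0 L'' (arc P L x) * beta^-1) = (fun x => g (arc P L x)).
    by apply/funext => x; rewrite /g (aff_ratio (aA x) L'A L''A).
  have cG := continuous_scale (c := beta^-1) cg; rewrite gF in cG.
  have sl x : slit (g (arc P L x)).
    by have [Nx|Nx] := we_arc we x e; [exact: (gP _ Nx).1|exact: (gL _ Nx).1].
  rewrite -(wind_scale b0' cg ng) gF (wind_slit cG sl).
  by have [E1 E0] := arc_ends e; rewrite E1 E0.
have [_ ->] := gL _ (we_line we e); have [_ ->] := gP _ (we_point we e).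
by move=> h; lra.
Qed.

Lemma expi_winding L' (s : sing R (CP2 R) 1) : L' \in A -> (forall x, complement A (s x)) ->
  expi (winding L0 L' << s >>) = unitc (aff L0 L' (s (pt1 1))) / unitc (aff L0 L' (s (pt1 0))).
Proof.
move=> L'A sA; have sc : continuous s by exact: cts_fun.
have [F hF] := lift_exists (aff_cts (L := L') L0A sc sA) (fun x => aff_neq0 L0A L'A (sA x)).
rewrite windingU (windE hF) expiD expiN.
by have [_ h] := hF; rewrite !h.
Qed.

End WeakEmbedding.
Lemma point_eq_of_lines (R : realType) (L L' : line R) (P Q : CP2 R) : L != L' ->
  on_line P L -> on_line P L' -> on_line Q L -> on_line Q L' -> P = Q.
Proof.
move=> LL' PL PL' QL QL'.
have [c E] := meet_unique LL' (eqP PL) (eqP PL') (eqP QL) (eqP QL') (coords_neq0 Q).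
have c0 : c != 0 by apply: contraTneq (coords_neq0 P) => c0; rewrite E c0 scale0r eqxx.
by rewrite -(proj_coords P) E projZ ?coords_neq0// proj_coords.
Qed.

(** The weight k is constant on each class of [key] and factors out of its sum; the classes are
    removed one at a time by induction. *)
Lemma grouped_sum_eq0 (T K : eqType) (G : zmodType) (s : seq T) (Q : pred T) (key : T -> K)
    (k : T -> int) (f : T -> G) :
  (forall x y, x \in s -> y \in s -> Q x -> Q y -> key x = key y -> k x = k y) ->
  (forall y, y \in s -> Q y -> \sum_(x <- s | Q x && (key x == key y)) f x = 0) ->
  \sum_(x <- s | Q x) f x *~ k x = 0.
Proof.
have [n] := ubnP (count Q s); elim: n Q => // n IH Q nQ kP fP.
have [/hasP[y ys Qy]|] := boolP (has Q s); last first.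
  by move=> /hasPn h; rewrite big_seq_cond big1// => x /andP[/h/negPf ->].
rewrite (bigID (fun x => key x == key y)) /= big_seq_cond.
rewrite (eq_bigr (fun x => f x *~ k y)); last first.
  by move=> x /andP[xs /andP[Qx /eqP e]]; congr (_ *~ _); exact: kP.
rewrite -big_seq_cond -mulrz_suml fP// mul0rz add0r; apply: IH.
- rewrite ltnS in nQ; apply: leq_trans nQ; apply: (@count_lt _ _ _ _ y) => //.
    by move=> x /andP[].
  by rewrite eqxx andbF.
- by move=> x z xs zs /andP[Qx _] /andP[Qz _]; exact: kP.
- move=> z zs /andP[Qz zy]; rewrite -[RHS](fP z zs Qz); apply: eq_bigl => x.
  by have [->|] := eqVneq (key x) (key z); rewrite ?andbF// zy !andbT.
Qed.

Lemma shift_arith (R : realFieldType) (a b c d la lb lc ld pa pb pc pd x y u v : R) :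
  a - la + pa = b - lb + pb -> c - lc + pc = d - ld + pd ->
  a - c - (la - lc + x - u) + (pa - pc + y - v) = b - d - (lb - ld + x - u) + (pb - pd + y - v).
Proof. by move=> h h'; lra. Qed.

Section Comparison.
Variable R : realType.
Local Notation C := R[i].
Local Notation ev L v := (pairing (coords L) v).
Variable A : seq (line R).
Variable L0 : line R.
Hypothesis L0A : L0 \in A.
Variables (eps del eps' del' : R) (pt pt' : CP2 R -> CP2 R) (ln ln' : line R -> CP2 R).
Variable arc arc' : CP2 R -> line R -> sing R (CP2 R) 1.
Hypothesis we : weak_embedding A eps del pt ln arc.
Hypothesis we' : weak_embedding A eps' del' pt' ln' arc'.

(* The vertex corrections are angles between the images of a vertex under the two
   embeddings; they are chosen so that the resulting integers depend on [L'] only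
   through its intersection with [L]. *)
Definition point_lift (P : CP2 R) (L' : line R) : R :=
  if on_line P L' then Arg (ev L' (coords (pt P)) / ev L' (coords (pt' P)))
  else point_arg P L' (pt P) - point_arg P L' (pt' P)
    + Arg (point_factor P (pt' P) / point_factor P (pt P)).

Definition line_lift (L L' : line R) : R :=
  if L' == L then Arg (ev L' (coords (ln L)) / ev L' (coords (ln' L)))
  else line_arg L L' (ln L) - line_arg L L' (ln' L)
    + Arg (ev L' (foot L (coords (ln L))) / ev L' (foot L (coords (ln' L)))).

(** The windings are those of L' / L0, so each vertex correction is likewise a difference between L'
    and L0. The line end is the target of the edge and the point end its source, whence the opposite
    signs. *)
Definition shift (P : CP2 R) (L L' : line R) : R :=
  winding L0 L' << arc P L >> - winding L0 L' << arc' P L >>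
    - (line_lift L L' - line_lift L L0) + (point_lift P L' - point_lift P L0).

Lemma unitc_neq0 (z : C) : z != 0 -> unitc z != 0.
Proof. by move=> z0; rewrite -expi_Arg// expi_neq0. Qed.

Lemma expi_point_lift P L L' : incidence_edge A P L -> L' \in A ->
  expi (point_lift P L') = unitc (ev L' (coords (pt P))) / unitc (ev L' (coords (pt' P))).
Proof.
move=> e L'A; have [SP LA PL] := e.
have p0 : ev L' (coords (pt P)) != 0 := N_point_complement (we_radii we) SP (we_point we e) L'A.
have p0' : ev L' (coords (pt' P)) != 0 := N_point_complement (we_radii we') SP (we_point we' e) L'A.
rewrite -unitcV -unitcM /point_lift; case: ifPn => [_|PL'].
  by rewrite expi_Arg// mulf_neq0 ?invr_eq0.
have [k0 h] := point_half_plane we SP L'A PL' (we_point we e).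
have [k0' h'] := point_half_plane we' SP L'A PL' (we_point we' e).
have P0 : ev L' (coords P) != 0 by [].
have n1 : ev L' (coords (pt P)) / ev L' (coords P) * point_factor P (pt P) != 0 := mulf_neq0 (mulf_neq0 p0 (invr_neq0 P0)) k0.
have n2 : ev L' (coords (pt' P)) / ev L' (coords P) * point_factor P (pt' P) != 0 := mulf_neq0 (mulf_neq0 p0' (invr_neq0 P0)) k0'.
have n3 : point_factor P (pt' P) / point_factor P (pt P) != 0 := mulf_neq0 k0' (invr_neq0 k0).
rewrite 2!expiD expiN /point_arg (expi_Arg n1) (expi_Arg n2) (expi_Arg n3).
rewrite -unitcV -!unitcM; congr unitc.
move: k0 k0' P0 p0'; move: (point_factor _ _) (point_factor _ _) (ev L' _) (ev L' _) (ev L' _) => a b c d f a0 b0 d0 f0.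
by field; rewrite ?a0 ?b0 ?d0 ?f0.
Qed.

Lemma expi_line_lift P L L' : incidence_edge A P L -> L' \in A ->
  expi (line_lift L L') = unitc (ev L' (coords (ln L))) / unitc (ev L' (coords (ln' L))).
Proof.
move=> e L'A; have [SP LA PL] := e.
have p0 : ev L' (coords (ln L)) != 0 := N_line_complement (we_radii we) LA (we_line we e) L'A.
have p0' : ev L' (coords (ln' L)) != 0 := N_line_complement (we_radii we') LA (we_line we' e) L'A.
rewrite -unitcV -unitcM /line_lift; case: ifPn => [_|L'L].
  by rewrite expi_Arg// mulf_neq0 ?invr_eq0.
have [k0 h] := line_half_plane we LA L'A L'L (we_line we e).
have [k0' h'] := line_half_plane we' LA L'A L'L (we_line we' e).
move: p0 p0' k0 k0'; rewrite /line_arg.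
move: (ev L' _) (ev L' _) (ev L' _) (ev L' _) => a b c d a0 b0 c0 d0.
rewrite 2!expiD expiN (expi_Arg (mulf_neq0 a0 (invr_neq0 c0))) (expi_Arg (mulf_neq0 b0 (invr_neq0 d0))).
rewrite (expi_Arg (mulf_neq0 c0 (invr_neq0 d0))) -!unitcV -!unitcM; congr unitc.
by field; rewrite ?a0 ?b0 ?c0 ?d0.
Qed.

(** The exponential of a winding is the quotient of the unit values of L' / L0 at the ends, and the
    corrections have as exponentials the quotients between the two embeddings at these ends; the
    product is 1. *)
Lemma shift_integral P L L' : incidence_edge A P L -> L' \in A ->
  exists k : int, shift P L L' = 2 * pi * k%:~R.
Proof.
move=> e L'A; apply: expi_eq1; have [SP LA PL] := e.
have [E1 E0] := arc_ends we e; have [E1' E0'] := arc_ends we' e.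
have aA x := arc_complement we x e; have aA' x := arc_complement we' x e.
have nz L1 p : L1 \in A -> complement A p -> unitc (ev L1 (coords p)) != 0.
  by move=> L1A pA; apply: unitc_neq0; exact: pA.
have lnA : complement A (ln L) by rewrite -E1; exact: aA.
have ptA : complement A (pt P) by rewrite -E0; exact: aA.
have lnA' : complement A (ln' L) by rewrite -E1'; exact: aA'.
have ptA' : complement A (pt' P) by rewrite -E0'; exact: aA'.
have affE p : unitc (aff L0 L' p) = unitc (ev L' (coords p)) / unitc (ev L0 (coords p)).
  by rewrite /aff /chart pairingZr unitcM unitcV mulrC.
have w := expi_winding L0A L'A aA; rewrite E1 E0 (affE (ln L)) (affE (pt P)) in w.
have w' := expi_winding L0A L'A aA'; rewrite E1' E0' (affE (ln' L)) (affE (pt' P)) in w'.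
rewrite /shift !(expiD, expiN, opprB) w w'.
rewrite !(expi_point_lift e)// !(expi_line_lift e)//.
move: (nz _ _ L'A lnA) (nz _ _ L'A ptA) (nz _ _ L'A lnA') (nz _ _ L'A ptA').
move: (nz _ _ L0A lnA) (nz _ _ L0A ptA) (nz _ _ L0A lnA') (nz _ _ L0A ptA').
move: (unitc _) (unitc _) (unitc _) (unitc _) (unitc _) (unitc _) (unitc _) (unitc _).
move=> a b c d a' b' c' d' *; field.
by repeat (apply/andP; split).
Qed.

Lemma shift_L0 P L : incidence_edge A P L -> shift P L L0 = 0.
Proof.
move=> e; rewrite /shift !subrr subr0 addr0.
have w0 (s : sing R (CP2 R) 1) : (forall x, complement A (s x)) -> winding L0 L0 << s >> = 0.
  move=> sA; rewrite windingU.
  have -> : (fun x => aff L0 L0 (s x)) = (fun=> 1) by apply/funext => x; apply: chart1; exact: sA.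
  have c1 : continuous (fun _ : std_simplex R 1 => 1 : C) by move=> x; exact: cts_cst.
  by rewrite (wind_slit c1) ?subrr// => x; rewrite /slit /= ltr01 orbT.
by rewrite !w0 ?subrr// => x; [exact: (arc_complement we' x e)|exact: (arc_complement we x e)].
Qed.

(** By [winding_group] each embedding contributes a quantity depending only on Q. The remaining
    terms agree too: the argument of the point factors does not involve L', and L' and L'' are
    proportional on L, where the feet lie. *)
Lemma shift_group P L L' L'' Q : incidence_edge A P L -> L' \in A -> L'' \in A ->
  ~~ on_line P L' -> ~~ on_line P L'' -> on_line Q L -> on_line Q L' -> on_line Q L'' ->
  shift P L L' = shift P L L''.
Proof.
move=> e L'A L''A PL' PL'' QL QL' QL''; have [SP LA PL] := e.
have L'L : L' != L by apply: contraNneq PL' => ->.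
have L''L : L'' != L by apply: contraNneq PL'' => ->.
have h := winding_group we L0A e L'A L''A PL' PL'' QL QL' QL''.
have h' := winding_group we' L0A e L'A L''A PL' PL'' QL QL' QL''.
have hf : ev L' (foot L (coords (ln L))) / ev L' (foot L (coords (ln' L))) =
    ev L'' (foot L (coords (ln L))) / ev L'' (foot L (coords (ln' L))).
  have [k0 _] := line_half_plane we' LA L'A L'L (we_line we' e).
  have [k0' _] := line_half_plane we' LA L''A L''L (we_line we' e).
  have LL' : L != L' by rewrite eq_sym.
  have := third_line LL' (coords_neq0 Q) (eqP QL) (eqP QL') (eqP QL'') (ev_foot L (coords (ln L))) (ev_foot L (coords (ln' L))).
  move=> E; apply/eqP; rewrite (eqr_div _ _ k0 k0') E; apply/eqP; exact: mulrC.
rewrite /shift /line_lift /point_lift (negPf PL') (negPf PL'') (negPf L'L) (negPf L''L) hf.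
exact: shift_arith h h'.
Qed.

End Comparison.
(** * Tensor products *)

Section HomLemmas.
Variables U W : zmodType.

Lemma homB (f g : hom U W) u : (f - g) u = f u - g u.
Proof. by have -> : hom_fun (f - g) = hom_fun f - hom_fun g by exact: (raddfB (\val : hom U W -> (U -> W))). Qed.

Lemma hom_eval_morphism u : zmod_morphism (fun f : hom U W => f u).
Proof. by move=> f g; exact: homB. Qed.

Lemma hom_eval_mulz (f : hom U W) u (k : int) : (f *~ k) u = f u *~ k.
Proof.
pose e : {additive hom U W -> W} := HB.pack (fun f : hom U W => f u) (GRing.isZmodMorphism.Build _ _ _ (hom_eval_morphism u)).
exact: (raddfMz e).
Qed.

Lemma hom_mulz (f : hom U W) u (k : int) : f (u *~ k) = f u *~ k.
Proof.
pose e : {additive U -> W} := HB.pack (hom_fun f) (GRing.isZmodMorphism.Build _ _ _ (hom_is_zmod_morphism f)).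
exact: (raddfMz e).
Qed.

Lemma hom_sum (f : hom U W) (I : Type) (s : seq I) (P : pred I) (F : I -> U) :
  f (\sum_(i <- s | P i) F i) = \sum_(i <- s | P i) f (F i).
Proof.
pose e : {additive U -> W} := HB.pack (hom_fun f) (GRing.isZmodMorphism.Build _ _ _ (hom_is_zmod_morphism f)).
exact: (raddf_sum e).
Qed.

End HomLemmas.

Section TensorLemmas.
Variables U V W : zmodType.

Lemma tensor_pi_morphism : zmod_morphism \pi_(tensor U V).
Proof. by move=> x y; exact: (raddfB \pi_(tensor U V)). Qed.

(** Every tensor is the class of an integral combination of pairs, so additive maps are determined
    by the pure tensors. *)
Lemma tensor_ext (h h' : tensor U V -> W) : zmod_morphism h -> zmod_morphism h' ->
  (forall u v, h (tensor_pure u v) = h' (tensor_pure u v)) -> h =1 h'.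
Proof.
move=> hB h'B E t; rewrite -[t]reprK.
apply: (@freeg_morphism_eq _ _ (fun z => h (\pi z)) (fun z => h' (\pi z))).
- by move=> x y /=; rewrite tensor_pi_morphism hB.
- by move=> x y /=; rewrite tensor_pi_morphism h'B.
by move=> [u v] _; exact: E.
Qed.

End TensorLemmas.

Lemma tensor_pure_morphism_l (U V : zmodType) (v : V) : zmod_morphism (fun u : U => tensor_pure u v).
Proof.
move=> u u'; rewrite /tensor_pure -tensor_pi_morphism; apply/eqP; rewrite -Quotient.idealrBE.
(* The bilinear relation for the sum of u - u' and u' is additivity in subtractive form, up to
   sign. *)
apply/asboolP => S [S0 SB] rel; have := rel _ (or_introl (ex_intro _ (u - u') (ex_intro _ u' (ex_intro _ v erefl)))).
rewrite subrK => h; have := SB _ _ S0 h; rewrite sub0r; congr (_ \in S).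
by move: << (u, v) >> << (u - u', v) >> << (u', v) >> => x y z; freeg_ring.
Qed.

Lemma tensor_pure_morphism_r (U V : zmodType) (u : U) : zmod_morphism (@tensor_pure U V u).
Proof.
move=> v v'; rewrite /tensor_pure -tensor_pi_morphism; apply/eqP; rewrite -Quotient.idealrBE.
apply/asboolP => S [S0 SB] rel; have := rel _ (or_intror (ex_intro _ u (ex_intro _ (v - v') (ex_intro _ v' erefl)))).
rewrite subrK => h; have := SB _ _ S0 h; rewrite sub0r; congr (_ \in S).
by move: << (u, v) >> << (u, v - v') >> << (u, v') >> => x y z; freeg_ring.
Qed.

Section TensorMap.
Variables (U V U' V' W : zmodType) (f : U -> U') (g : V -> V').
Hypothesis fB : zmod_morphism f.
Hypothesis gB : zmod_morphism g.

Lemma tensor_map_morphism : zmod_morphism (tensor_map f g).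
Proof.
apply: tensor_lift_is_zmod_morphism => [v|u] x y /=.
  by rewrite fB tensor_pure_morphism_l.
by rewrite gB tensor_pure_morphism_r.
Qed.

Lemma tensor_map_pure u v : tensor_map f g (tensor_pure u v) = tensor_pure (f u) (g v).
Proof.
apply: tensor_lift_pure => [v'|u'] x y /=.
  by rewrite fB tensor_pure_morphism_l.
by rewrite gB tensor_pure_morphism_r.
Qed.

Lemma tensor_lift_map (b : U' -> V' -> W) t :
  (forall v, zmod_morphism (b^~ v)) -> (forall u, zmod_morphism (b u)) ->
  tensor_lift b (tensor_map f g t) = tensor_lift (fun u v => b (f u) (g v)) t.
Proof.
move=> bl br.
have bl' v : zmod_morphism (fun u => b (f u) (g v)) by move=> x y; rewrite fB; exact: (bl _).
have br' u : zmod_morphism (fun v => b (f u) (g v)) by move=> x y; rewrite gB; exact: (br _).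
apply: (tensor_ext (h := fun t => tensor_lift b (tensor_map f g t))).
- by move=> x y; rewrite tensor_map_morphism tensor_lift_is_zmod_morphism.
- exact: tensor_lift_is_zmod_morphism.
by move=> u v; rewrite tensor_map_pure !tensor_lift_pure.
Qed.

End TensorMap.

(** * The difference of the two images of a graph cycle *)

Section Difference.
Variable R : realType.
Variable A : seq (line R).
Hypothesis Auniq : uniq A.
Variable L0 : line R.
Hypothesis L0A : L0 \in A.
Variables (eps del eps' del' : R) (pt pt' : CP2 R -> CP2 R) (ln ln' : line R -> CP2 R).
Variable arc arc' : CP2 R -> line R -> sing R (CP2 R) 1.
Hypothesis we : weak_embedding A eps del pt ln arc.
Hypothesis we' : weak_embedding A eps' del' pt' ln' arc'.
Local Notation edge_type := (CP2 R * line R)%type.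
Local Notation chain1 := (chain R (CP2 R) 1).
Local Notation shift := (shift L0 pt pt' ln ln' arc arc').

Definition image_chain (a : CP2 R -> line R -> sing R (CP2 R) 1) (c : {freeg edge_type}) : chain1 :=
  fglift (fun e => << a e.1 e.2 >>) c.

Lemma image_chain_morphism a : zmod_morphism (image_chain a).
Proof. exact: lift_is_additive. Qed.

Lemma image_chainU a e : image_chain a << e >> = << a e.1 e.2 >>.
Proof. by rewrite /image_chain liftU scale1r. Qed.

(* The vertex corrections add up to zero along a cycle. *)
Lemma winding_shift (c : graphH1 A) (E : seq edge_type) L' : uniq E -> {subset dom (graph_cycle c) <= E} ->
  winding L0 L' (image_chain arc (graph_cycle c)) - winding L0 L' (image_chain arc' (graph_cycle c)) =
  \sum_(e <- E) shift e.1 e.2 L' * (coeff e (graph_cycle c))%:~R.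
Proof.
move=> Eu cE; have [cA c0] : (forall e, e \in dom (graph_cycle c) -> incidence_edge A e.1 e.2) /\ graph_boundary (graph_cycle c) = 0.
  by case: c {cE} => c /= /asboolP.
pose pot (v : CP2 R + line R) : R := match v with
  | inl P => point_lift pt pt' P L' - point_lift pt pt' P L0
  | inr L => line_lift ln ln' L L' - line_lift ln ln' L L0 end.
(* The corrections as an additive function of 0-chains. It vanishes on the boundary of the cycle, so
   it can be subtracted first, and the identity then holds edge by edge. *)
have [Pot [PotM PotU]] : exists Pot : {freeg (CP2 R + line R)} -> R, zmod_morphism Pot /\
    forall v, Pot << v >> = pot v.
  pose F : {freeg (CP2 R + line R)} -> zmodule R := fglift (fun v => pot v : zmodule R).
  have FB : zmod_morphism F by exact: lift_is_additive.
  exists F; split; first exact: FB.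
  by move=> v; rewrite /F liftU scale1r.
have Pot0 : Pot 0 = 0 by rewrite -(subrr 0) PotM subrr.
rewrite -[LHS]subr0 -[in LHS]Pot0 -[in LHS]c0.
apply: (@freeg_morphism_eq _ _ (fun c => winding L0 L' (image_chain arc c) - winding L0 L' (image_chain arc' c) - Pot (graph_boundary c))
  (fun c => \sum_(e <- E) shift e.1 e.2 L' * (coeff e c)%:~R)).
- move=> x y; rewrite !image_chain_morphism !windingB graph_boundary_is_zmod_morphism PotM.
  move: (winding _ _ _) (winding _ _ _) (winding _ _ _) (winding _ _ _) (Pot _) (Pot _) => a b d e f g.
  by ring.
- move=> x y; rewrite -sumrB; apply: eq_bigr => e _.
  by rewrite coeffB rmorphB mulrBr.
move=> [P L] eE; rewrite !image_chainU (bigD1_seq (P, L)) ?cE//= big1 => [|e ne]; last first.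
  by rewrite coeffU mul1r eq_sym (negPf ne) mulr0.
rewrite coeffU mul1r eqxx mulr1 addr0 /graph_boundary liftU scale1r PotM !PotU /shift /=.
by rewrite opprB -[RHS]addrA; congr (_ + _); exact: addrC.
Qed.

Definition shift_index (P : CP2 R) (L L' : line R) : int :=
  xget 0 [set k : int | shift P L L' = 2 * pi * k%:~R].

Lemma shift_indexE P L L' : incidence_edge A P L -> L' \in A ->
  shift P L L' = 2 * pi * (shift_index P L L')%:~R.
Proof.
move=> e L'A; have [k kE] := shift_integral L0A we we' e L'A.
by apply: (@xgetPex _ 0 [set k : int | shift P L L' = 2 * pi * k%:~R]); exists k.
Qed.

Lemma two_pi_inj (k k' : int) : 2 * pi * k%:~R = 2 * pi * k'%:~R :> R -> k = k'.
Proof.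
have p0 : 2 * pi != 0 :> R by rewrite mulf_neq0 ?pnatr_eq0// gt_eqF// pi_gt0.
by move=> /(mulfI p0)/intr_inj.
Qed.

(** Both classes are written in meridians with windings as coefficients, and [winding_shift]
    compares these. The term of L0 may be included since its shift is 0. E may exceed the support of
    c, so that one set of edges serves several cycles. *)
Lemma class_difference (c : graphH1 A) (E : seq edge_type) (z z' : cycle1 R (complement A)) :
  uniq E -> (forall e, e \in E -> incidence_edge A e.1 e.2) -> {subset dom (graph_cycle c) <= E} ->
  cycle_val z = image_chain arc (graph_cycle c) -> cycle_val z' = image_chain arc' (graph_cycle c) ->
  homology_class z - homology_class z' =
  \sum_(e <- E) \sum_(L' <- A) meridian A L' *~ shift_index e.1 e.2 L' *~ coeff e (graph_cycle c).
Proof.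
move=> Eu Ei cE zE zE'.
have [k [-> kP]] := homology_structure L0A Auniq z.
have [k' [-> kP']] := homology_structure L0A Auniq z'.
rewrite exchange_big /= -sumrB [RHS](bigD1_seq L0)//=.
rewrite [X in _ = X + _]big_seq [X in _ = X + _]big1 ?add0r => [|e eE]; last first.
  have := shift_indexE (Ei e eE) L0A; rewrite (shift_L0 L0A we we' (Ei e eE)) => h.
  have -> : shift_index e.1 e.2 L0 = 0 by apply: two_pi_inj; rewrite -h mulr0.
  by rewrite mulr0z mul0rz.
rewrite big_seq_cond [RHS]big_seq_cond; apply: eq_bigr => L' /andP[L'A L'L0].
under eq_bigr do rewrite -mulrzA.
rewrite -mulrzBr -mulrz_sumr; congr (_ *~ _); apply: two_pi_inj.
rewrite rmorphB mulrBr -kP// -kP'// zE zE' (winding_shift L' Eu cE).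
rewrite rmorph_sum mulr_sumr big_seq [RHS]big_seq; apply: eq_bigr => e eE.
by rewrite (shift_indexE (Ei e eE) L'A) rmorphM mulrA.
Qed.

Variable G : zmodType.

(** Lines through P contribute 0 by (I). The others are grouped by their intersection Q with L, on
    which the index depends; the sum over a group is the sum over all lines through Q, since by (I)
    those through P add nothing, and (II) makes it 0. *)
Lemma TLG_shift (Lam : tensor_chains A G) P L : TLG Lam -> incidence_edge A P L ->
  \sum_(L' <- A) edge_coeff P L Lam (meridian A L') *~ shift_index P L L' = 0.
Proof.
move=> tlg e; have [SP LA PL] := e; have [I II] := tlg P L e.
rewrite (bigID (on_line P)) /= big_seq_cond big1 ?add0r => [|L' /andP[L'A PL']]; last first.
  by rewrite I// mul0rz.
have /choice[meet meetP] : forall L' : line R, exists Q : CP2 R, on_line Q L /\ on_line Q L' := lines_meet L.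
apply: (@grouped_sum_eq0 _ _ _ _ _ meet).
  move=> L' L'' L'A L''A PL' PL'' E; apply: two_pi_inj; rewrite -!shift_indexE//.
  apply: (shift_group L0A we we' e L'A L''A PL' PL'' (Q := meet L')); try exact: (meetP L').1; try exact: (meetP L').2.
  by rewrite E; exact: (meetP L'').2.
move=> L' L'A PL'; have [QL QL'] := meetP L'.
have L'L : L' != L by apply: contraNneq PL' => ->.
have SQ : Sing A (meet L') by exists L', L; split.
have := II _ SQ QL; rewrite (bigID (on_line P)) /= big_seq_cond big1 ?add0r => [|x]; last first.
  by move=> /andP[xA /andP[_ Px]]; exact: I.
move=> S; rewrite -[RHS]S; apply: eq_bigl => x.
have [Px|Px] := boolP (on_line P x); first by rewrite andbF.
(* A line x that misses P differs from L, so it passes through the given point of L exactly when it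
   meets L there. *)
rewrite andbT /=; have [xL xx] := meetP x; apply/eqP/idP => [<-//|Qx].
have Lx : L != x by apply: contraNneq Px => <-.
exact: (point_eq_of_lines Lx).
Qed.

End Difference.
(** * Independence of the embedding *)

Section Independence.
Variable R : realType.
Variables (A : seq (line R)) (G : zmodType).
Hypothesis Auniq : uniq A.
Variable L0 : line R.
Hypothesis L0A : L0 \in A.

Lemma edge_coeff_bl (e : CP2 R * line R) (c : graphH1 A) :
  zmod_morphism (fun l : coH1 R (complement A) G => l *~ coeff e (graph_cycle c)).
Proof. by move=> l l'; exact: mulrzBl. Qed.

Lemma edge_coeff_br (e : CP2 R * line R) (l : coH1 R (complement A) G) :
  zmod_morphism (fun c : graphH1 A => l *~ coeff e (graph_cycle c)).
Proof.
by move=> c c'; rewrite -mulrzBr -coeffB; congr (_ *~ coeff e _).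
Qed.

Lemma edge_coeff_pure e (l : coH1 R (complement A) G) (c : graphH1 A) :
  edge_coeff e.1 e.2 (tensor_pure l c) = l *~ coeff e (graph_cycle c).
Proof.
case: e => P L; apply: (tensor_lift_pure (b := fun (l : coH1 R (complement A) G) (c : graphH1 A) => l *~ coeff (P, L) (graph_cycle c))).
  by move=> v; exact: edge_coeff_bl.
by move=> u; exact: edge_coeff_br.
Qed.

Lemma edge_coeff_morphism P L : zmod_morphism (@edge_coeff R A G P L).
Proof.
apply: tensor_lift_is_zmod_morphism; first by move=> v; exact: edge_coeff_bl.
by move=> u; exact: edge_coeff_br.
Qed.

Section Class.
Variables (arc : CP2 R -> line R -> sing R (CP2 R) 1) (F : graphH1 A -> cycle1 R (complement A)).
Hypothesis FE : forall c, cycle_val (F c) = image_chain arc (graph_cycle c).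

Lemma class_morphism : zmod_morphism (fun c => homology_class (F c)).
Proof.
move=> c c'; rewrite /homology_class -(raddfB \pi_(H1 R (complement A))); congr (\pi _).
apply: val_inj; change (cycle_val (F (c - c')) = cycle_val (F c) - cycle_val (F c')).
by rewrite !FE -image_chain_morphism.
Qed.

Definition class_eval (l : coH1 R (complement A) G) (c : graphH1 A) : G := l (homology_class (F c)).

Lemma class_eval_l c : zmod_morphism (class_eval^~ c).
Proof. by move=> l l'; exact: homB. Qed.

Lemma class_eval_r l : zmod_morphism (class_eval l).
Proof. by move=> c c'; rewrite /class_eval class_morphism hom_is_zmod_morphism. Qed.

End Class.

Variables (eps del eps' del' : R) (pt pt' : CP2 R -> CP2 R) (ln ln' : line R -> CP2 R).
Variable arc arc' : CP2 R -> line R -> sing R (CP2 R) 1.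
Hypothesis we : weak_embedding A eps del pt ln arc.
Hypothesis we' : weak_embedding A eps' del' pt' ln' arc'.
Variables F F' : graphH1 A -> cycle1 R (complement A).
Hypothesis FE : forall c, cycle_val (F c) = image_chain arc (graph_cycle c).
Hypothesis FE' : forall c, cycle_val (F' c) = image_chain arc' (graph_cycle c).

(** Conditions (I) and (II) concern the edge coefficients of [Lam], not the pure tensors of a
    representative. The difference is computed on pure tensors, reassembled into edge coefficients
    by additivity, and then vanishes edge by edge. *)
Lemma class_eval_independent (Lam : tensor_chains A G) : TLG Lam ->
  tensor_lift (class_eval F) Lam = tensor_lift (class_eval F') Lam.
Proof.
(* All edges of all cycles in a representative of [Lam]: a finite set independent of the pure tensor
   considered. *)
move=> tlg; pose E := undup (flatten [seq dom (graph_cycle x.2) | x <- dom (repr Lam)]).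
have Ei e : e \in E -> incidence_edge A e.1 e.2.
  rewrite mem_undup => /flatten_mapP[[l [c cc]] _ /= ec].
  by have /asboolP[cA _] := cc; exact: cA.
have liftB := tensor_lift_is_zmod_morphism (class_eval_l F) (class_eval_r FE).
have liftB' := tensor_lift_is_zmod_morphism (class_eval_l F') (class_eval_r FE').
pose idx e L' := shift_index L0 pt pt' ln ln' arc arc' e.1 e.2 L'.
pose rhs (t : tensor_chains A G) := \sum_(e <- E) \sum_(L' <- A) edge_coeff e.1 e.2 t (meridian A L') *~ idx e L'.
have rhsB : zmod_morphism rhs.
  move=> x y; rewrite /rhs -sumrB; apply: eq_bigr => e _; rewrite -sumrB; apply: eq_bigr => L' _.
  by rewrite edge_coeff_morphism homB mulrzBl.
have : tensor_lift (class_eval F) Lam - tensor_lift (class_eval F') Lam = rhs Lam.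
  rewrite -[Lam]reprK.
  apply: (@freeg_morphism_eq _ _ (fun z => tensor_lift (class_eval F) (\pi z) - tensor_lift (class_eval F') (\pi z))
    (fun z => rhs (\pi z))).
  - move=> x y; rewrite tensor_pi_morphism liftB liftB' !opprB addrACA [RHS]addrACA.
    by congr (_ + _); rewrite addrC.
  - by move=> x y; rewrite tensor_pi_morphism rhsB.
  move=> [l c] lc; rewrite -![\pi_(tensor _ _) _]/(tensor_pure l c).
  rewrite !tensor_lift_pure; [|exact: class_eval_l|exact: class_eval_r FE'|exact: class_eval_l|exact: class_eval_r FE].
  have cE : {subset dom (graph_cycle c) <= E}.
    by move=> e ec; rewrite mem_undup; apply/flatten_mapP; exists (l, c).
  rewrite /class_eval -hom_is_zmod_morphism.
  rewrite (class_difference Auniq L0A we we' (undup_uniq _) Ei cE (FE c) (FE' c)).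
  rewrite hom_sum; apply: eq_bigr => e _; rewrite hom_sum; apply: eq_bigr => L' _.
  by rewrite edge_coeff_pure hom_eval_mulz !hom_mulz -!mulrzA mulrC.
rewrite /rhs big_seq big1 => [/eqP|e eE]; first by rewrite subr_eq0 => /eqP.
exact: (TLG_shift L0A we we' tlg (Ei e eE)).
Qed.

End Independence.

(** * Restriction of an embedding to a subarrangement *)

Section Restriction.
Variable R : realType.
Variables A B : seq (line R).
Hypothesis AB : {subset A <= B}.

Lemma Sing_sub P : Sing A P -> Sing B P.
Proof. by move=> [L [L' [LA L'A LL' PL PL']]]; exists L, L'; split=> //; exact: AB. Qed.

Lemma N_point_sub eps del P : N_point B eps del P `<=` N_point A eps del P.
Proof. by move=> p [pP h]; split=> // L LA; apply: h; exact: AB. Qed.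

Lemma N_line_sub eps del L : N_line B eps del L `<=` N_line A eps del L.
Proof. by move=> p [pL h]; split=> // P SP; apply: h; exact: Sing_sub. Qed.

Lemma regular_radii_sub eps del : regular_radii B eps del -> regular_radii A eps del.
Proof.
move=> [d0 de h1 h2 h3]; split=> //.
- by move=> P Q p SP SQ; apply: h1; exact: Sing_sub.
- by move=> P L p SP LA; apply: h2; [exact: Sing_sub|exact: AB].
- by move=> L L' P p LA L'A; apply: h3; exact: AB.
Qed.

(** A smaller arrangement has fewer lines to avoid and fewer singular points, so its radii
    conditions are weaker and its pieces [N_point] and [N_line] larger. *)
Lemma restricted_embedding (phi : coherent_embedding B) :
  weak_embedding A (ce_eps phi) (ce_del phi) (ce_point phi) (ce_line phi) (ce_arc phi).
Proof.
have sub := incidence_edge_sub AB; have [e1 e0] := @edge_param_ends R.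
split.
- exact: regular_radii_sub (ce_radii phi).
- by move=> P L x /sub; exact: ce_source.
- by move=> P L x /sub; exact: ce_target.
- move=> P L /sub e; have [t [t0 t1 h _ _]] := ce_crossing phi e.
  by apply: N_point_sub; rewrite -(ce_source phi e e0); apply: h; rewrite e0 ltW.
- move=> P L /sub e; have [t [t0 t1 _ h _]] := ce_crossing phi e.
  by apply: N_line_sub; rewrite -(ce_target phi e e1); apply: h; rewrite e1 ltW.
- move=> P L x /sub e; have [t [_ _ h h' _]] := ce_crossing phi e.
  have [xt|tx] := leP (edge_param x) t.
    by left; apply: N_point_sub; exact: h.
  by right; apply: N_line_sub; apply: h'; exact: ltW.
Qed.

(** [H1_incl] uses a chosen representative; it differs from z by a boundary in the complement of B,
    which is also one in the complement of A. *)
Lemma H1_incl_class (BA : complement B `<=` complement A) (z : cycle1 R (complement B)) :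
  H1_incl BA (homology_class z) = homology_class (Cycle1 (is_cycle_sub z BA)).
Proof.
apply: homology_class_eq.
have : repr (homology_class z) - z \in @is_boundary R (CP2 R) (complement B).
  by rewrite Quotient.idealrBE reprK.
move=> /asboolP[b [bB bz]]; exists b; split; first exact: chain_in_sub bB.
exact: bz.
Qed.

Variable G : zmodType.

Definition restricted_cycle (phi : coherent_embedding B) (c : graphH1 A) : cycle1 R (complement A) :=
  Cycle1 (is_cycle_sub (Cycle1 (embed_chain_is_cycle phi (graphH1_incl AB c))) (complement_sub AB)).

Lemma restricted_cycleE phi c : cycle_val (restricted_cycle phi c) = image_chain (ce_arc phi) (graph_cycle c).
Proof. by []. Qed.

(** Naturality of the evaluation: a restricted cohomology class takes on the image of a cycle the
    value of the original class on that image viewed in the larger complement. *)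
Lemma loop_linking_incl (phi : coherent_embedding B) (Lam : tensor_chains A G) :
  loop_linking phi (tensor_incl AB Lam) = tensor_lift (class_eval (restricted_cycle phi)) Lam.
Proof.
have evalB h : zmod_morphism (fun l : coH1 R (complement B) G => l h) by exact: hom_eval_morphism.
have starB : zmod_morphism (embed_star phi).
  exact: (class_morphism (arc := ce_arc phi) (F := fun c => Cycle1 (embed_chain_is_cycle phi c))).
have inclB : zmod_morphism (graphH1_incl AB).
  move=> c c'; apply: val_inj; rewrite raddfB /=.
  exact: (raddfB (\val : graphH1 A -> {freeg (CP2 R * line R)})).
have restrB : zmod_morphism (fun l : coH1 R (complement A) G => coH1_restrict (complement_sub AB) l).
  by move=> l l'; apply: val_inj; rewrite raddfB; apply/funext => h; exact: homB.
have homBr (l : coH1 R (complement B) G) : zmod_morphism l by exact: hom_is_zmod_morphism.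
rewrite /loop_linking /tensor_incl tensor_lift_map//.
rewrite tensor_lift_map//; last by move=> l c c'; rewrite starB homBr.
apply: tensor_ext.
- by apply: tensor_lift_is_zmod_morphism => [c|l] x y; [rewrite restrB evalB|rewrite inclB starB homBr].
- apply: tensor_lift_is_zmod_morphism; first exact: class_eval_l.
  exact: class_eval_r (restricted_cycleE phi).
move=> l c; rewrite !tensor_lift_pure.
- by rewrite /= /class_eval /embed_star H1_incl_class.
- exact: class_eval_l.
- exact: class_eval_r (restricted_cycleE phi).
- by move=> {}c x y; rewrite restrB evalB.
- by move=> {}l x y; rewrite inclB starB homBr.
Qed.

End Restriction.

(** * Additivity of the linking number over the union *)

Section Union.
Variables (R : realType) (G : zmodType).
Implicit Types A B : seq (line R).

Lemma embed_star_morphism A (phi : coherent_embedding A) : zmod_morphism (embed_star phi).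
Proof. exact: (class_morphism (arc := ce_arc phi) (F := fun c => Cycle1 (embed_chain_is_cycle phi c))). Qed.

Lemma loop_linking_morphism A (phi : coherent_embedding A) :
  zmod_morphism (fun Lam : tensor_chains A G => loop_linking phi Lam).
Proof.
move=> x y; rewrite /loop_linking.
have id_morphism : zmod_morphism (id : coH1 R (complement A) G -> _) by [].
rewrite (tensor_map_morphism id_morphism (embed_star_morphism phi)).
apply: tensor_lift_is_zmod_morphism; first by move=> h; exact: hom_eval_morphism.
by move=> l; exact: hom_is_zmod_morphism.
Qed.

Lemma loop_linkingE A (phi : coherent_embedding A) (Lam : tensor_chains A G) :
  loop_linking phi Lam =
  tensor_lift (class_eval (fun c => Cycle1 (embed_chain_is_cycle phi c))) Lam.
Proof.
have id_morphism : zmod_morphism (id : coH1 R (complement A) G -> _) by [].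
apply: (tensor_lift_map id_morphism (embed_star_morphism phi)); first by move=> h; exact: hom_eval_morphism.
by move=> l; exact: hom_is_zmod_morphism.
Qed.

(** Both embeddings give weak embeddings of the graph of A, [psi] along the identity inclusion, so
    independence of the embedding compares them. *)
Lemma loop_linking_union A B (AB : {subset A <= B}) (phi : coherent_embedding B)
    (psi : coherent_embedding A) (Lam : tensor_chains A G) :
  arrangement A -> TLG Lam -> loop_linking phi (tensor_incl AB Lam) = loop_linking psi Lam.
Proof.
move=> [Auniq notpencil] tlg.
have [L0 L0A] : exists L0, L0 \in A.
  (* The empty list is excluded because any point would lie on all of its lines, making it a
     pencil. *)
  have [A0|] := eqVneq A [::]; last by case: (A) => [//|L A'] _; exists L; exact: mem_head.
  by case: notpencil; exists (proj (const_mx 1)) => L; rewrite A0.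
rewrite loop_linking_incl loop_linkingE.
apply: (class_eval_independent Auniq L0A (restricted_embedding AB phi)
  (restricted_embedding (fun _ h => h) psi) _ _ tlg) => //.
Qed.

End Union.

Theorem theorem5p5 (R : realType) (r : nat) (A1 A2 : seq (line R))
    (arrA1 : arrangement A1) (arrA2 : arrangement A2)
    (common : common_prefix r A1 A2) (G : zmodType)
    (Lam1 : tensor_chains A1 G) (Lam2 : tensor_chains A2 G)
    (tlg1 : TLG Lam1) (tlg2 : TLG Lam2)
    (phi : coherent_embedding (ordered_union r A1 A2))
    (phi1 : coherent_embedding A1) (phi2 : coherent_embedding A2) :
  loop_linking phi (tensor_sum common Lam1 Lam2) =
    (loop_linking phi1 Lam1 + loop_linking phi2 Lam2)%R.
Proof.
rewrite -(loop_linking_union (@sub_union_l _ r A1 A2) phi phi1 arrA1 tlg1).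
rewrite -(loop_linking_union (sub_union_r common) phi phi2 arrA2 tlg2).
pose f : {additive tensor_chains (ordered_union r A1 A2) G -> G} :=
  HB.pack (fun Lam => loop_linking phi Lam) (GRing.isZmodMorphism.Build _ _ _ (@loop_linking_morphism R G _ phi)).
exact: (raddfD f).
Qed.
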